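(* Let $V$ be a finite-dimensional real normed space, $m\ge 1$ an integer, $p\ge 1$ a real number, and let $\omega$ be a control satisfying condition $(H_{p})$ (defined in the context) and $$\lim_{\delta\to 0}\ \sup_{\substack{0\le s<t\le 1\\ t-s\le\delta}}\frac{t-s}{\omega(s,t)^{1/p}}=0 .$$ Let $Y$ be an element of $C^{\omega,p}(G^{m}(V))$. Then $Y$ belongs to $C^{0,\omega,p}(G^{m}(V))$ if and only if $$\lim_{\delta\to 0}\ \sup_{\substack{0\le s<t\le 1\\ t-s\le\delta}}\frac{\left\Vert Y_{s,t}\right\Vert_m}{\omega(s,t)^{1/p}}=0 .$$
   Context: $T^{(m)}(V)=\bigoplus_{n=0}^{m}V^{\otimes n}$ is the truncated tensor algebra with (truncated) product $\otimes$; $\mathcal{G}^{m}(V)$ is its Lie subalgebra generated by $V$ for the bracket $[a,b]=a\otimes b-b\otimes a$; $G^{m}(V)=\exp(\mathcal{G}^{m}(V))$ is the free nilpotent Lie group of step $m$ over $V$, with product $\otimes$ and neutral element $1$. The dilation is $\delta_{t}(1+v_{1}+\dots+v_{m})=1+tv_{1}+\dots+t^{m}v_{m}$, $v_i\in V^{\otimes i}$, $t\in\mathbb{R}$. $\|\cdot\|_{m}$ is a fixed symmetric subadditive homogeneous norm on $G^{m}(V)$, i.e. a function $G^m(V)\to[0,\infty)$ with $\|g\|_m=0$ iff $g=1$, $\|\delta_t g\|_m=|t|\,\|g\|_m$, $\|g\otimes h\|_m\le\|g\|_m+\|h\|_m$, $\|g^{-1}\|_m=\|g\|_m$ (for instance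 the Carnot–Caratheodory norm; all such norms are equivalent since $\dim V<\infty$). Set $d_{m}(g,h)=\|g^{-1}\otimes h\|_{m}$. A $G^m(V)$-valued path is a continuous map $[0,1]\to G^{m}(V)$ starting at $1$; for such a path $Y_{s,t}:=Y_{s}^{-1}\otimes Y_{t}$. For a smooth path $y:[0,1]\to V$, the signature is $S_{m}(y)_{s,t}=1+\sum_{k=1}^{m}\int_{s<u_{1}<\dots<u_{k}<t}dy_{u_{1}}\otimes\dots\otimes dy_{u_{k}}\in G^{m}(V)$, and $S_m(y)$ denotes the $G^m(V)$-valued path $t\mapsto S_m(y)_{0,t}$. A control is a continuous function $\omega:\{(s,t):0\le s\le t\le 1\}\to[0,\infty)$ with $\omega(t,t)=0$ for all $t$ and $\omega(s,t)+\omega(t,u)\le\omega(s,u)$ for $s<t<u$. It satisfies condition $(H_p)$ if it is not identically $0$ and there is a constant $C$ such that $\frac{\omega(r,u)}{(u-r)^{p}}\le C\frac{\omega(s,t)}{(t-s)^{p}}$ for all $r<s<t<u$ in $[0,1]$. $d_{\omega,p}(x,y)=\sup_{0\le s<t\le 1}\frac{d_{m}(x_{s,t},y_{s,t})}{\omega(s,t)^{1/p}}$, $\|x\|_{\omega,p}$ is $d_{\omega,p}$ between $x$ and the constant path $1$. $C^{\omega,p}(G^{m}(V))$ is the set of $G^m(V)$-valued paths $x$ with $\|x\|_{\omega,p}<\infty$, and $C^{0,\omega,p}(G^{m}(V))$ is the $d_{\omega,p}$-closure of $\{S_{m}(x): x \text{ a smooth } V\text{-valued path}\}$. *)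

(* Defs.v *)
From HB Require Import structures.
From mathcomp Require Import all_boot all_order all_algebra.
From mathcomp Require Import all_classical all_reals all_analysis.

Set Implicit Arguments.
Unset Strict Implicit.
Unset Printing Implicit Defensive.

Import Order.TTheory GRing.Theory Num.Theory.
Import numFieldNormedType.Exports.

Local Open Scope classical_set_scope.
Local Open Scope ring_scope.

#[short(type="normedVectType")]
HB.structure Definition NormedVector (R : numFieldType) :=
  {V of NormedModule R V & Vector R V}.

(* Truncated tensor algebra over R^d. The basis e_1, ..., e_d of R^d makes the
   words of length k in the letters 0, ..., d - 1 a basis of the k-th tensor
   power; an element is the family of its coordinates on the words of length at
   most m. The product is e_u * e_v = e_(u ++ v), or 0 if size (u ++ v) > m. *)
Definition ttensor (R : Type) (d m : nat) : Type := {ffun m.-bseq 'I_d -> R}.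

HB.instance Definition _ (R : fieldType) (d m : nat) :=
  GRing.Lmodule.copy (ttensor R d m) {ffun m.-bseq 'I_d -> R^o}.

Section TruncatedTensorAlgebra.
Variables (R : fieldType) (d m : nat).
Local Notation T := (ttensor R d m).
Local Notation word := (m.-bseq 'I_d).
Implicit Types (a b c : T) (w : word).

Definition tone : T := [ffun w : word => (bseqval w == [::])%:R].

Definition tmul a b : T :=
  [ffun w : word => \sum_(uv : word * word | uv.1 ++ uv.2 == w :> seq _)
               a uv.1 * b uv.2].

Let addE a b w : (a + b) w = a w + b w. Proof. by rewrite ffunE. Qed.

Let scaleE (k : R) a w : (k *: a) w = k * a w. Proof. by rewrite ffunE. Qed.

Lemma tmulA : associative tmul.
Proof.
move=> a b c; apply/ffunP => w; rewrite !ffunE.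
under eq_bigr do rewrite ffunE big_distrr /=.
under [RHS]eq_bigr do rewrite ffunE big_distrl /=.
pose F (u x v : word) : R := if u ++ x ++ v == w :> seq _ then a u * (b x * c v) else 0.
transitivity (\sum_u \sum_x \sum_v F u x v).
  rewrite [LHS]big_mkcond /= -(pair_bigA _ (fun u z : word =>
    if u ++ z == w :> seq _ then \sum_(i : word * word | i.1 ++ i.2 == z :> seq _)
      a u * (b i.1 * c i.2) else 0)) /=.
  apply: eq_bigr => u _.
  rewrite -big_mkcond /= (exchange_big_dep predT) //= pair_bigA /=.
  apply: eq_bigr => -[x v] _ /=; rewrite /F.
  case: ifPn => [/eqP uxvw|uxvw].
    have sxv : (size (x ++ v) <= m)%N.
      by rewrite (leq_trans (leq_addl (size u) _)) // -size_cat uxvw size_bseq.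
    rewrite (big_pred1 (Bseq sxv)) // => z /=.
    apply/andP/eqP => [[_ /eqP xvz]|->]; first exact/val_inj.
    by rewrite /= uxvw.
  rewrite big1 // => z /andP[/eqP uzw /eqP xvz].
  by rewrite xvz uzw eqxx in uxvw.
symmetry.
rewrite [LHS]big_mkcond /= -(pair_bigA _ (fun z v : word =>
    if z ++ v == w :> seq _ then \sum_(i : word * word | i.1 ++ i.2 == z :> seq _)
      a i.1 * b i.2 * c v else 0)) /=.
rewrite exchange_big /=.
under [RHS]eq_bigr do rewrite exchange_big /=.
rewrite [RHS]exchange_big /=.
apply: eq_bigr => v _.
rewrite -big_mkcond /= (exchange_big_dep predT) //= pair_bigA /=.
apply: eq_bigr => -[u x] _ /=; rewrite /F.
case: ifPn => [/eqP uxvw|uxvw].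
  have sux : (size (u ++ x) <= m)%N.
    by rewrite (leq_trans (leq_addr (size v) _)) // -size_cat -catA uxvw size_bseq.
  rewrite (big_pred1 (Bseq sux)) ?mulrA // => z /=.
  apply/andP/eqP => [[_ /eqP xvz]|->]; first exact/val_inj.
  by rewrite /= -catA uxvw.
rewrite big1 // => z /andP[/eqP uzw /eqP xvz].
by rewrite catA xvz uzw eqxx in uxvw.
Qed.

Lemma tmul1l : left_id tone tmul.
Proof.
move=> a; apply/ffunP => w; rewrite !ffunE (bigD1 ([bseq], w)) //=.
rewrite ffunE eqxx mul1r big1 ?addr0 // => -[u v] /= /andP[/eqP uvw neq].
rewrite ffunE; case: eqP => [u0|_]; last by rewrite mul0r.
case/negP: neq; apply/eqP; congr pair; apply: val_inj => //=.
by rewrite -uvw u0.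
Qed.

Lemma tmul1r : right_id tone tmul.
Proof.
move=> a; apply/ffunP => w; rewrite !ffunE (bigD1 (w, [bseq])) /= ?cats0 //.
rewrite ffunE eqxx mulr1 big1 ?addr0 // => -[u v] /= /andP[/eqP uvw neq].
rewrite ffunE; case: eqP => [v0|_]; last by rewrite mulr0.
case/negP: neq; apply/eqP; congr pair; apply: val_inj => //=.
by rewrite -uvw v0 cats0.
Qed.

Lemma tmulDl : left_distributive tmul +%R.
Proof.
move=> a b c; apply/ffunP => w; rewrite !ffunE -big_split /=.
by apply: eq_bigr => uv _; rewrite ffunE mulrDl.
Qed.

Lemma tmulDr : right_distributive tmul +%R.
Proof.
move=> a b c; apply/ffunP => w; rewrite !ffunE -big_split /=.
by apply: eq_bigr => uv _; rewrite ffunE mulrDr.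
Qed.

Lemma tone_neq0 : tone != 0.
Proof.
by apply/eqP => /ffunP/(_ [bseq])/eqP; rewrite !ffunE eqxx oner_eq0.
Qed.

HB.instance Definition _ := GRing.Zmodule_isNzRing.Build T
  tmulA tmul1l tmul1r tmulDl tmulDr tone_neq0.

Lemma tscalerAl (k : R) a b : k *: (a * b) = (k *: a) * b.
Proof.
apply/ffunP => w; rewrite scaleE !ffunE big_distrr /=.
by apply: eq_bigr => uv _; rewrite scaleE mulrA.
Qed.

HB.instance Definition _ := GRing.Lmodule_isLalgebra.Build R T tscalerAl.

Lemma tscalerAr (k : R) a b : k *: (a * b) = a * (k *: b).
Proof.
apply/ffunP => w; rewrite scaleE !ffunE big_distrr /=.
by apply: eq_bigr => uv _; rewrite scaleE mulrCA.
Qed.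

HB.instance Definition _ := GRing.Lalgebra_isAlgebra.Build R T tscalerAr.

Lemma tmul_nil a b : (a * b) [bseq] = a [bseq] * b [bseq].
Proof.
rewrite ffunE (big_pred1 ([bseq], [bseq])) // => -[u v] /=.
rewrite -size_eq0 size_cat addn_eq0 !size_eq0.
by apply/andP/eqP => [[/eqP u0 /eqP v0]|[-> ->//]]; congr pair; apply: val_inj.
Qed.

Lemma tone_nil : (1 : T) [bseq] = 1. Proof. by rewrite ffunE eqxx. Qed.

Lemma texpr_small a k w : a [bseq] = 0 -> (size w < k)%N -> (a ^+ k) w = 0.
Proof.
move=> a0; elim: k w => // k IH w; rewrite ltnS => wk.
rewrite exprS ffunE big1 // => -[u v] /= /eqP uvw.
have [u0|u0] := eqVneq (bseqval u) [::].
  by rewrite (_ : u = [bseq]) ?a0 ?mul0r //; exact: val_inj.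
rewrite IH ?mulr0 //; apply: leq_trans wk.
by rewrite -uvw size_cat -[X in (X < _)%N]add0n ltn_add2r lt0n size_eq0.
Qed.

Lemma texpr_nilpotent a : a [bseq] = 0 -> a ^+ m.+1 = 0.
Proof.
move=> a0; apply/ffunP => w.
by rewrite texpr_small ?ltnS ?size_bseq // ffunE.
Qed.

Definition tunit : pred T := fun a => a [bseq] != 0.

Definition tinv a : T :=
  if tunit a then
    let c := a [bseq] in c^-1 *: \sum_(k < m.+1) (1 - c^-1 *: a) ^+ k
  else a.

Lemma tgeom a : tunit a ->
  (a [bseq])^-1 *: a * \sum_(k < m.+1) (1 - (a [bseq])^-1 *: a) ^+ k = 1.
Proof.
move=> ua; set b := _ *: a.
have b0 : (1 - b) [bseq] = 0.
  rewrite [LHS]ffunE [X in _ + X]ffunE /b scaleE mulVf //.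
  by rewrite tone_nil subrr.
have := subrX1 (1 - b) m.+1; rewrite texpr_nilpotent // sub0r addrAC subrr sub0r.
by rewrite mulNr => /oppr_inj.
Qed.

Lemma tgeomC a (c : R) n : GRing.comm a (\sum_(k < n) (1 - c *: a) ^+ k).
Proof.
apply: commr_sum => k _; apply: commrX; apply: commrB; first exact: commr1.
by rewrite /GRing.comm -tscalerAl -tscalerAr.
Qed.

Lemma tmulrV : {in tunit, right_inverse 1 tinv *%R}.
Proof.
by move=> a ua; rewrite /tinv (ua : tunit a) -tscalerAr tscalerAl tgeom.
Qed.

Lemma tmulVr : {in tunit, left_inverse 1 tinv *%R}.
Proof.
move=> a ua; rewrite -[RHS](tmulrV ua) /tinv (ua : tunit a).
by rewrite -tscalerAl -tscalerAr tgeomC.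
Qed.

Lemma tunitP a b : b * a = 1 /\ a * b = 1 -> tunit a.
Proof.
case=> _ /(congr1 (fun f : T => f [bseq])); rewrite tmul_nil tone_nil => ab1.
by apply/eqP => a0; move/eqP: ab1; rewrite a0 mul0r eq_sym oner_eq0.
Qed.

Lemma tinv_out : {in [predC tunit], tinv =1 id}.
Proof. by move=> a; rewrite inE /= /tinv => /negbTE ua; rewrite [tunit a]ua. Qed.

HB.instance Definition _ :=
  GRing.NzRing_hasMulInverse.Build T tmulVr tmulrV tunitP tinv_out.

(* On elements without scalar part, m.+1-st powers vanish, so that this is the
   full exponential series. *)
Definition texp a : T := \sum_(k < m.+1) (k`!%:R)^-1 *: a ^+ k.

Definition dilation (t : R) a : T := [ffun w : word => t ^+ size w * a w].

Definition lie_subalgebra (L : set T) : Prop :=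
  [/\ L 0,
      forall a b, L a -> L b -> L (a + b),
      forall (k : R) a, L a -> L (k *: a) &
      forall a b, L a -> L b -> L (a * b - b * a)].

End TruncatedTensorAlgebra.

Section FreeNilpotentGroup.
Variables (R : realType) (V : normedVectType R) (m : nat).
(* The truncated tensor algebra of V, in the coordinates of vbasis {:V}. *)
Local Notation T := (ttensor R (\dim {:V}) m).
Local Notation word := (m.-bseq 'I_(\dim {:V})).
Implicit Types (N : T -> R) (g h : T).

Definition tinj (v : V) : T :=
  [ffun w : word =>
     (if bseqval w is [:: i] then coord (vbasis {:V}) i v else 0) : R].

Definition free_lie : set T :=
  smallest (@lie_subalgebra R (\dim {:V}) m) (range tinj).

Definition free_nilpotent : set T := @texp R (\dim {:V}) m @` free_lie.

(* The values of N outside free_nilpotent are irrelevant. *)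
Definition homogeneous_norm N : Prop :=
  let G := free_nilpotent in
  [/\ forall g, G g -> 0 <= N g,
      forall g, G g -> (N g = 0 <-> g = 1),
      forall (t : R) g, G g -> N (dilation t g) = `|t| * N g,
      forall g h, G g -> G h -> N (g * h) <= N g + N h &
      forall g, G g -> N g^-1 = N g].

Definition hdist N g h : R := N (g^-1 * h).

(* A path on [0, 1] is represented by any function on R that restricts to it;
   the topology of T is that of its coordinates. *)
Definition group_path (Y : R -> T) : Prop :=
  [/\ Y 0 = 1,
      forall t : R, 0 <= t <= 1 -> free_nilpotent (Y t) &
      forall w : word, {within `[0, 1], continuous (fun t : R => Y t w)}].

Definition path_incr (Y : R -> T) (s t : R) : T := (Y s)^-1 * Y t.

(* A smooth path on [0, 1] is the restriction of a smooth function on R. *)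
Definition smooth (y : R -> V) : Prop :=
  forall (n : nat) (t : R), derivable (derive1n n y) t 1.

Definition tintegral (s t : R) (F : R -> T) : T :=
  [ffun w : word => \int[lebesgue_measure]_(u in `[s, t]) F u w].

(* Level k is the integral of dy_(u_1) ... dy_(u_k) over s < u_1 < ... < u_k < t,
   the outermost integration being in u_k. *)
Fixpoint iterated_integral (y : R -> V) (k : nat) (s t : R) : T :=
  if k is k'.+1 then
    tintegral s t (fun u => iterated_integral y k' s u * tinj (derive1 y u))
  else 1.

Definition signature (y : R -> V) (s t : R) : T :=
  \sum_(k < m.+1) iterated_integral y k s t.

End FreeNilpotentGroup.

Section Control.
Variable R : realType.
Implicit Types (omega : R -> R -> R) (p : R).

Definition control omega : Prop :=
  [/\ {within [set st : R * R | 0 <= st.1 <= st.2 /\ st.2 <= 1],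
         continuous (fun st : R * R => omega st.1 st.2)},
      forall s t : R, 0 <= s -> s <= t -> t <= 1 -> 0 <= omega s t,
      forall t : R, 0 <= t <= 1 -> omega t t = 0 &
      forall s t u : R, 0 <= s -> s < t -> t < u -> u <= 1 ->
        omega s t + omega t u <= omega s u].

Definition condition_H p omega : Prop :=
  (exists s t : R, [/\ 0 <= s, s <= t, t <= 1 & omega s t != 0]) /\
  exists C : R, forall r s t u : R,
    0 <= r -> r < s -> s < t -> t < u -> u <= 1 ->
    omega r u / (u - r) `^ p <= C * (omega s t / (t - s) `^ p).

Lemma condition_H_gt0 p omega : control omega -> condition_H p omega ->
  forall s t, 0 <= s -> s < t -> t <= 1 -> 0 < omega s t.
Proof.
move=> [_ ge0 diag super] [[s0 [t0 [s00 st0 t01 nz]]] [C HC]] s t s_ge0 st t1.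
rewrite lt_neqAle ge0 ?(ltW st) // andbT eq_sym; apply/eqP => wst0.
pose a := s + (t - s) / 3; pose b := s + (t - s) / 3 *+ 2.
have d0 : 0 < (t - s) / 3 by rewrite divr_gt0 ?subr_gt0.
have sa : s < a by rewrite ltrDl.
have ab : a < b by rewrite /a /b ltrD2l mulr2n ltrDl.
have bt : b < t.
  have -> : t = s + (t - s) / 3 *+ 3.
    by rewrite -[_ *+ 3]mulr_natr mulfVK ?pnatr_eq0 // addrC subrK.
  by rewrite /b ltrD2l [ltRHS]mulrS ltrDr.
have b1 := le_trans (ltW bt) t1.
have wab : omega a b = 0.
  apply/eqP; rewrite eq_le ge0 ?(ltW ab) ?(le_trans s_ge0 (ltW sa)) // andbT.
  have h1 := super _ _ _ s_ge0 sa ab b1.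
  have h2 := super _ _ _ s_ge0 (lt_trans sa ab) bt t1.
  have p1 := ge0 _ _ s_ge0 (ltW sa) (le_trans (ltW ab) b1).
  have p2 := ge0 _ _ (le_trans s_ge0 (ltW (lt_trans sa ab))) (ltW bt) t1.
  rewrite -wst0; apply: le_trans h2; apply: (@le_trans _ _ (omega s b)).
    by apply: le_trans h1; rewrite lerDr.
  by rewrite lerDl.
have w01 : omega 0 1 = 0.
  apply/eqP; rewrite eq_le ge0 // andbT.
  have := HC 0 a b 1 (lexx _) (le_lt_trans s_ge0 sa) ab (lt_le_trans bt t1) (lexx _).
  by rewrite wab mul0r mulr0 subr0 powR1 divr1.
have w0 u : 0 <= u -> u <= 1 -> omega 0 u = 0.
  rewrite le_eqVlt => /predU1P[<- _|u0]; first by rewrite diag ?lexx ?ler01.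
  rewrite le_eqVlt => /predU1P[-> //|u1].
  have := super _ _ _ (lexx _) u0 u1 (lexx _); rewrite w01 => h.
  apply/eqP; rewrite eq_le ge0 ?(ltW u0) ?(ltW u1) // andbT.
  by apply: le_trans h; rewrite lerDl ge0 ?(ltW u0) ?(ltW u1).
case/negP: nz; move: s00; rewrite le_eqVlt => /predU1P[s00|s00].
  by rewrite -s00 w0 // s00.
move: st0; rewrite le_eqVlt => /predU1P[st0|st0].
  by rewrite -st0 diag // (ltW s00) st0.
have := super _ _ _ (lexx _) s00 st0 t01.
have st1 := le_trans (ltW st0) t01; have t00 := lt_trans s00 st0.
rewrite !w0 ?(ltW t00) ?(ltW s00) // add0r.
by move=> h; rewrite eq_le h ge0 ?(ltW st0) ?(ltW s00).
Qed.

(* lim_(delta -> 0) sup_(0 <= s < t <= 1, t - s <= delta) F s t = 0 *)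
Definition vanishes_near_diag (F : R -> R -> R) : Prop :=
  ereal_sup [set (F st.1 st.2)%:E | st in
    [set st : R * R | [/\ 0 <= st.1, st.1 < st.2, st.2 <= 1 &
                         st.2 - st.1 <= delta]]] @[delta --> 0^'+] --> 0%E.

End Control.

Section PathSpaces.
Variables (R : realType) (V : normedVectType R) (m : nat).
Local Notation T := (ttensor R (\dim {:V}) m).
Variables (N : T -> R) (omega : R -> R -> R) (p : R).
Implicit Types X Y : R -> T.

(* Division by 0 returns 0, but omega s t > 0 for s < t by condition_H_gt0. *)
Definition dist_omega X Y : \bar R :=
  ereal_sup [set (hdist N (path_incr X st.1 st.2) (path_incr Y st.1 st.2)
                  / omega st.1 st.2 `^ p^-1)%:E | st in
    [set st : R * R | [/\ 0 <= st.1, st.1 < st.2 & st.2 <= 1]]].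

Definition norm_omega X : \bar R := dist_omega X (cst 1).

Definition C_omega : set (R -> T) :=
  [set X | group_path X /\ (norm_omega X < +oo)%E].

Definition C0_omega : set (R -> T) :=
  [set X | group_path X /\
    forall eps : R, 0 < eps -> exists2 x : R -> V, smooth x &
      (dist_omega X (signature m x 0) < eps%:E)%E].

End PathSpaces.

(* Main.v *)
(* Let E be the derivation of T^m(V) that multiplies level k by k, let Theta be
   the algebra morphism from T^m(V) to its linear endomorphisms that sends a
   letter to its adjoint action, and let D send a word to its iterated bracket.
   Then G^m(V) = exp(L) is the set of the g with scalar part 1 such that
   Theta(g) z * g = g * z for all z and E g = D(g) * g. These equations are
   stable under products and limits, and a solution of h' = a h with a in L and
   h(0) = 1 satisfies them, so that signatures are in G^m(V) without the
   Baker-Campbell-Hausdorff formula.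

   Since E g = D(g) * g exhibits the first nonzero level of g - 1 as a
   combination of brackets, every g with |g_w| <= lam^|w| is a product of boundedly
   many exp(c e_i) with |c| <= C lam (Chow). Hence N g <= C lam; then N is
   continuous, and compactness gives |g_w| <= (C' N g)^|w|.

   If Y is within eps of the signature of a smooth path x, then N Y_(s,t) is at
   most a multiple of (t - s) plus eps omega(s,t)^(1/p). Conversely, let x follow
   on each interval I of a subdivision of mesh 1/n the segments that the Chow
   factorization attaches to Y_I, with smooth reparametrizations: its signature
   agrees with Y on the grid, and (H_p) bounds its increments inside I by those
   of Y. Close to the diagonal both increments are small; far from it, their
   quotient is, up to small factors, a conjugate of a small element by a bounded
   one, and omega(s,t)^(1/p) is bounded below. *)
Require Import Defs.
From mathcomp Require Import all_boot all_order all_algebra.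
From mathcomp Require Import all_classical all_reals all_analysis.
From mathcomp Require Import ring lra.
Set Implicit Arguments.
Unset Strict Implicit.
Unset Printing Implicit Defensive.
Import Order.TTheory GRing.Theory Num.Theory.
Import numFieldNormedType.Exports.
Local Open Scope classical_set_scope.
Local Open Scope ring_scope.

(** The maps E, Theta and D are [tdeg], [tact] and [dynkin]. E generates the dilations, so E g =
    D(g) * g says that D(g) is the logarithmic derivative of g along them: it is the
    Dynkin-Specht-Wever identity in group form. N is known only on G^m(V), so every increment,
    conjugate and limit must be shown to lie in the group before N is applied to it; equations make
    this cheap. As words have length at most m, the differential equations are triangular and are
    solved by induction on length. The final case distinction is forced by conjugation: for bounded
    h, N(h^-1 a h) is in general not bounded by a multiple of N(a), only by a modulus of continuity.
    Conjugating thus yields an absolute error, which is harmless only where omega(s,t)^(1/p) is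
    bounded below; elsewhere the triangle inequality must do. Hence the threshold d1 between near
    and far is fixed before the mesh. (H_p) enters through one inequality: omega^(1/p) of a
    subinterval is at least a fixed multiple of its proportional share of omega^(1/p) of the cell.
    This matches a path that crosses each cell at speed bounded by a multiple of N(Y_I) / |I|. *)

Section WordBasis.
Variables (R : fieldType) (d m : nat).
Local Notation T := (ttensor R d m).
Local Notation word := (m.-bseq 'I_d).
Implicit Types (k t : R) (a b c g h x y z : T) (w : word) (s u v : seq 'I_d).

(** * Coordinates, the basis of words and the filtration by degree *)

Lemma taddE a b w : (a + b) w = a w + b w. Proof. by rewrite ffunE. Qed.
Lemma toppE a w : (- a) w = - a w. Proof. by rewrite ffunE. Qed.
Lemma tsubE a b w : (a - b) w = a w - b w. Proof. by rewrite taddE toppE. Qed.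
Lemma tscaleE (k : R) a w : (k *: a) w = k * a w. Proof. by rewrite ffunE. Qed.
Lemma tzeroE w : (0 : T) w = 0. Proof. by rewrite ffunE. Qed.
Lemma toneE w : (1 : T) w = (bseqval w == [::])%:R. Proof. by rewrite ffunE. Qed.
Lemma tmulE a b w : (a * b) w =
  \sum_(uv : word * word | uv.1 ++ uv.2 == w :> seq _) a uv.1 * b uv.2.
Proof. by rewrite ffunE. Qed.

Lemma tsumE (I : Type) (r : seq I) (P : pred I) (F : I -> T) w :
  (\sum_(i <- r | P i) F i) w = \sum_(i <- r | P i) F i w.
Proof.
elim/big_rec2: _ => [|i x y _ <-]; first exact: tzeroE.
exact: taddE.
Qed.

(** Indexed by all sequences, with value 0 on those longer than m: concatenation is then total, and
    truncation is built into [tbasisM]. *)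
Definition tbasis s : T := [ffun w : word => (bseqval w == s)%:R].

Lemma tbasisE s w : tbasis s w = (bseqval w == s)%:R.
Proof. by rewrite ffunE. Qed.

Lemma tbasis_big s : (m < size s)%N -> tbasis s = 0.
Proof.
move=> ms; apply/ffunP => w; rewrite tbasisE tzeroE.
by case: eqP => // ws; move: (size_bseq w); rewrite ws leqNgt ms.
Qed.

Lemma tbasis_expand a : a = \sum_w a w *: tbasis w.
Proof.
apply/ffunP => w; rewrite tsumE (bigD1 w) //= tscaleE tbasisE eqxx mulr1.
rewrite big1 ?addr0 // => u uw; rewrite tscaleE tbasisE.
by case: eqP => [/val_inj wu|]; [rewrite wu eqxx in uw|rewrite mulr0].
Qed.

Lemma tbasis0 : tbasis [::] = 1.
Proof. by apply/ffunP => w; rewrite tbasisE. Qed.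

Lemma tbasisM u v : tbasis u * tbasis v = tbasis (u ++ v).
Proof.
apply/ffunP => w; rewrite tmulE tbasisE.
have [wuv|wuv] := eqVneq (bseqval w) (u ++ v).
  have uv_le : (size u + size v <= m)%N by rewrite -size_cat -wuv size_bseq.
  have su := leq_trans (leq_addr _ _) uv_le.
  have sv := leq_trans (leq_addl _ _) uv_le.
  rewrite (bigD1 (Bseq su, Bseq sv)) /= ?wuv // !tbasisE !eqxx mulr1.
  rewrite big1 ?addr0 // => -[x y] /= /andP[/eqP xyw]; apply: contraNeq.
  rewrite !tbasisE; have [xu|_] := eqVneq (bseqval x) u; last by rewrite mul0r eqxx.
  have [yv _|_] := eqVneq (bseqval y) v; last by rewrite mulr0 eqxx.
  by apply/eqP; congr pair; apply: val_inj.
rewrite big1 // => -[x y] /= /eqP xyw; rewrite !tbasisE.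
case: eqP => [xu|_]; last by rewrite mul0r.
case: eqP => [yv|_]; last by rewrite mulr0.
by rewrite -xyw xu yv eqxx in wuv.
Qed.

(** The ideal of tensors that start at level n or later; logarithms and commutators are computed
    below modulo these ideals. *)
Definition tord n a := forall w, (size w < n)%N -> a w = 0.

Lemma tord_ge n n' a : (n' <= n)%N -> tord n a -> tord n' a.
Proof. by move=> nn an w /leq_trans/(_ nn)/an. Qed.

Lemma tord_eq0 n a : (m < n)%N -> tord n a -> a = 0.
Proof.
move=> mn an; apply/ffunP => w; rewrite tzeroE an //.
exact: leq_ltn_trans (size_bseq w) mn.
Qed.

Lemma tordD n a b : tord n a -> tord n b -> tord n (a + b).
Proof. by move=> an bn w wn; rewrite taddE an ?bn ?addr0. Qed.

Lemma tordN n a : tord n a -> tord n (- a).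
Proof. by move=> an w wn; rewrite toppE an ?oppr0. Qed.

Lemma tordB n a b : tord n a -> tord n b -> tord n (a - b).
Proof. by move=> an bn; apply: tordD => //; apply: tordN. Qed.

Lemma tordZ n k a : tord n a -> tord n (k *: a).
Proof. by move=> an w wn; rewrite tscaleE an ?mulr0. Qed.

Lemma tord_sum n (I : Type) (r : seq I) (P : pred I) (F : I -> T) :
  (forall i, P i -> tord n (F i)) -> tord n (\sum_(i <- r | P i) F i).
Proof.
move=> Fn; elim/big_ind: _ => // [w _|]; first exact: tzeroE.
exact: tordD.
Qed.

Lemma tord1P a : tord 1 a <-> a [bseq] = 0.
Proof.
split=> [/(_ [bseq])|a0 w]; first by move->.
by rewrite ltnS leqn0 size_eq0 => /eqP w0; rewrite -a0; congr (a _); apply: val_inj.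
Qed.

Lemma tordM (n l : nat) a b : tord n a -> tord l b -> tord (n + l) (a * b).
Proof.
move=> an bk w wnk; rewrite tmulE big1 // => -[u v] /= /eqP uvw.
have [un|nu] := ltnP (size u) n; first by rewrite an ?mul0r.
rewrite bk ?mulr0 // ltnNge; apply: contraL wnk => kv.
by rewrite -leqNgt -uvw size_cat leq_add.
Qed.

Lemma tord_basis s : tord (size s) (tbasis s).
Proof. by move=> w ws; rewrite tbasisE; case: eqP ws => // ->; rewrite ltnn. Qed.

(** * Brackets, the derivation E, the action Theta and the Dynkin map D *)

Definition tcomm a b := a * b - b * a.

Lemma tcommZl k a z : tcomm (k *: a) z = k *: tcomm a z.
Proof. by rewrite /tcomm -scalerAl -scalerAr scalerBr. Qed.
Lemma tcommZr k a z : tcomm z (k *: a) = k *: tcomm z a.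
Proof. by rewrite /tcomm -scalerAl -scalerAr scalerBr. Qed.
Lemma tcommDl a b z : tcomm (a + b) z = tcomm a z + tcomm b z.
Proof. by rewrite /tcomm mulrDl mulrDr opprD addrACA. Qed.
Lemma tcommDr a b z : tcomm z (a + b) = tcomm z a + tcomm z b.
Proof. by rewrite /tcomm mulrDl mulrDr opprD addrACA. Qed.

Lemma tcommBl a b z : tcomm (a - b) z = tcomm a z - tcomm b z.
Proof. by rewrite -scaleN1r tcommDl tcommZl scaleN1r. Qed.
Lemma tcommBr a b z : tcomm z (a - b) = tcomm z a - tcomm z b.
Proof. by rewrite -scaleN1r tcommDr tcommZr scaleN1r. Qed.

Lemma tord_comm (n l : nat) a b : tord n a -> tord l b -> tord (n + l) (tcomm a b).
Proof. by move=> an bk; apply: tordB; last rewrite addnC; apply: tordM. Qed.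

Definition tdeg a : T := [ffun w : word => (size w)%:R * a w].

Lemma tdegE a w : tdeg a w = (size w)%:R * a w. Proof. by rewrite ffunE. Qed.

Lemma tdegD a b : tdeg (a + b) = tdeg a + tdeg b.
Proof. by apply/ffunP => w; rewrite tdegE !taddE !tdegE mulrDr. Qed.

Lemma tdegZ k a : tdeg (k *: a) = k *: tdeg a.
Proof. by apply/ffunP => w; rewrite tdegE !tscaleE !tdegE mulrCA. Qed.

Lemma tdegB a b : tdeg (a - b) = tdeg a - tdeg b.
Proof. by rewrite tdegD -scaleN1r tdegZ scaleN1r. Qed.

Lemma tdeg1 : tdeg 1 = 0.
Proof.
apply/ffunP => w; rewrite tdegE toneE tzeroE.
by case: eqP => [->|_]; rewrite ?mul0r ?mulr0.
Qed.

Lemma tdegM a b : tdeg (a * b) = tdeg a * b + a * tdeg b.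
Proof.
apply/ffunP => w; rewrite tdegE taddE !tmulE mulr_sumr -big_split /=.
apply: eq_bigr => -[u v] /= /eqP <-.
by rewrite size_cat natrD !tdegE mulrDl mulrA [a u * (_ * _)]mulrCA.
Qed.

Definition adw s z := foldr (fun i => tcomm (tbasis [:: i])) z s.

Lemma adw_cat u v z : adw (u ++ v) z = adw u (adw v z).
Proof. exact: foldr_cat. Qed.

Lemma adwD s a b : adw s (a + b) = adw s a + adw s b.
Proof. by elim: s => //= i s ->; rewrite tcommDr. Qed.

Lemma adwZ s k a : adw s (k *: a) = k *: adw s a.
Proof. by elim: s => //= i s ->; rewrite tcommZr. Qed.

Lemma tord_adw s n z : tord n z -> tord (size s + n) (adw s z).
Proof.
move=> zn; elim: s => //= i s IH; rewrite -add1n -addnA.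
by apply: tord_comm => //; exact: (@tord_basis [:: i]).
Qed.

Lemma adw_big s z : (m < size s)%N -> adw s z = 0.
Proof.
move=> ms; apply: (@tord_eq0 (size s + 0)); first by rewrite addn0.
exact: tord_adw.
Qed.

Definition tact a z := \sum_w a w *: adw w z.

Lemma tactDl a b z : tact (a + b) z = tact a z + tact b z.
Proof. by rewrite -big_split; apply: eq_bigr => w _; rewrite taddE scalerDl. Qed.
Lemma tactZl k a z : tact (k *: a) z = k *: tact a z.
Proof. by rewrite scaler_sumr; apply: eq_bigr => w _; rewrite tscaleE scalerA. Qed.
Lemma tactDr a y z : tact a (y + z) = tact a y + tact a z.
Proof. by rewrite -big_split; apply: eq_bigr => w _; rewrite adwD scalerDr. Qed.
Lemma tactZr k a z : tact a (k *: z) = k *: tact a z.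
Proof.
by rewrite scaler_sumr; apply: eq_bigr => w _; rewrite adwZ !scalerA mulrC.
Qed.
Lemma tact0l z : tact 0 z = 0.
Proof. by rewrite -(scale0r 0) tactZl !scale0r. Qed.
Lemma tact0r a : tact a 0 = 0.
Proof. by rewrite -(scale0r 0) tactZr !scale0r. Qed.
Lemma tactBl a b z : tact (a - b) z = tact a z - tact b z.
Proof. by rewrite tactDl -scaleN1r tactZl scaleN1r. Qed.
Lemma tact_suml (I : Type) (r : seq I) (P : pred I) (F : I -> T) z :
  tact (\sum_(i <- r | P i) F i) z = \sum_(i <- r | P i) tact (F i) z.
Proof. by apply: (big_morph (tact^~ z) _ (tact0l z)) => x y; apply: tactDl. Qed.

Lemma tact_sumr (I : Type) (r : seq I) (P : pred I) (F : I -> T) a :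
  tact a (\sum_(i <- r | P i) F i) = \sum_(i <- r | P i) tact a (F i).
Proof. by apply: (big_morph _ (tactDr a) (tact0r a)). Qed.

Lemma tact_basis s z : tact (tbasis s) z = adw s z.
Proof.
have [ms|ms] := ltnP m (size s).
  by rewrite tbasis_big // tact0l adw_big.
rewrite /tact (bigD1 (Bseq ms)) //= tbasisE eqxx scale1r big1 ?addr0 // => w /eqP wn.
rewrite tbasisE; have [ws|_] := eqVneq (bseqval w) s; last by rewrite scale0r.
by case: wn; apply: val_inj.
Qed.

Lemma tact1 z : tact 1 z = z.
Proof. by rewrite -tbasis0 tact_basis. Qed.

(** Truncating the product a * b loses nothing, because the adjoint action of a word longer than m
    vanishes ([adw_big]). *)
Lemma tactM a b z : tact (a * b) z = tact a (tact b z).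
Proof.
rewrite (tbasis_expand a) (tbasis_expand b) mulr_suml !tact_suml.
apply: eq_bigr => u _; rewrite mulr_sumr !tact_suml tact_sumr.
apply: eq_bigr => v _.
by rewrite -scalerAl -scalerAr !tactZl tbasisM !tact_basis adw_cat adwZ.
Qed.

(** The bracket nested to the right. Its value 0 on the empty word makes D kill scalars, and is the
    reason why [brw_cat] asks for a nonempty second word. *)
Fixpoint brw s : T :=
  if s is i :: v then
    if v is [::] then tbasis [:: i] else tcomm (tbasis [:: i]) (brw v)
  else 0.

Lemma brw_cat u v : v != [::] -> brw (u ++ v) = adw u (brw v).
Proof.
move=> v0; elim: u => //= i u <-.
by case: u => //=; case: v v0.
Qed.

Lemma tord_brw s : tord (size s) (brw s).
Proof.
case/lastP: s => // s i; rewrite -cats1 brw_cat // size_cat.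
by apply: tord_adw; exact: (@tord_basis [:: i]).
Qed.

Definition dynkin a := \sum_w a w *: brw w.

Lemma dynkinD a b : dynkin (a + b) = dynkin a + dynkin b.
Proof. by rewrite -big_split; apply: eq_bigr => w _; rewrite taddE scalerDl. Qed.
Lemma dynkinZ k a : dynkin (k *: a) = k *: dynkin a.
Proof. by rewrite scaler_sumr; apply: eq_bigr => w _; rewrite tscaleE scalerA. Qed.
Lemma dynkin0 : dynkin 0 = 0.
Proof. by rewrite -(scale0r 0) dynkinZ !scale0r. Qed.
Lemma dynkinB a b : dynkin (a - b) = dynkin a - dynkin b.
Proof. by rewrite dynkinD -scaleN1r dynkinZ scaleN1r. Qed.
Lemma dynkin_sum (I : Type) (r : seq I) (P : pred I) (F : I -> T) :
  dynkin (\sum_(i <- r | P i) F i) = \sum_(i <- r | P i) dynkin (F i).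
Proof. by apply: (big_morph _ dynkinD dynkin0). Qed.

Lemma dynkin_basis s : dynkin (tbasis s) = brw s.
Proof.
have [ms|ms] := ltnP m (size s).
  by rewrite tbasis_big // dynkin0 (tord_eq0 ms (@tord_brw s)).
rewrite /dynkin (bigD1 (Bseq ms)) //= tbasisE eqxx scale1r big1 ?addr0 // => w /eqP wn.
rewrite tbasisE; have [ws|_] := eqVneq (bseqval w) s; last by rewrite scale0r.
by case: wn; apply: val_inj.
Qed.

Lemma dynkin1 : dynkin 1 = 0.
Proof. by rewrite -tbasis0 dynkin_basis. Qed.

Lemma dynkinM a b : b [bseq] = 0 -> dynkin (a * b) = tact a (dynkin b).
Proof.
move=> b0; rewrite (tbasis_expand a) (tbasis_expand b) mulr_suml tact_suml dynkin_sum.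
apply: eq_bigr => u _; rewrite mulr_sumr !dynkin_sum tact_sumr.
apply: eq_bigr => v _; rewrite -scalerAl -scalerAr !dynkinZ tactZl tactZr.
rewrite tbasisM !dynkin_basis tact_basis; have [v0|v0] := eqVneq (bseqval v) [::].
  by rewrite (_ : v = [bseq]) ?b0 ?scale0r ?scaler0 //; exact: val_inj.
by rewrite brw_cat.
Qed.

(** The cocycle identity of D for the action Theta. The summand D(g) comes from the empty word of h,
    which [dynkinM] has to exclude. *)
Lemma dynkinMD g h : h [bseq] = 1 -> dynkin (g * h) = tact g (dynkin h) + dynkin g.
Proof.
move=> h1; rewrite -{1}(subrK 1 h) mulrDr mulr1 dynkinD dynkinM.
  by rewrite dynkinB dynkin1 subr0.
by rewrite tsubE h1 toneE eqxx subrr.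
Qed.

(* By the Dynkin-Specht-Wever lemma these identities hold on Lie elements. *)
Definition lielike a :=
  [/\ a [bseq] = 0, forall z, tact a z = tcomm a z & dynkin a = tdeg a].

(** For a bracket, D(ab - ba) = Theta(a) D(b) - Theta(b) D(a) = [a, E b] - [b, E a], which is E(ab -
    ba) by the Leibniz rule. *)
Lemma lielike_subalgebra : lie_subalgebra (lielike : set T).
Proof.
split.
- split; first exact: tzeroE.
  + by move=> z; rewrite tact0l /tcomm mul0r mulr0 subr0.
  + by rewrite dynkin0 -(scale0r 0) tdegZ !scale0r.
- move=> a b [a0 at_ aD] [b0 bt_ bD]; split; first by rewrite taddE a0 b0 addr0.
  + by move=> z; rewrite tactDl tcommDl at_ bt_.
  + by rewrite dynkinD tdegD aD bD.
- move=> k a [a0 at_ aD]; split; first by rewrite tscaleE a0 mulr0.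
  + by move=> z; rewrite tactZl tcommZl at_.
  + by rewrite dynkinZ tdegZ aD.
- move=> a b [a0 at_ aD] [b0 bt_ bD]; split.
  + by rewrite tsubE !tmul_nil a0 b0 mul0r subrr.
  + move=> z; rewrite tactBl !tactM !bt_ !at_ /tcomm !(mulrBl, mulrBr) !mulrA.
    by rewrite !opprB addrACA !subrKA addrACA [in RHS]addrACA [- _ - _]addrC.
  + rewrite dynkinB !dynkinM // aD bD at_ bt_ tdegB !tdegM /tcomm.
    by rewrite opprB addrACA opprD [_ * _ + _]addrC.
Qed.

Lemma lielike_basis i : lielike (tbasis [:: i]).
Proof.
split; first by rewrite tbasisE.
- by move=> z; rewrite tact_basis.
- rewrite dynkin_basis; apply/ffunP => w; rewrite tdegE tbasisE.
  by case: eqP => [->|_]; rewrite ?mulr1 ?mulr0.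
Qed.

(* A characterization of the group exp(L) by equations, which shows at once
   that it is a group and that it is closed. *)
Definition glike g :=
  [/\ g [bseq] = 1, forall z, tact g z * g = g * z & tdeg g = dynkin g * g].

Lemma glike_unit g : glike g -> g \is a GRing.unit.
Proof. by case=> g1 _ _; rewrite qualifE /= /tunit g1 oner_eq0. Qed.

Lemma tunit1 g : g [bseq] = 1 -> g \is a GRing.unit.
Proof. by move=> g1; rewrite qualifE /= /tunit g1 oner_eq0. Qed.

Lemma glike1 : glike 1.
Proof.
split; first by rewrite toneE.
- by move=> z; rewrite tact1 mul1r mulr1.
- by rewrite tdeg1 dynkin1 mul0r.
Qed.

(** By Leibniz, E(gh) = D(g) g h + g D(h) h. Since g D(h) = (Theta(g) D(h)) g, this is (D(g) +
    Theta(g) D(h)) g h, and the cocycle identity concludes. *)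
Lemma glikeM g h : glike g -> glike h -> glike (g * h).
Proof.
move=> [g1 gt_ gD] [h1 ht_ hD]; split; first by rewrite tmul_nil g1 h1 mulr1.
- by move=> z; rewrite tactM mulrA gt_ -[g * _ * h]mulrA ht_ mulrA.
- by rewrite dynkinMD // tdegM gD hD mulrDl !mulrA gt_ addrC.
Qed.

Lemma glikeV g : glike g -> glike g^-1.
Proof.
move=> gg; have gu := glike_unit gg; case: gg => g1 gt_ gD.
have gt1 z : tact g z = g * z * g^-1 by rewrite -gt_ mulrK.
have gtV z : tact g^-1 z = g^-1 * z * g.
  have : tact g (tact g^-1 z) = z by rewrite -tactM divrr // tact1.
  by rewrite gt1 => /(congr1 (fun x => g^-1 * x * g)); rewrite !mulrA mulVr // mul1r mulrVK.
have gV1 : g^-1 [bseq] = 1.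
  have := congr1 (fun x : T => x [bseq]) (mulVr gu).
  by rewrite tmul_nil toneE eqxx g1 mulr1.
split=> //; first by move=> z; rewrite gtV mulrK.
(* This is the cocycle identity for the product [g^-1 * g = 1]. *)
have DV : dynkin g^-1 = - (g^-1 * dynkin g * g).
  apply/eqP; rewrite -addr_eq0 -gtV addrC -dynkinMD //.
  by rewrite mulVr // dynkin1.
have : tdeg (g * g^-1) = 0 by rewrite divrr // tdeg1.
rewrite tdegM gD => /eqP; rewrite addrC addr_eq0 => /eqP /(congr1 (fun x => g^-1 * x)).
rewrite mulrA mulVr // mul1r => ->; rewrite DV mulrN mulNr; congr (- _).
by rewrite -!mulrA.
Qed.

(** * Dilations and the exponential *)

Lemma tdilM (t : R) a b : dilation t (a * b) = dilation t a * dilation t b.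
Proof.
apply/ffunP => w; rewrite ffunE !tmulE mulr_sumr; apply: eq_bigr => -[u v] /= /eqP <-.
by rewrite !ffunE size_cat exprD mulrACA.
Qed.

Lemma tdilE t a w : dilation t a w = t ^+ size w * a w.
Proof. by rewrite ffunE. Qed.

Lemma tdilD t a b : dilation t (a + b) = dilation t a + dilation t b.
Proof. by apply/ffunP => w; rewrite tdilE !taddE !tdilE mulrDr. Qed.

Lemma tdilZ t k a : dilation t (k *: a) = k *: dilation t a.
Proof. by apply/ffunP => w; rewrite tdilE !tscaleE !tdilE mulrCA. Qed.

Lemma tdil_basis t s : dilation t (tbasis s) = t ^+ size s *: tbasis s.
Proof.
apply/ffunP => w; rewrite tdilE tscaleE tbasisE.
by case: eqP => [->|_]; rewrite ?mulr1 ?mulr0.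
Qed.

Lemma tdil1 (t : R) : dilation t (1 : T) = 1.
Proof. by rewrite -tbasis0 tdil_basis scale1r. Qed.

Lemma tdil_comp (k t : R) a : dilation k (dilation t a) = dilation (k * t) a.
Proof. by apply/ffunP => w; rewrite !tdilE mulrA exprMn. Qed.

Lemma tdil_id a : dilation 1 a = a.
Proof. by apply/ffunP => w; rewrite tdilE expr1n mul1r. Qed.

Lemma tdilX t a (k : nat) : dilation t (a ^+ k) = dilation t a ^+ k.
Proof. by elim: k => [|k IH]; rewrite ?tdil1 // !exprS tdilM IH. Qed.

Lemma tdil_sum t (I : Type) (r : seq I) (P : pred I) (F : I -> T) :
  dilation t (\sum_(i <- r | P i) F i) = \sum_(i <- r | P i) dilation t (F i).
Proof.
apply: (big_morph _ (tdilD t)).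
by rewrite -(scale0r 0) tdilZ !scale0r.
Qed.

Lemma tdil_exp t a : dilation t (texp a) = texp (dilation t a).
Proof. by rewrite tdil_sum; apply: eq_bigr => k _; rewrite tdilZ tdilX. Qed.

Lemma texp_nil a : a [bseq] = 0 -> texp a [bseq] = 1.
Proof.
move=> a0; rewrite tsumE big_ord_recl /= tscaleE fact0 invr1 mul1r expr0 toneE eqxx.
by rewrite big1 ?addr0 // => i _; rewrite tscaleE texpr_small ?mulr0.
Qed.

End WordBasis.

(** * Derivatives of real functions *)

Section ScalarCalculus.
Variable R : realType.
Implicit Types (f g : R -> R) (s t b : R).

Lemma is_derive_prod f g t a b : is_derive t 1 f a -> is_derive t 1 g b ->
  is_derive t 1 (fun u => f u * g u) (a * g t + f t * b).
Proof.
move=> fa gb; apply: (@is_derive_eq _ _ _ (f * g) _ _ _ _ (is_deriveM fa gb)).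
by rewrite addrC /GRing.scale /= [a * _]mulrC.
Qed.

Lemma is_derive_mulrC (c : R) f t a : is_derive t 1 f a ->
  is_derive t 1 (fun u => f u * c) (a * c).
Proof.
move=> fa; apply: (is_derive_eq (is_derive_prod fa (is_derive_cst (c : R^o) t 1))).
by rewrite mulr0 addr0.
Qed.

Lemma is_derive_bigsum (W : normedModType R) (I : Type) (r : seq I) (P : pred I)
    (F : I -> R -> W) (F' : I -> W) t : (forall i, P i -> is_derive t 1 (F i) (F' i)) ->
  is_derive t 1 (fun u => \sum_(i <- r | P i) F i u) (\sum_(i <- r | P i) F' i).
Proof.
move=> FF'; elim: r => [|i r IH].
  rewrite big_nil; under eq_fun do rewrite big_nil.
  exact: is_derive_cst.
rewrite big_cons; under eq_fun do rewrite big_cons.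
case: ifPn => // Pi; exact: is_deriveD (FF' i Pi) IH.
Qed.

Lemma derive_bounded_incr f (f' : R -> R) s b M : s <= b ->
  (forall t, s <= t <= b -> is_derive t 1 f (f' t)) ->
  (forall t, s <= t <= b -> `|f' t| <= M) ->
  `|f b - f s| <= M * (b - s).
Proof.
rewrite le_eqVlt => /predU1P[<- _ _|sb fd fM]; first by rewrite !subrr normr0 mulr0.
have [||c cI ->] := @MVT _ f f' s b sb.
- by move=> t; rewrite in_itv /= => /andP[/ltW st /ltW tb]; apply: fd; rewrite st tb.
- apply: derivable_within_continuous => t; rewrite in_itv /= => tI.
  by have [] := fd t tI.
- rewrite normrM [`|b - s|]gtr0_norm ?subr_gt0 // ler_wpM2r ?subr_ge0 ?(ltW sb) //.
  by apply: fM; move: cI; rewrite in_itv /= => /andP[/ltW -> /ltW ->].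
Qed.

Lemma derive0_cst f s b : s <= b ->
  (forall t, s <= t <= b -> is_derive t 1 f 0) -> f b = f s.
Proof.
move=> sb fd; apply/eqP; rewrite -subr_eq0 -normr_le0.
rewrite -[leRHS](mul0r (b - s)); apply: (derive_bounded_incr (f' := cst 0)) => // t _.
by rewrite normr0.
Qed.

End ScalarCalculus.

(** * Linear differential equations in the truncated tensor algebra *)

Section TensorODE.
Variables (R : realType) (d m : nat).
Local Notation T := (ttensor R d m).
Local Notation word := (m.-bseq 'I_d).
Implicit Types (f g h a : R -> T) (x y z df dg : T) (s t b : R) (w : word).

Definition tder g t dg := forall w, is_derive t 1 (fun u => g u w) (dg w).

Lemma tder_ext f g t dg : f =1 g -> tder f t dg -> tder g t dg.
Proof. by move=> /funext ->. Qed.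

Lemma tder_eq g t x y : tder g t x -> x = y -> tder g t y.
Proof. by move=> gx <-. Qed.

Lemma tder_cst (x : T) t : tder (fun=> x) t 0.
Proof. by move=> w; rewrite tzeroE; apply: is_derive_cst. Qed.

Lemma tderD f g t df dg : tder f t df -> tder g t dg ->
  tder (fun u => f u + g u) t (df + dg).
Proof.
move=> ff gg w; rewrite taddE; under eq_fun do rewrite taddE.
exact: is_deriveD (ff w) (gg w).
Qed.

Lemma tderZ (k : R -> R) (k' : R) t (x : T) : is_derive t 1 k k' ->
  tder (fun u => k u *: x) t (k' *: x).
Proof.
move=> kk w; rewrite tscaleE; under eq_fun do rewrite tscaleE.
exact: is_derive_mulrC.
Qed.

Lemma tderN f t df : tder f t df -> tder (fun u => - f u) t (- df).
Proof.
move=> ff w; rewrite toppE; under eq_fun do rewrite toppE.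
exact: is_deriveN (ff w).
Qed.

Lemma tderB f g t df dg : tder f t df -> tder g t dg ->
  tder (fun u => f u - g u) t (df - dg).
Proof. by move=> ff gg; apply: tderD => //; apply: tderN. Qed.

Lemma tder_sum (I : Type) (r : seq I) (P : pred I) (F : I -> R -> T) (F' : I -> T) t :
  (forall i, P i -> tder (F i) t (F' i)) ->
  tder (fun u => \sum_(i <- r | P i) F i u) t (\sum_(i <- r | P i) F' i).
Proof.
move=> FF w; rewrite tsumE; under eq_fun do rewrite tsumE.
by apply: is_derive_bigsum => i Pi; apply: FF.
Qed.

Lemma tderM f g t df dg : tder f t df -> tder g t dg ->
  tder (fun u => f u * g u) t (df * g t + f t * dg).
Proof.
move=> ff gg w; rewrite taddE !tmulE -big_split; under eq_fun do rewrite tmulE.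
by apply: is_derive_bigsum => -[u v] _; apply: is_derive_prod.
Qed.

Lemma tder_coord_sum g t dg (c : word -> T) : tder g t dg ->
  tder (fun u => \sum_w g u w *: c w) t (\sum_w dg w *: c w).
Proof. by move=> gg; apply: tder_sum => w _; apply: tderZ. Qed.

Lemma tder_act g t dg z : tder g t dg -> tder (fun u => tact (g u) z) t (tact dg z).
Proof. exact: tder_coord_sum. Qed.

Lemma tder_dynkin g t dg : tder g t dg -> tder (fun u => dynkin (g u)) t (dynkin dg).
Proof. exact: tder_coord_sum. Qed.

Lemma tder_deg g t dg : tder g t dg -> tder (fun u => tdeg (g u)) t (tdeg dg).
Proof.
move=> gg w; rewrite tdegE; under eq_fun do rewrite tdegE.
rewrite mulrC; under eq_fun do rewrite mulrC.
exact: is_derive_mulrC.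
Qed.

(** As a has no scalar part, the derivative of the coordinate at w involves only coordinates of f at
    shorter words: induction on length replaces the Gronwall inequality. *)
Lemma tode_left_eq0 a f s b : s <= b -> (forall t, (a t) [bseq] = 0) ->
  (forall t, s <= t <= b -> tder f t (a t * f t)) -> f s = 0 -> f b = 0.
Proof.
move=> sb a0 fd fs.
suff H n w t : (size w < n)%N -> s <= t <= b -> f t w = 0.
  by apply/ffunP => w; rewrite tzeroE (H (size w).+1) ?sb ?lexx.
elim: n w t => // n IH w t; rewrite ltnS => wn /andP[st tb].
have -> : f t w = f s w.
  apply: (derive0_cst (f := fun u => f u w)) => // u /andP[su ut].
  have ub := le_trans ut tb.
  apply: (is_derive_eq (fd u _ w)); first by rewrite su.
  rewrite tmulE big1 // => -[x y] /= /eqP xyw.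
  have [x0|x0] := eqVneq (bseqval x) [::].
    by rewrite (_ : x = [bseq]) ?a0 ?mul0r //; exact: val_inj.
  rewrite (IH y) ?mulr0 ?su ?ub //; apply: leq_trans wn; rewrite -xyw size_cat.
  by rewrite -add1n leq_add2r lt0n size_eq0.
by rewrite fs tzeroE.
Qed.

Lemma tode_right_eq0 a f s b : s <= b -> (forall t, (a t) [bseq] = 0) ->
  (forall t, s <= t <= b -> tder f t (f t * a t)) -> f s = 0 -> f b = 0.
Proof.
move=> sb a0 fd fs.
suff H n w t : (size w < n)%N -> s <= t <= b -> f t w = 0.
  by apply/ffunP => w; rewrite tzeroE (H (size w).+1) ?sb ?lexx.
elim: n w t => // n IH w t; rewrite ltnS => wn /andP[st tb].
have -> : f t w = f s w.
  apply: (derive0_cst (f := fun u => f u w)) => // u /andP[su ut].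
  have ub := le_trans ut tb.
  apply: (is_derive_eq (fd u _ w)); first by rewrite su.
  rewrite tmulE big1 // => -[x y] /= /eqP xyw.
  have [y0|y0] := eqVneq (bseqval y) [::].
    by rewrite (_ : y = [bseq]) ?a0 ?mulr0 //; exact: val_inj.
  rewrite (IH x) ?mul0r ?su ?ub //; apply: leq_trans wn; rewrite -xyw size_cat.
  by rewrite -addn1 leq_add2l lt0n size_eq0.
by rewrite fs tzeroE.
Qed.

Lemma tder0_cst f s b : s <= b -> (forall t, s <= t <= b -> tder f t 0) -> f b = f s.
Proof.
move=> sb fd; apply/ffunP => w.
apply: (derive0_cst (f := fun u => f u w)) => // u su.
by have := fd u su w; rewrite tzeroE.
Qed.

(* Both tact h z * h - h * z and tdeg h - dynkin h * h solve X' = a X with X s = 0. *)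
Lemma glike_ode a h s b : s <= b -> (forall t, lielike (a t)) ->
  (forall t, s <= t <= b -> tder h t (a t * h t)) -> h s = 1 -> glike (h b).
Proof.
move=> sb aL hd hs.
have a0 t : (a t) [bseq] = 0 by case: (aL t).
have h1 t : s <= t <= b -> h t [bseq] = 1.
  move=> /andP[st tb]; transitivity (h s [bseq]); last by rewrite hs toneE eqxx.
  apply: (derive0_cst (f := fun u => h u [bseq])) => // u /andP[su ut].
  apply: (is_derive_eq (hd u _ [bseq])); first by rewrite su (le_trans ut).
  by rewrite tmul_nil a0 mul0r.
split; first by rewrite h1 ?sb ?lexx.
- move=> z; apply/eqP; rewrite -subr_eq0; apply/eqP.
  apply: (tode_left_eq0 (f := fun t => tact (h t) z * h t - h t * z) sb a0).
    move=> t tI; have ht := hd t tI.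
    apply: (tder_eq (tderB (tderM (tder_act z ht) ht) (tderM ht (tder_cst z t)))).
    have [_ aT _] := aL t.
    by rewrite tactM aT /tcomm mulrBl mulr0 addr0 mulrBr !mulrA subrK.
  by rewrite hs tact1 mulr1 mul1r subrr.
- apply/eqP; rewrite -subr_eq0; apply/eqP.
  apply: (tode_left_eq0 (f := fun t => tdeg (h t) - dynkin (h t) * h t) sb a0).
    move=> t tI; have ht := hd t tI.
    apply: (tder_eq (tderB (tder_deg ht) (tderM (tder_dynkin ht) ht))).
    have [_ aT aD] := aL t.
    rewrite dynkinMD ?h1 // aT aD tdegM mulrBr mulrDl /tcomm mulrBl !mulrA.
    rewrite [X in _ - X]addrAC subrK [X in _ - X]addrC.
    by rewrite opprD addrACA subrr add0r.
  by rewrite hs tdeg1 dynkin1 mul0r subrr.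
Qed.

Lemma texp_der (x : T) (k : R -> R) (k' t : R) : x [bseq] = 0 -> is_derive t 1 k k' ->
  tder (fun u => texp (k u *: x)) t (k' *: (x * texp (k t *: x))).
Proof.
move=> x0 kk.
have E (c : R) : texp (c *: x) = \sum_(i < m.+1) (c ^+ i / i`!%:R) *: x ^+ i.
  by apply: eq_bigr => i _; rewrite exprZn scalerA mulrC.
apply: (tder_ext (f := fun u => \sum_(i < m.+1) (k u ^+ i / i`!%:R) *: x ^+ i)).
  by move=> u; rewrite E.
have kp n : is_derive t 1 (fun u => k u ^+ n / n`!%:R)
    (if n is n'.+1 then k' * (k t ^+ n' / n'`!%:R) else 0).
  case: n => [|n].
    under eq_fun do rewrite expr0.
    exact: (is_derive_cst (1 / 0`!%:R : R^o)).
  have kn : is_derive t 1 (fun u => k u ^+ n.+1) (k' * (k t ^+ n * n.+1%:R)).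
    have -> : (fun u => k u ^+ n.+1) = k ^+ n.+1.
      by apply/funext => u; rewrite exprfctE.
    apply: (is_derive_eq (is_deriveX n.+1 kk)).
    by rewrite /GRing.scale /= mulrC [_ * _ ^+ _]mulrC.
  apply: (is_derive_eq (is_derive_mulrC _ kn)).
  rewrite factS natrM invfM -!mulrA; congr (_ * (_ * _)).
  by rewrite mulrA divff ?mul1r // pnatr_eq0.
apply: tder_eq; first by apply: tder_sum => i _; apply: tderZ; exact: kp.
(* Both sides run over the same powers of x: the constant term has derivative 0, and the last term
   of [x * texp] contains x^(m+1) = 0. *)
rewrite big_ord_recl /= scale0r add0r E big_ord_recr /= mulrDr -scalerAr -exprS.
rewrite texpr_nilpotent // scaler0 addr0 mulr_sumr scaler_sumr.
by apply: eq_bigr => i _; rewrite /= -[x * _]scalerAr -exprS scalerA.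
Qed.

Lemma texp0 : texp (0 : T) = 1.
Proof.
rewrite /texp big_ord_recl /= fact0 invr1 scale1r expr0 big1 ?addr0 // => i _.
by rewrite expr0n /= scaler0.
Qed.

(** The function exp(tx) exp(-tx) has derivative 0, which avoids binomial identities. *)
Lemma texpN (x : T) : x [bseq] = 0 -> texp x * texp (- x) = 1.
Proof.
move=> x0.
suff -> : texp x * texp (- x) = texp (0 *: x) * texp (- 0 *: x).
  by rewrite oppr0 !scale0r texp0 mulr1.
rewrite -[in LHS](scale1r x) -scaleNr.
apply: (tder0_cst (f := fun t => texp (t *: x) * texp (- t *: x)) ler01) => t _.
apply: (tder_eq (tderM (texp_der x0 (is_derive_id t 1))
  (texp_der x0 (is_deriveNid t 1)))).
rewrite scale1r scaleN1r mulrN mulrA.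
have -> : x * texp (t *: x) = texp (t *: x) * x.
  rewrite mulr_sumr mulr_suml; apply: eq_bigr => i _.
  by rewrite -scalerAr -scalerAl exprZn -scalerAr -scalerAl -exprS exprSr.
by rewrite -mulrA subrr.
Qed.

Lemma texpV (x : T) : x [bseq] = 0 -> (texp x)^-1 = texp (- x).
Proof.
move=> x0; have xu : texp x \is a GRing.unit by apply/tunit1/texp_nil.
by rewrite -[RHS](mulKr xu) texpN // mulr1.
Qed.

Lemma glike_exp (x : T) : lielike x -> glike (texp x).
Proof.
move=> xL; rewrite -(scale1r x).
apply: (glike_ode (a := fun=> x) (h := fun t => texp (t *: x)) ler01) => // [t _|].
  have [x0 _ _] := xL.
  by apply: (tder_eq (texp_der x0 (is_derive_id t 1))); rewrite scale1r.
by rewrite scale0r texp0.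
Qed.

End TensorODE.

(** * Leading terms of group elements and of exponentials *)

Section LeadingTerms.
Variables (R : realType) (d m : nat).
Local Notation T := (ttensor R d m).
Local Notation word := (m.-bseq 'I_d).
Implicit Types (a b c g h x y z P : T) (w u : word) (s v : seq 'I_d) (n : nat).

Lemma tord1_sub1 g : g [bseq] = 1 -> tord 1 (g - 1).
Proof. by move=> g1; apply/tord1P; rewrite tsubE g1 toneE eqxx subrr. Qed.

Lemma tord_dynkin n h : tord n (h - 1) -> tord n (dynkin h).
Proof.
move=> hn; rewrite -[h](subrK 1) dynkinD dynkin1 addr0.
apply: tord_sum => w _; have [wn|nw] := ltnP (size w) n.
  by rewrite hn // scale0r => u _; rewrite tzeroE.
by apply: tordZ; apply: tord_ge nw (@tord_brw _ _ _ _).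
Qed.

(** The Dynkin idempotent applied to level n of h; by construction it is a combination of brackets
    with explicit coefficients. *)
Definition lead n h : T := n%:R^-1 *: \sum_(u : word | size u == n) h u *: brw R m u.

Lemma tord_lead n h : tord n (lead n h).
Proof.
apply: tordZ; apply: tord_sum => u /eqP <-.
by apply: tordZ; apply: tord_brw.
Qed.

(** At a word of length n + 1 the left side of E h = D(h) h is (n + 1) h_w. On the right h may be
    replaced by 1, since D(h) (h - 1) has order 2n + 2. *)
Lemma glike_lead n h : glike h -> tord n.+1 (h - 1) ->
  tord n.+2 (h - 1 - lead n.+1 h).
Proof.
move=> [h1 _ hD] hn w; rewrite ltnS leq_eqVlt => /predU1P[wn|wn]; last first.
  by rewrite tsubE hn // tord_lead // subrr.
have w0 : bseqval w != [::] by rewrite -size_eq0 wn.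
rewrite tsubE tsubE toneE (negbTE w0) subr0.
have n0 : n.+1%:R != 0 :> R by rewrite pnatr_eq0.
apply: (mulfI n0); rewrite mulr0 mulrBr tscaleE mulVKf //.
have := congr1 (fun x : T => x w) hD; rewrite tdegE wn => ->.
rewrite -[h in _ * h](subrK 1) mulrDr mulr1 taddE.
have dn := tord_dynkin hn.
rewrite (tordM dn hn) ?add0r; last by rewrite wn addnS ltnS leq_addr.
rewrite -[in dynkin h](subrK 1 h) dynkinD dynkin1 addr0 !tsumE.
rewrite [X in _ - X]big_mkcond /= -sumrB big1 // => u _.
case: eqP => [un|/eqP un]; last first.
  rewrite subr0 tscaleE; have [lt|le] := ltnP (size u) n.+1.
    by rewrite hn ?mul0r.
  by rewrite tord_brw ?mulr0 // wn ltn_neqAle eq_sym un.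
rewrite !tscaleE tsubE toneE; case: eqP => [u0|_]; last by rewrite subr0 subrr.
by move: un; rewrite u0.
Qed.

(** Every monomial of the difference contains a factor y, of order n + 1, and k further factors of
    order at least 1. *)
Lemma tord_expB n x y (k : nat) : tord 1 x -> tord n.+1 y ->
  tord (n.+1 + k) ((x + y) ^+ k.+1 - x ^+ k.+1).
Proof.
move=> x1 yn; have xk j : tord j (x ^+ j).
  elim: j => // j IH; rewrite exprS -add1n; exact: tordM.
elim: k => [|k IH]; first by rewrite !expr1 addrC addKr addn0.
have -> : (x + y) ^+ k.+2 - x ^+ k.+2 =
    (x + y) * ((x + y) ^+ k.+1 - x ^+ k.+1) + y * x ^+ k.+1.
  by rewrite mulrBr -exprS mulrDl -exprS opprD addrA subrK.
apply: tordD; last by apply: tordM.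
rewrite addnS -add1n; apply: tordM => //; apply: tordD => //.
exact: tord_ge yn.
Qed.

Lemma texp_tordD n x y : tord 1 x -> tord n.+1 y ->
  tord n.+2 (texp (x + y) - texp x - y).
Proof.
move=> x1 yn; rewrite /texp -sumrB.
have xy1 : tord 1 (x + y) by apply: tordD => //; exact: tord_ge yn.
(* The terms of exponent 0 cancel and those of exponent m + 1 vanish, so the exponent can be shifted
   by one over the same range. *)
have -> : \sum_(k < m.+1) ((k`!%:R)^-1 *: (x + y) ^+ k - (k`!%:R)^-1 *: x ^+ k) =
    \sum_(k < m.+1) ((k.+1`!%:R)^-1 *: ((x + y) ^+ k.+1 - x ^+ k.+1)).
  rewrite big_ord_recl big_ord_recr /= !expr0 subrr add0r.
  rewrite !texpr_nilpotent ?subrr ?scaler0 ?addr0; [|exact/tord1P..].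
  by apply: eq_bigr => k _; rewrite scalerBr.
rewrite big_ord_recl /= invr1 scale1r !expr1 addrAC [x + y]addrC addrK subrr add0r.
apply: tord_sum => k _; apply: tordZ.
rewrite [y + x]addrC /bump leq0n add1n; apply: tord_ge (@tord_expB n x y k.+1 x1 yn).
by rewrite addnS ltnS leq_addr.
Qed.

Lemma texp_tord n y : tord n.+1 y -> tord n.+2 (texp y - 1 - y).
Proof.
move=> yn; rewrite -[y in texp y]add0r -texp0; apply: texp_tordD => // w _.
exact: tzeroE.
Qed.

End LeadingTerms.

(** * The free Lie algebra and the equations of its group *)

Section FreeGroup.
Variables (R : realType) (V : normedVectType R) (m : nat).
Local Notation d := (\dim {:V}).
Local Notation T := (ttensor R d m).
Local Notation word := (m.-bseq 'I_d).
Local Notation L := (@free_lie R V m).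
Local Notation e i := (tbasis R m [:: i]).

Lemma tinj_expand (v : V) : tinj m v = \sum_i coord (vbasis {:V}) i v *: e i.
Proof.
apply/ffunP => w; rewrite ffunE tsumE.
case E: (bseqval w) => [|i [|j s]].
- by rewrite big1 // => j _; rewrite tscaleE tbasisE E mulr0.
- rewrite (bigD1 i) //= tscaleE tbasisE E eqxx mulr1 big1 ?addr0 // => j ji.
  by rewrite tscaleE tbasisE E eqseq_cons eqxx andbT eq_sym (negbTE ji) mulr0.
- by rewrite big1 // => k _; rewrite tscaleE tbasisE E eqseq_cons andbF mulr0.
Qed.

Lemma free_lie_subalgebra : lie_subalgebra L.
Proof.
split.
- by move=> A [[]].
- by move=> a b La Lb A CA; have [_ D _ _] := CA.1; apply: D; [apply: La|apply: Lb].
- by move=> k a La A CA; have [_ _ Z _] := CA.1; apply: Z; apply: La.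
- by move=> a b La Lb A CA; have [_ _ _ B] := CA.1; apply: B; [apply: La|apply: Lb].
Qed.

Lemma free_lie0 : L 0. Proof. by have [] := free_lie_subalgebra. Qed.
Lemma free_lieD a b : L a -> L b -> L (a + b).
Proof. by have [_ D _ _] := free_lie_subalgebra; apply: D. Qed.
Lemma free_lieZ k a : L a -> L (k *: a).
Proof. by have [_ _ Z _] := free_lie_subalgebra; apply: Z. Qed.
Lemma free_lie_comm a b : L a -> L b -> L (tcomm a b).
Proof. by have [_ _ _ B] := free_lie_subalgebra; apply: B. Qed.
Lemma free_lie_sum (I : Type) (r : seq I) (P : pred I) (F : I -> T) :
  (forall i, P i -> L (F i)) -> L (\sum_(i <- r | P i) F i).
Proof.
by move=> LF; elim/big_ind: _ => //; [exact: free_lie0|exact: free_lieD].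
Qed.

Lemma free_lie_min (A : set T) : lie_subalgebra A -> (forall i, A (e i)) ->
  L `<=` A.
Proof.
move=> CA Ae a La; apply: La; split=> // _ [v _ <-].
rewrite tinj_expand; have [A0 AD AZ _] := CA.
by elim/big_ind: _ => // i _; apply: AZ.
Qed.

Lemma tinj_vbasis (i : 'I_d) : tinj m (vbasis {:V})`_i = e i.
Proof.
have bf : free (vbasis {:V}) := basis_free (vbasisP _).
rewrite tinj_expand (bigD1 i) //= coord_free // eqxx scale1r.
rewrite big1 ?addr0 // => j ji.
by rewrite coord_free // eq_sym (negbTE ji) scale0r.
Qed.

Lemma tinjZ k (v : V) : tinj m (k *: v) = k *: tinj m v.
Proof.
by rewrite !tinj_expand scaler_sumr; apply: eq_bigr => i _; rewrite linearZ scalerA.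
Qed.

Lemma free_lie_letter i : L (e i).
Proof. by move=> A [_ Ainj]; apply: Ainj; exists (vbasis {:V})`_i => //; exact: tinj_vbasis. Qed.

Lemma free_lie_brw s : L (brw R m s).
Proof.
elim: s => [|i [|j s] IH]; first exact: free_lie0.
  exact: free_lie_letter.
by apply: free_lie_comm => //; apply: free_lie_letter.
Qed.

Lemma free_lie_lead n h : L (lead n h).
Proof.
apply: free_lieZ; apply: free_lie_sum => u _; apply: free_lieZ.
exact: free_lie_brw.
Qed.

Lemma free_lielike a : L a -> lielike a.
Proof.
by apply: free_lie_min; [exact: lielike_subalgebra|exact: lielike_basis].
Qed.

Lemma free_lie_dil t a : L a -> L (dilation t a).
Proof.
apply: (free_lie_min (A := [set a | L (dilation t a)])) => [|i /=]; last first.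
  by rewrite tdil_basis; apply: free_lieZ; exact: free_lie_letter.
split=> /=.
- by rewrite -(scale0r (0 : T)) tdilZ !scale0r; exact: free_lie0.
- by move=> x y Lx Ly; rewrite tdilD; apply: free_lieD.
- by move=> k x Lx; rewrite tdilZ; apply: free_lieZ.
- move=> x y Lx Ly; rewrite tdilD -scaleN1r tdilZ scaleN1r !tdilM.
  exact: free_lie_comm.
Qed.

(* Improves a logarithm of g one level at a time. *)
Lemma glike_log n g : glike g -> exists2 x, L x & tord n.+1 (g - texp x).
Proof.
move=> gg; elim: n => [|n [x Lx xn]].
  exists 0; first exact: free_lie0.
  by rewrite texp0; apply: tord1_sub1; case: gg.
have xL := free_lielike Lx; have [x0 _ _] := xL.
have xg := glike_exp xL; have xu := glike_unit xg.
pose h := g * (texp x)^-1.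
have hg : glike h by apply: glikeM => //; apply: glikeV.
have hn : tord n.+1 (h - 1).
  by rewrite /h -(divrr xu) -mulrBl -[n.+1]addn0; apply: tordM.
have hl := glike_lead hg hn; pose y := lead n.+1 h.
exists (x + y); first by apply: free_lieD => //; apply: free_lie_lead.
have yn : tord n.+1 y := @tord_lead _ _ _ _ _.
(* Each of the three terms has order n + 2: by [glike_lead], as a product of orders n + 1 and 1, and
   by [texp_tordD]. *)
have -> : g - texp (x + y) = (h - 1 - y) * texp x + y * (texp x - 1)
    - (texp (x + y) - texp x - y).
  rewrite !mulrBl mulrBr mulr1 mul1r mulrVK // addrA subrK.
  by rewrite !opprB !subrKA.
apply: tordB; last by apply: texp_tordD => //; apply/tord1P.
apply: tordD; first by rewrite -[n.+2]addn0; apply: tordM.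
by rewrite -[n.+2]addn1; apply: tordM => //; apply: tord1_sub1; apply: texp_nil.
Qed.

(** A logarithm that is correct up to order m + 1 is exact, because no tensor of that order survives
    the truncation. *)
Lemma free_nilpotentE g : @free_nilpotent R V m g <-> glike g.
Proof.
split=> [[x Lx <-]|gg]; first exact/glike_exp/free_lielike.
have [x Lx xm] := glike_log m gg; exists x => //.
by apply/esym/eqP; rewrite -subr_eq0; apply/eqP; apply: tord_eq0 xm.
Qed.

Lemma glike_dil t (g : T) : glike g -> glike (dilation t g).
Proof.
move=> /free_nilpotentE [x Lx <-]; apply/free_nilpotentE; exists (dilation t x).
  exact: free_lie_dil.
by rewrite tdil_exp.
Qed.

End FreeGroup.

(** * The coordinate norm and products of segments *)

Section CoordinateNorm.
Variables (R : realType) (d m : nat).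
Local Notation T := (ttensor R d m).
Local Notation word := (m.-bseq 'I_d).
Implicit Types (a b c g h x y z P : T) (w u : word) (s v : seq 'I_d).

(** The l^1 norm, chosen because it is submultiplicative: basis words multiply to basis words or to
    0. *)
Definition tnorm a : R := \sum_w `|a w|.

Lemma tnorm_ge0 a : 0 <= tnorm a.
Proof. by apply: sumr_ge0 => w _; apply: normr_ge0. Qed.

Lemma tnorm_coord a w : `|a w| <= tnorm a.
Proof. by rewrite /tnorm (bigD1 w) //= lerDl; apply: sumr_ge0 => u _; apply: normr_ge0. Qed.

Lemma tnorm_le a M : (forall w, `|a w| <= M) -> tnorm a <= M *+ #|{: word}|.
Proof.
move=> aM; rewrite /tnorm.
apply: (@le_trans _ _ (\sum_(w : word) M)); first exact: ler_sum.
by rewrite sumr_const.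
Qed.

Lemma tnormD a b : tnorm (a + b) <= tnorm a + tnorm b.
Proof.
rewrite /tnorm -big_split; apply: ler_sum => w _ /=.
by rewrite taddE ler_normD.
Qed.

Lemma tnormZ (k : R) a : tnorm (k *: a) = `|k| * tnorm a.
Proof. by rewrite mulr_sumr; apply: eq_bigr => w _; rewrite tscaleE normrM. Qed.

Lemma tnorm0 : tnorm 0 = 0.
Proof. by rewrite /tnorm big1 // => w _; rewrite tzeroE normr0. Qed.

Lemma tnorm_sum (I : Type) (r : seq I) (Q : pred I) (F : I -> T) :
  tnorm (\sum_(i <- r | Q i) F i) <= \sum_(i <- r | Q i) tnorm (F i).
Proof.
elim/big_rec2: _ => [|i x y _ xy]; first by rewrite tnorm0.
by apply: (le_trans (tnormD _ _)); rewrite lerD2l.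
Qed.

Lemma tnorm_basis s : tnorm (tbasis R m s) <= 1.
Proof.
have [ms|ms] := ltnP m (size s).
  by rewrite tbasis_big // tnorm0 ler01.
rewrite /tnorm (bigD1 (Bseq ms)) //= tbasisE eqxx normr1 big1 ?addr0 // => w /eqP wn.
rewrite tbasisE; have [ws|_] := eqVneq (bseqval w) s; last by rewrite normr0.
by case: wn; apply: val_inj.
Qed.

Lemma tnormM a b : tnorm (a * b) <= tnorm a * tnorm b.
Proof.
rewrite [in X in X <= _](tbasis_expand a) mulr_suml mulr_suml.
apply: (le_trans (tnorm_sum _ _ _)); apply: ler_sum => u _.
rewrite -scalerAl tnormZ ler_wpM2l ?normr_ge0 //.
rewrite [in X in X <= _](tbasis_expand b) mulr_sumr.
apply: (le_trans (tnorm_sum _ _ _)); apply: ler_sum => v _.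
rewrite -scalerAr tnormZ ler_piMr ?normr_ge0 // tbasisM.
exact: tnorm_basis.
Qed.

Lemma tnorm_exp_letter (k C : R) i : `|k| <= C ->
  tnorm (texp (k *: tbasis R m [:: i])) <= \sum_(n < m.+1) C ^+ n / n`!%:R.
Proof.
move=> kC; apply: (le_trans (tnorm_sum _ _ _)); apply: ler_sum => n _.
rewrite exprZn scalerA tnormZ.
have xk j : tnorm (tbasis R m [:: i] ^+ j) <= 1.
  elim: j => [|j IH]; first by rewrite expr0 -tbasis0; exact: tnorm_basis.
  rewrite exprS; apply: (le_trans (tnormM _ _)).
  by rewrite mulr_ile1 ?tnorm_ge0 ?tnorm_basis.
apply: (@le_trans _ _ `|n`!%:R^-1 * k ^+ n|); first by rewrite ler_piMr ?normr_ge0.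
rewrite normrM normrX mulrC [X in _ * X <= _]ger0_norm ?invr_ge0 ?ler0n // ler_wpM2r ?invr_ge0 ?ler0n //.
by rewrite lerXn2r ?nnegrE ?normr_ge0 // (le_trans (normr_ge0 _) kC).
Qed.

(* (c, i) stands for the straight segment exp(c e_i). *)
Definition lprod (l : seq (R * 'I_d)) : T :=
  \prod_(q <- l) texp (q.1 *: tbasis R m [:: q.2]).

Definition linv (l : seq (R * 'I_d)) := rev [seq (- q.1, q.2) | q <- l].

Definition lbound (C : R) (l : seq (R * 'I_d)) := all (fun q => `|q.1| <= C) l.

Lemma lprod_cat l1 l2 : lprod (l1 ++ l2) = lprod l1 * lprod l2.
Proof. exact: big_cat. Qed.

Lemma lprod_cons q l : lprod (q :: l) = texp (q.1 *: tbasis R m [:: q.2]) * lprod l.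
Proof. exact: big_cons. Qed.

Lemma glike_letter (k : R) (i : 'I_d) : glike (texp (k *: tbasis R m [:: i])).
Proof.
apply: glike_exp; have [_ _ Z _] := lielike_subalgebra R d m.
by apply: Z; apply: lielike_basis.
Qed.

Lemma glike_lprod l : glike (lprod l).
Proof.
elim: l => [|q l IH]; first by rewrite /lprod big_nil; exact: glike1.
by rewrite lprod_cons; apply: glikeM => //; exact: glike_letter.
Qed.

Lemma lprod_inv l : lprod (linv l) = (lprod l)^-1.
Proof.
elim: l => [|q l IH]; first by rewrite /lprod !big_nil invr1.
rewrite /linv map_cons rev_cons -cats1 lprod_cat -/(linv l) IH lprod_cons.
rewrite lprod_cons {2}/lprod big_nil mulr1 /= scaleNr -texpV; last first.
  by rewrite tscaleE tbasisE mulr0.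
by rewrite invrM //; apply: glike_unit; [exact: glike_letter|exact: glike_lprod].
Qed.

Lemma size_linv l : size (linv l) = size l.
Proof. by rewrite size_rev size_map. Qed.

Lemma lbound_linv C l : lbound C (linv l) = lbound C l.
Proof. by rewrite /lbound all_rev all_map; apply: eq_all => q /=; rewrite normrN. Qed.

Lemma lprod_bounded (K : nat) (C : R) : exists M : R, forall l,
  (size l <= K)%N -> lbound C l -> tnorm (lprod l) <= M.
Proof.
pose B := \sum_(n < m.+1) `|C| ^+ n / n`!%:R.
have B1 : 1 <= B.
  rewrite /B big_ord_recl /= expr0 invr1 mulr1 lerDl; apply: sumr_ge0 => n _.
  by rewrite divr_ge0 ?exprn_ge0.
exists (B ^+ K) => l lK lC.
apply: (@le_trans _ _ (B ^+ size l)); last by rewrite ler_weXn2l.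
elim: l lC {lK} => [_|q l IH /= /andP[qC lC]].
  by rewrite /lprod big_nil -tbasis0; exact: tnorm_basis.
rewrite lprod_cons exprS; apply: (le_trans (tnormM _ _)).
apply: ler_pM; rewrite ?tnorm_ge0 ?IH //.
by apply: tnorm_exp_letter; apply: (le_trans qC); exact: ler_norm.
Qed.

(** The iterated group commutator. The whole coefficient sits on the outermost letter, which avoids
    roots and signs of c; the segments are then not of homogeneous size, and [chow] repairs this by
    a dilation. *)
Fixpoint lbracket (s : seq 'I_d) (c : R) : seq (R * 'I_d) :=
  if s is i :: v then
    if v is [::] then [:: (c, i)]
    else (c, i) :: lbracket v 1 ++ (- c, i) :: linv (lbracket v 1)
  else [::].

Lemma size_lbracket s (c c' : R) : size (lbracket s c) = size (lbracket s c').
Proof.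
case: s => // i [//|j s]; rewrite /lbracket -/lbracket.
by rewrite /= !size_cat.
Qed.

Lemma lbound_lbracket s (c C : R) : 1 <= C -> `|c| <= C -> lbound C (lbracket s c).
Proof.
move=> C1; elim: s c => // i [|j s] IH c cC; first by rewrite /lbound /= cC.
have IH1 := IH 1; rewrite normr1 in IH1.
rewrite /lbracket -/lbracket /lbound /= cC all_cat /= normrN cC /=.
by rewrite -!/(lbound C _) lbound_linv IH1.
Qed.

(** Rests on A B A^-1 B^-1 - 1 = [A - 1, B - 1] A^-1 B^-1. Up to higher order the last two factors
    are 1, and A - 1 and B - 1 may be replaced by their leading terms. *)
Lemma lprod_lbracket s (c : R) : s != [::] ->
  tord (size s).+1 (lprod (lbracket s c) - 1 - c *: brw R m s).
Proof.
elim: s c => // i [|j s] IH c _.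
  rewrite /= lprod_cons {1}/lprod big_nil mulr1.
  by apply: texp_tord; apply: tordZ; exact: (@tord_basis _ _ _ [:: i]).
have {IH} := IH 1 isT; set v := j :: s; rewrite scale1r => Bv.
have -> : lbracket (i :: v) c = (c, i) :: lbracket v 1 ++ (- c, i) :: linv (lbracket v 1).
  by [].
rewrite lprod_cons lprod_cat lprod_cons lprod_inv /= scaleNr -texpV; last first.
  by rewrite tscaleE tbasisE mulr0.
set A := texp _; set B := lprod _; set b := brw R m v in Bv *; pose a := c *: tbasis R m [:: i].
have A2 : tord 2 (A - 1 - a).
  by apply: texp_tord; apply: tordZ; exact: (@tord_basis _ _ _ [:: i]).
have Ag : glike A := glike_letter _ _.
have Bg : glike B := glike_lprod _.
have Au := glike_unit Ag; have Bu := glike_unit Bg.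
have a1 : tord 1 a by apply: tordZ; exact: (@tord_basis _ _ _ [:: i]).
have A1 : tord 1 (A - 1) by apply: tord1_sub1; case: Ag.
have bv : tord (size v) b by apply: tord_brw.
have B1 : tord (size v) (B - 1).
  rewrite -(subrK b (B - 1)); apply: tordD => //.
  by apply: tord_ge Bv.
have -> : A * (B * (A^-1 * B^-1)) - 1 - c *: tcomm (tbasis R m [:: i]) b =
    tcomm (A - 1) (B - 1) * (A^-1 * B^-1 - 1) +
    (tcomm (A - 1 - a) (B - 1) + tcomm a (B - 1 - b)).
  rewrite -tcommZl -/a mulrBr mulr1.
  have -> : tcomm (A - 1 - a) (B - 1) + tcomm a (B - 1 - b) =
      tcomm (A - 1) (B - 1) - tcomm a b.
    by rewrite (tcommBl (A - 1) a) (tcommBr (B - 1) b) subrKA.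
  rewrite subrKA; congr (_ - _).
  have -> : tcomm (A - 1) (B - 1) = A * B - B * A.
    have c1l z : tcomm 1 z = 0 by rewrite /tcomm mul1r mulr1 subrr.
    have c1r z : tcomm z 1 = 0 by rewrite /tcomm mul1r mulr1 subrr.
    by rewrite tcommBl !tcommBr !(c1l, c1r) !subr0.
  rewrite mulrBl -!mulrA; congr (_ - _).
  by rewrite [A * (A^-1 * _)]mulrA divrr // mul1r divrr.
have sv : (size (i :: v)).+1 = ((1 + size v) + 1)%N by rewrite addn1.
apply: tordD.
  rewrite sv; apply: tordM; first exact: tord_comm.
  by apply: tord1_sub1; case: (glikeM (glikeV Ag) (glikeV Bg)).
by apply: tordD; [rewrite sv addn1 -addSn|rewrite sv addn1 -addnS]; apply: tord_comm.
Qed.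

(** In a product of factors 1 + y_i the leading terms add up, since a product of y_i with any Q - 1
    already has order n + 2. *)
Lemma lprod_flatten_tord (n : nat) (I : eqType) (r : seq I) (l : I -> seq (R * 'I_d)) (y : I -> T) :
  (forall i, i \in r -> tord n.+1 (y i)) ->
  (forall i, i \in r -> tord n.+2 (lprod (l i) - 1 - y i)) ->
  tord n.+2 (lprod (flatten [seq l i | i <- r]) - 1 - \sum_(i <- r) y i).
Proof.
elim: r => [|i r IH] yr lr.
  by rewrite /lprod !big_nil subr0 subrr => w _; rewrite tzeroE.
rewrite /= lprod_cat big_cons.
set P := lprod (l i); set Q := lprod _ in IH *; set Y := \sum_(_ <- _) _ in IH *.
have -> : P * Q - 1 - (y i + Y) =
    (P - 1 - y i) * Q + y i * (Q - 1) + (Q - 1 - Y).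
  rewrite !mulrBl mulrBr mul1r mulr1 subrKA [_ - Q - _]addrAC -[Q - 1 - Y]addrA.
  by rewrite subrKA opprD addrACA.
have Q1 : tord 1 (Q - 1) by apply: tord1_sub1; case: (glike_lprod (flatten [seq l i | i <- r])).
apply: tordD.
  apply: tordD; first by rewrite -[n.+2]addn0; apply: tordM => //; apply: lr; rewrite mem_head.
  by rewrite -[n.+2]addn1; apply: tordM => //; apply: yr; rewrite mem_head.
by apply: IH => x xr; [apply: yr|apply: lr]; rewrite in_cons xr orbT.
Qed.

(** If l is right up to level n, the leading term of the remainder h is a combination of brackets of
    length n + 1; appending one commutator word for each of them removes that level. The bounds stay
    uniform in g because h is bounded in terms of M alone. *)
Lemma chow_level n (M : R) : exists (K : nat) (C : R), forall g, glike g ->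
  (forall w, `|g w| <= M) ->
  exists l, [/\ (size l <= K)%N, lbound C l & tord n.+1 ((lprod l)^-1 * g - 1)].
Proof.
elim: n => [|n [K [C IH]]].
  exists 0%N, 0 => g gg _; exists [::]; split => //.
  by rewrite /lprod big_nil invr1 mul1r; apply: tord1_sub1; case: gg.
have [M1 HM1] := lprod_bounded K C.
(* [M1] bounds the inverse of the word already found, so [M2] bounds the coordinates of h and hence
   the new coefficients. *)
pose M2 := M1 * (M *+ #|{: word}|).
pose W := [seq u : word <- enum {: word} | size u == n.+1].
(* The length of a commutator word does not depend on its coefficient, for which 0 is a
   placeholder. *)
pose K2 := (\sum_(u <- W) size (lbracket u 0))%N.
pose C2 := Num.max C (Num.max 1 M2).
exists (K + K2)%N, C2 => g gg gM.
have [l [lK lC hn]] := IH g gg gM.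
set h := (lprod l)^-1 * g in hn.
have hg : glike h by apply: glikeM => //; apply: glikeV; apply: glike_lprod.
have hM w : `|h w| <= M2.
  apply: (le_trans (tnorm_coord _ _)); apply: (le_trans (tnormM _ _)).
  apply: ler_pM; rewrite ?tnorm_ge0 //; last exact: tnorm_le.
  by rewrite -lprod_inv HM1 ?size_linv ?lbound_linv.
pose f (u : word) := lbracket u (n.+1%:R^-1 * h u).
exists (l ++ flatten [seq f u | u <- W]); split.
- rewrite size_cat leq_add // size_flatten /shape -map_comp sumnE big_map.
  by apply: leq_sum => u _ /=; rewrite (@size_lbracket u _ 0).
- rewrite /lbound all_cat; apply/andP; split.
    by apply: sub_all lC => q qC; apply: (le_trans qC); rewrite le_max lexx.
  apply/allP => q /flattenP[_ /mapP[u _ ->]]; apply/allP: q; apply: lbound_lbracket.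
    by rewrite !le_max lexx !orbT.
  have hu : `|n.+1%:R^-1 * h u| <= M2.
    rewrite normrM ger0_norm ?invr_ge0 ?ler0n //; apply: le_trans (hM u).
    by rewrite ler_piMl ?normr_ge0 // invf_le1 ?ler1n ?ltr0n.
  by rewrite !le_max hu !orbT.
- pose P := lprod (flatten [seq f u | u <- W]).
  have Pg : glike P := glike_lprod _.
  have PT : tord n.+2 (P - 1 - lead n.+1 h).
    rewrite /lead scaler_sumr (eq_bigl (fun u : word => (u \in {: word}) && (size u == n.+1))) //.
    rewrite -big_enum_cond -big_filter -/W.
    apply: lprod_flatten_tord => u; rewrite mem_filter => /andP[/eqP us _].
      by do 2 apply: tordZ; rewrite -us; apply: tord_brw.
    have u0 : bseqval u != [::] by rewrite -size_eq0 us.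
    by rewrite scalerA; have := lprod_lbracket (n.+1%:R^-1 * h u) u0; rewrite us.
  rewrite lprod_cat -/P invrM ?(glike_unit Pg) ?(glike_unit (glike_lprod l)) //.
  rewrite -mulrA -/h -(mulVr (glike_unit Pg)) -mulrBr -[n.+2]add0n.
  apply: tordM => //.
  rewrite (_ : h - P = (h - 1 - lead n.+1 h) - (P - 1 - lead n.+1 h)).
    by apply: tordB => //; apply: glike_lead.
  by rewrite opprB addrA subrK opprB addrA subrK.
Qed.

End CoordinateNorm.

(** * Chow factorization with homogeneous bounds *)

Section Chow.
Variables (R : realType) (V : normedVectType R) (m : nat).
Local Notation d := (\dim {:V}).
Local Notation T := (ttensor R d m).
Local Notation word := (m.-bseq 'I_d).

Lemma tdil_lprod (t : R) l :
  dilation t (lprod m l : T) = lprod m [seq (t * q.1, q.2) | q <- l].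
Proof.
elim: l => [|q l IH]; first by rewrite /lprod !big_nil tdil1.
by rewrite /= !lprod_cons tdilM IH tdil_exp tdilZ tdil_basis scalerA mulrC.
Qed.

(** Dilating by 1/lam reduces to coordinates bounded by 1, where [chow_level] at level m leaves no
    remainder; dilating back multiplies every coefficient by lam. *)
Lemma chow : exists (K : nat) (C : R), 0 < C /\ forall (lam : R) (g : T),
  0 <= lam -> glike g -> (forall w, `|g w| <= lam ^+ size w) ->
  exists l, [/\ (size l <= K)%N, lbound (C * lam) l & g = lprod m l].
Proof.
have [K [C H]] := @chow_level R d m m 1.
exists K, (Num.max C 1); split=> [|lam g]; first by rewrite lt_max ltr01 orbT.
rewrite le_eqVlt => /predU1P[<-|lam0] gg gl.
  (* For lam = 0 only the empty word may carry a nonzero coordinate, as 0^0 = 1; so g = 1. *)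
  exists [::]; split=> //; rewrite /lprod big_nil; apply/ffunP => w.
  rewrite toneE; have [w0|w0] := eqVneq (bseqval w) [::].
    by case: gg => g1 _ _; rewrite -g1; congr (g _); apply: val_inj.
  have := gl w; rewrite expr0n size_eq0 (negbTE w0) normr_le0.
  by move/eqP.
pose g' := dilation lam^-1 g.
have gg' : glike g' by apply: glike_dil.
have g'1 w : `|g' w| <= 1.
  rewrite tdilE normrM exprVn normfV normrX gtr0_norm // mulrC.
  by rewrite ler_pdivrMr ?mul1r ?exprn_gt0.
have [l [lK lC hl]] := H g' gg' g'1.
have gl' : g' = lprod m l.
  have lu := glike_unit (glike_lprod m l).
  have := tord_eq0 (ltnSn m) hl => /eqP; rewrite subr_eq0 => /eqP E.
  by rewrite -[g'](mulVKr lu) E mulr1.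
exists [seq (lam * q.1, q.2) | q <- l]; split; first by rewrite size_map.
  rewrite /lbound all_map; apply: sub_all lC => q /= qC.
  rewrite normrM gtr0_norm // mulrC ler_wpM2r ?(ltW lam0) // le_max qC //.
by rewrite -tdil_lprod -gl' tdil_comp divff ?tdil_id // gt_eqF.
Qed.

End Chow.

(** * Compactness in finite dimension *)

Section Compactness.
Variable R : realType.

(** Formulated as a cluster point approached at arbitrarily late indices, which spares the
    extraction of subsequences. *)
Lemma bolzano_weierstrass (I : finType) (u : nat -> I -> R) (M : R) :
  (forall k i, `|u k i| <= M) ->
  exists v : I -> R, forall (eps : R) (k : nat), 0 < eps ->
    exists2 j, (k <= j)%N & forall i, `|u j i - v i| < eps.
Proof.
move=> uM; pose x k : 'rV[R]_#|I| := \row_i u k (enum_val i).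
pose K := [set v : 'rV[R]_#|I| | forall i, `[- M, M]%classic (v ord0 i)].
have cK : compact K.
  by apply: (@rV_compact _ _ (fun=> `[- M, M]%classic)) => _; exact: segment_compact.
have xK : (x @ \oo) K.
  by exists 0%N => // k _ i /=; rewrite in_itv /= mxE -ler_norml.
have [v [_ cv]] := cK _ _ xK.
exists (fun i => v ord0 (enum_rank i)) => eps k eps0.
have [|_ [[j kj <-] /= [_ xv]]] := cv [set x j | j in [set j | (k <= j)%N]] _ _ (nbhsx_ballx v _ eps0).
  by exists k => // j kj; exists j.
exists j => // i; have := xv ord0 (enum_rank i).
by rewrite /ball /= mxE enum_rankK distrC.
Qed.

Lemma le0_of_eps (x C : R) : (forall eps, 0 < eps -> x <= C * eps) -> x <= 0.
Proof.
move=> H; rewrite leNgt; apply/negP => x0.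
have C0 : 0 < C by have := lt_le_trans x0 (H 1 ltr01); rewrite mulr1.
have := H (x / (2 * C)); rewrite divr_gt0 ?mulr_gt0 // => /(_ isT).
have -> : C * (x / (2 * C)) = x / 2 by field; rewrite gt_eqF.
lra.
Qed.

(** If the norm were not bounded below on the unit sphere of the l^1 coordinate norm s, a sequence
    there would have norms tending to 0. A cluster point then has norm 0, so all its coordinates
    vanish, against s = 1 along the sequence. *)
Lemma coord_bounded (V : normedVectType R) : exists C : R, forall (v : V) i,
  `|coord (vbasis {:V}) i v| <= C * `|v|.
Proof.
pose b := vbasis {:V}; pose s (v : V) := \sum_i `|coord b i v|.
have sZ (k : R) v : s (k *: v) = `|k| * s v.
  by rewrite mulr_sumr; apply: eq_bigr => i _; rewrite linearZ normrM.
have vE v : v = \sum_i coord b i v *: b`_i.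
  by apply: coord_vbasis; rewrite memvf.
suff [c c0 cs] : exists2 c, 0 < c & forall v, s v = 1 -> c <= `|v|.
  exists c^-1 => v i; have svi : `|coord b i v| <= s v.
    by rewrite /s (bigD1 i) //= lerDl sumr_ge0.
  apply: (le_trans svi); have [s0|s0] := eqVneq (s v) 0.
    by rewrite s0 mulr_ge0 // invr_ge0 ltW.
  have sp : 0 < s v by rewrite lt_neqAle eq_sym s0 sumr_ge0.
  have := cs ((s v)^-1 *: v); rewrite sZ normrZ gtr0_norm ?invr_gt0 // mulVf //.
  move=> /(_ erefl); rewrite mulrC ler_pdivlMr // => h.
  by rewrite mulrC ler_pdivlMr // mulrC.
apply: contrapT => H.
have {H} H k : exists v, s v = 1 /\ `|v| < k.+1%:R^-1.
  apply: contrapT => Hk; apply: H; exists k.+1%:R^-1; first by rewrite invr_gt0.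
  by move=> v sv; rewrite leNgt; apply/negP => vk; apply: Hk; exists v.
have [u Hu] := choice H.
have uM k i : `|coord b i (u k)| <= 1.
  by rewrite -(Hu k).1 /s (bigD1 i) //= lerDl sumr_ge0.
have [x Hx] := @bolzano_weierstrass _ (fun k i => coord b i (u k)) 1 uM.
pose v := \sum_i x i *: b`_i.
have bfree : free b := basis_free (vbasisP _).
have cv i : coord b i v = x i by rewrite coord_sum_free.
pose B := \sum_(i < \dim {:V}) `|b`_i|.
have v0 : `|v| <= 0.
  apply: (@le0_of_eps _ (1 + B)) => eps eps0.
  have [k _ ke] : exists2 k, (0 <= k)%N & k.+1%:R^-1 < eps.
    have [k _ kP] := near_infty_natSinv_lt (PosNum eps0).
    by exists k => //; apply: kP => /=.
  have [j kj Hj] := Hx eps k eps0.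
  rewrite -[v](subrK (u j)) mulrDl mul1r addrC.
  apply: (le_trans (ler_normD _ _)); apply: lerD.
    apply: ltW; apply: (lt_trans (Hu j).2); apply: le_lt_trans ke.
    by rewrite lef_pV2 ?posrE // ler_nat.
  rewrite [u j]vE -sumrB mulr_suml; apply: (le_trans (ler_norm_sum _ _ _)).
  apply: ler_sum => i _; rewrite -scalerBl normrZ mulrC ler_wpM2l //.
  by rewrite distrC ltW.
have : 1 <= (0 : R).
  apply: (@le0_of_eps _ #|'I_(\dim {:V})|%:R) => eps eps0.
  have [j _ Hj] := Hx eps 0%N eps0.
  rewrite mulr_natl -(Hu j).1 -sumr_const; apply: ler_sum => i _.
  have vz : v = 0 by apply/eqP; rewrite -normr_eq0 eq_le v0 normr_ge0.
  by have := Hj i; rewrite -cv vz linear0 subr0 => /ltW.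
by rewrite ler10.
Qed.

End Compactness.

(** * Closedness of the group *)

Section GroupClosed.
Variables (R : realType) (d m : nat).
Local Notation T := (ttensor R d m).
Local Notation word := (m.-bseq 'I_d).

Lemma tnorm_coord_sum (a : T) (c : word -> T) :
  tnorm (\sum_w a w *: c w) <= tnorm a * \sum_w tnorm (c w).
Proof.
rewrite mulr_suml; apply: (le_trans (tnorm_sum _ _ _)); apply: ler_sum => w _.
rewrite tnormZ ler_wpM2l //.
by rewrite (bigD1 w) //= lerDl sumr_ge0 // => u _; apply: tnorm_ge0.
Qed.

Lemma tnormN (a : T) : tnorm (- a) = tnorm a.
Proof. by rewrite -scaleN1r tnormZ normrN1 mul1r. Qed.

Lemma tnorm_le0 (a : T) : tnorm a <= 0 -> a = 0.
Proof.
move=> a0; apply/ffunP => w; rewrite tzeroE; apply/eqP.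
by rewrite -normr_le0 (le_trans (tnorm_coord a w)).
Qed.

Lemma tnorm_deg (a : T) : tnorm (tdeg a) <= m%:R * tnorm a.
Proof.
rewrite mulr_sumr; apply: ler_sum => w _.
by rewrite tdegE normrM ger0_norm // ler_wpM2r // ler_nat size_bseq.
Qed.

Lemma glike_closed (g : T) :
  (forall eps, 0 < eps -> exists2 h, glike h & tnorm (h - g) <= eps) -> glike g.
Proof.
move=> Hg.
have H eps : 0 < eps -> exists2 h : T, glike h &
    tnorm (g - h) <= eps /\ tnorm h <= tnorm g + eps.
  move=> /Hg[h hh hg]; exists h => //; split; first by rewrite -tnormN opprB.
  by rewrite -[h](subrK g) addrC; apply: (le_trans (tnormD _ _)); rewrite lerD2l.
split.
- apply/eqP; rewrite -subr_eq0 -normr_le0; apply: (@le0_of_eps _ _ 1) => eps e0.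
  have [h [h1 _ _] [hg _]] := H eps e0; rewrite mul1r -h1.
  by apply: le_trans hg; rewrite -tsubE; apply: tnorm_coord.
- move=> z; apply/eqP; rewrite -subr_eq0; apply/eqP; apply: tnorm_le0.
  pose K := \sum_(w : word) tnorm (adw w z).
  have K0 : 0 <= K by apply: sumr_ge0 => w _; apply: tnorm_ge0.
  have tK a : tnorm (tact a z) <= tnorm a * K by exact: tnorm_coord_sum.
  apply: (@le0_of_eps _ _ (K * tnorm g + (tnorm g + 1) * K + tnorm z)) => eps0 e0.
  (* With eps at most 1, [tnorm h] is at most [tnorm g + 1], so that the error is a constant times
     eps. *)
  pose eps := Num.min eps0 1.
  have e1 : 0 < eps by rewrite lt_min e0 ltr01.
  have [h [_ hz _] [hg hh]] := H eps e1.
  have -> : tact g z * g - g * z =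
      tact (g - h) z * g + tact h z * (g - h) - (g - h) * z.
    by rewrite tactBl mulrBl mulrBr hz mulrBl addrA subrK opprB addrA subrK.
  apply: (@le_trans _ _ ((K * tnorm g + (tnorm g + 1) * K + tnorm z) * eps)); last first.
    rewrite ler_wpM2l ?ge_min ?lexx // !addr_ge0 ?mulr_ge0 ?tnorm_ge0 //.
    by rewrite addr_ge0 ?tnorm_ge0.
  apply: (le_trans (tnormD _ _)); rewrite tnormN [leRHS]mulrDl; apply: lerD; last first.
    apply: (le_trans (tnormM _ _)); rewrite mulrC ler_wpM2l ?tnorm_ge0 //.
  apply: (le_trans (tnormD _ _)); rewrite [leRHS]mulrDl; apply: lerD.
    apply: (le_trans (tnormM _ _)).
    rewrite [leRHS]mulrC mulrA; apply: ler_wpM2r; first exact: tnorm_ge0.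
    by apply: (le_trans (tK _)); apply: ler_wpM2r.
  apply: (le_trans (tnormM _ _)); apply: ler_pM; rewrite ?tnorm_ge0 //.
  apply: (le_trans (tK _)); apply: ler_wpM2r => //; apply: (le_trans hh).
  by rewrite lerD2l ge_min lexx orbT.
- apply/eqP; rewrite -subr_eq0; apply/eqP; apply: tnorm_le0.
  pose K := \sum_(w : word) tnorm (brw R m w).
  have K0 : 0 <= K by apply: sumr_ge0 => w _; apply: tnorm_ge0.
  have tK (a : T) : tnorm (dynkin a) <= tnorm a * K by exact: tnorm_coord_sum.
  apply: (@le0_of_eps _ _ (K * tnorm g + (tnorm g + 1) * K + m%:R)) => eps0 e0.
  pose eps := Num.min eps0 1.
  have e1 : 0 < eps by rewrite lt_min e0 ltr01.
  have [h [_ _ hD] [hg hh]] := H eps e1.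
  have -> : tdeg g - dynkin g * g =
      - (dynkin (g - h) * g + dynkin h * (g - h)) + tdeg (g - h).
    by rewrite dynkinB mulrBl mulrBr -hD tdegB subrKA opprB [RHS]addrC subrKA.
  apply: (@le_trans _ _ ((K * tnorm g + (tnorm g + 1) * K + m%:R) * eps)); last first.
    rewrite ler_wpM2l ?ge_min ?lexx // !addr_ge0 ?mulr_ge0 ?tnorm_ge0 //.
    by rewrite addr_ge0 ?tnorm_ge0.
  apply: (le_trans (tnormD _ _)); rewrite tnormN [leRHS]mulrDl; apply: lerD; last first.
    by apply: (le_trans (tnorm_deg _)); rewrite ler_wpM2l.
  apply: (le_trans (tnormD _ _)); rewrite [leRHS]mulrDl; apply: lerD.
    apply: (le_trans (tnormM _ _)).
    rewrite [leRHS]mulrC mulrA; apply: ler_wpM2r; first exact: tnorm_ge0.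
    by apply: (le_trans (tK _)); apply: ler_wpM2r.
  apply: (le_trans (tnormM _ _)); apply: ler_pM; rewrite ?tnorm_ge0 //.
  apply: (le_trans (tK _)); apply: ler_wpM2r => //; apply: (le_trans hh).
  by rewrite lerD2l ge_min lexx orbT.
Qed.

End GroupClosed.

(** * Comparison of N with the coordinates *)

Section HomogeneousNorm.
Variables (R : realType) (V : normedVectType R) (m : nat).
Local Notation d := (\dim {:V}).
Local Notation T := (ttensor R d m).
Local Notation word := (m.-bseq 'I_d).
Variable N : T -> R.
Hypothesis HN : @homogeneous_norm R V m N.
Implicit Types (g h a : T).

Lemma hnorm_ge0 g : glike g -> 0 <= N g.
Proof. by move=> /free_nilpotentE gg; have [H _ _ _ _] := HN; apply: H. Qed.

Lemma hnorm_eq0 g : glike g -> N g = 0 -> g = 1.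
Proof. by move=> /free_nilpotentE gg; have [_ H _ _ _] := HN; move/H; apply. Qed.

Lemma hnorm1 : N 1 = 0.
Proof. by have [_ H _ _ _] := HN; apply/H => //; apply/free_nilpotentE; exact: glike1. Qed.

Lemma hnorm_dil (t : R) g : glike g -> N (dilation t g) = `|t| * N g.
Proof. by move=> /free_nilpotentE gg; have [_ _ H _ _] := HN; apply: H. Qed.

Lemma hnormM g h : glike g -> glike h -> N (g * h) <= N g + N h.
Proof.
move=> /free_nilpotentE gg /free_nilpotentE hh; have [_ _ _ H _] := HN; exact: H.
Qed.

Lemma hnormV g : glike g -> N g^-1 = N g.
Proof. by move=> /free_nilpotentE gg; have [_ _ _ _ H] := HN; apply: H. Qed.

(** Each factor exp(c e_i) is the dilation by c of exp(e_i), on which N scales exactly;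
    subadditivity does the rest. *)
Lemma hnorm_upper : exists2 C : R, 0 < C & forall (lam : R) g, 0 <= lam -> glike g ->
  (forall w, `|g w| <= lam ^+ size w) -> N g <= C * lam.
Proof.
have [K [C [C0 H]]] := chow V m.
pose B : R := \sum_i N (texp (tbasis R m [:: i])).
have gl i : glike (texp (tbasis R m [:: i])).
  by rewrite -[tbasis R m [:: i]]scale1r; exact: glike_letter.
have B0 : 0 <= B by apply: sumr_ge0 => i _; apply: hnorm_ge0.
(* The summand 1 keeps the constant positive even if there are no letters. *)
exists (K%:R * (C * B) + 1) => [|lam g lam0 gg gl'].
  by rewrite ltr_wpDl // !mulr_ge0 // ltW.
have [l [lK lC ->]] := H lam g lam0 gg gl'.
have cb0 : 0 <= C * lam * B by rewrite !mulr_ge0 // ltW.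
apply: (@le_trans _ _ ((size l)%:R * (C * lam * B))).
  elim: l lC {lK} => [_|q l IH /= /andP[qC lC]].
    by rewrite /lprod big_nil hnorm1 mul0r.
  rewrite lprod_cons -[in leRHS]nat1r mulrDl mul1r.
  have qg : glike (texp (q.1 *: tbasis R m [:: q.2])) by exact: glike_letter.
  apply: (le_trans (hnormM qg (glike_lprod _ _))); apply: lerD; last exact: IH.
  have -> : texp (q.1 *: tbasis R m [:: q.2]) = dilation q.1 (texp (tbasis R m [:: q.2])).
    by rewrite tdil_exp tdil_basis expr1.
  rewrite hnorm_dil //; apply: ler_pM; rewrite ?hnorm_ge0 //.
  by rewrite /B (bigD1 q.2) //= lerDl; apply: sumr_ge0 => i _; apply: hnorm_ge0.
apply: (@le_trans _ _ (K%:R * (C * lam * B))); first by rewrite ler_wpM2r // ler_nat.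
have -> : (K%:R * (C * B) + 1) * lam = K%:R * (C * lam * B) + lam by ring.
by rewrite lerDl.
Qed.

(** With lam at most 1, lam^m is at most lam^|w| for every word, so closeness to 1 within lam^m
    gives the homogeneous bound of [hnorm_upper]. *)
Lemma hnorm_continuous1 (eps : R) : 0 < eps ->
  exists2 eta : R, 0 < eta & forall g, glike g -> tnorm (g - 1) <= eta -> N g <= eps.
Proof.
move=> eps0; have [C C0 H] := hnorm_upper.
pose lam := Num.min (eps / C) 1.
have lam0 : 0 < lam by rewrite lt_min ltr01 divr_gt0.
have lam1 : lam <= 1 by rewrite ge_min lexx orbT.
exists (lam ^+ m); first exact: exprn_gt0.
move=> g gg geta; apply: (@le_trans _ _ (C * lam)); last first.
  by rewrite mulrC -ler_pdivlMr // ge_min lexx.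
apply: H => //; [exact: ltW|move=> w].
have [w0|w0] := eqVneq (bseqval w) [::].
  rewrite w0 expr0; have -> : w = [bseq] by apply: val_inj.
  by have [-> _ _] := gg; rewrite normr1.
apply: (le_trans _ (ler_wiXn2l (ltW lam0) lam1 (size_bseq w))).
apply: le_trans geta; apply: le_trans (tnorm_coord _ w).
by rewrite tsubE toneE (negbTE w0) subr0.
Qed.

(** Subadditivity would only give 2 N g + N a; in coordinates the deviation from 1 is g^-1 (a - 1)
    g, which is linear in a - 1. *)
Lemma hnorm_conj (M eps : R) : 0 < eps -> exists2 eta : R, 0 < eta & forall g a,
  glike g -> glike a -> tnorm g <= M -> tnorm g^-1 <= M -> tnorm (a - 1) <= eta ->
  N (g^-1 * a * g) <= eps.
Proof.
move=> eps0; have [eta eta0 H] := hnorm_continuous1 eps0.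
pose B := `|M| + 1.
have B0 : 0 < B by rewrite ltr_wpDl.
exists (eta / (B * B)); first by rewrite divr_gt0 ?mulr_gt0.
move=> g a gg aa gM gVM aeta; apply: H.
  by apply: glikeM => //; apply: glikeM => //; apply: glikeV.
have gu := glike_unit gg.
have -> : g^-1 * a * g - 1 = g^-1 * (a - 1) * g.
  by rewrite mulrBr mulr1 mulrBl mulVr.
have MB x : x <= M -> x <= B.
  by move=> xM; apply: (le_trans xM); apply: (le_trans (ler_norm _)); rewrite lerDl.
apply: (le_trans (tnormM _ _)).
apply: (@le_trans _ _ (B * (eta / (B * B)) * B)).
  apply: ler_pM; rewrite ?tnorm_ge0 ?MB //.
  apply: (le_trans (tnormM _ _)).
  by apply: ler_pM; rewrite ?tnorm_ge0 ?MB.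
have -> : B * (eta / (B * B)) * B = eta by field; rewrite gt_eqF.
exact: lexx.
Qed.

(* The half-open annulus swept out by the dilations by powers of 1/2 is
   relatively compact and stays away from 1. *)
Lemma hnorm_annulus : exists2 c : R, 0 < c & forall g, glike g ->
  (forall w, `|g w| <= 1) -> 2^-1 ^+ m <= tnorm (g - 1) -> c <= N g.
Proof.
apply: contrapT => Hc.
have {Hc} H k : exists g, [/\ glike g, forall w, `|g w| <= 1,
    2^-1 ^+ m <= tnorm (g - 1) & N g < k.+1%:R^-1].
  apply: contrapT => Hk; apply: Hc; exists k.+1%:R^-1; first by rewrite invr_gt0.
  move=> g gg g1 gm; rewrite leNgt; apply/negP => gk; apply: Hk; by exists g.
have [u Hu] := choice H.
have uM k w : `|u k w| <= 1 by have [_ + _ _] := Hu k.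
have [x Hx] := @bolzano_weierstrass _ _ (fun k w => u k w) 1 uM.
pose v : T := [ffun w => x w].
pose n : R := #|{: word}|%:R.
have Hv eps k : 0 < eps -> exists2 j, (k <= j)%N & tnorm (u j - v) <= n * eps.
  move=> e0; have [j kj Hj] := Hx eps k e0; exists j => //.
  rewrite mulr_natl; apply: tnorm_le => w; rewrite tsubE [v w]ffunE.
  exact/ltW/Hj.
have vg : glike v.
  apply: glike_closed => eps e0.
  have n1 : 0 < n + 1 by rewrite ltr_wpDl.
  have [j _ Hj] := Hv (eps / (n + 1)) 0%N (divr_gt0 e0 n1).
  have [ug _ _ _] := Hu j; exists (u j) => //; apply: (le_trans Hj).
  rewrite mulrA ler_pdivrMr // mulrC ler_wpM2l ?(ltW e0) //.
  by rewrite lerDl.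
(* N v is at most N (u j) + N (v^-1 * u j). The first term is small by the choice of u, the second
   by continuity of N at 1. But v = 1 contradicts the distance of u from 1. *)
have v1 : v = 1.
  apply: hnorm_eq0 => //; apply/eqP; rewrite eq_le hnorm_ge0 // andbT.
  apply: (@le0_of_eps _ _ 2) => eps e0.
  have [eta eta0 He] := hnorm_continuous1 e0.
  pose B := tnorm v^-1 * n + 1.
  have B0 : 0 < B by rewrite ltr_wpDl // mulr_ge0 ?tnorm_ge0.
  have [k _ ke] : exists2 k, (0 <= k)%N & k.+1%:R^-1 < eps.
    have [k _ kP] := near_infty_natSinv_lt (PosNum e0).
    by exists k => //; apply: kP => /=.
  have [j kj Hj] := Hv (eta / B) k (divr_gt0 eta0 B0).
  have [ug _ _ uN] := Hu j.
  have vu := glike_unit vg; have uu := glike_unit ug.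
  have hg : glike (v^-1 * u j) by apply: glikeM => //; apply: glikeV.
  have -> : v = u j * (v^-1 * u j)^-1.
    by rewrite invrM ?unitrV // invrK mulrA divrr // mul1r.
  apply: (le_trans (hnormM ug (glikeV hg))); rewrite mulr_natl mulr2n.
  apply: lerD.
    apply: ltW; apply: (lt_trans uN); apply: le_lt_trans ke.
    by rewrite lef_pV2 ?posrE // ler_nat.
  rewrite hnormV //; apply: He => //.
  have -> : v^-1 * u j - 1 = v^-1 * (u j - v) by rewrite mulrBr mulVr.
  apply: (le_trans (tnormM _ _)).
  apply: (le_trans (ler_wpM2l (tnorm_ge0 _) Hj)).
  rewrite !mulrA ler_pdivrMr // [leRHS]mulrC.
  by rewrite ler_wpM2r ?(ltW eta0) // lerDl.
have : (2^-1 : R) ^+ m <= 0.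
  apply: (@le0_of_eps _ _ n) => eps e0.
  have [j _ Hj] := Hv eps 0%N e0; have [_ _ um _] := Hu j.
  by apply: (le_trans um); rewrite -v1.
by rewrite leNgt exprn_gt0.
Qed.

(** By dilation it suffices that N g < c forces all coordinates to be at most 1. Otherwise halve g
    until they are: just after the last halving g lies in the annulus, where N is at least c,
    although halving has only decreased N. *)
Lemma hnorm_lower : exists2 C : R, 0 < C & forall g, glike g ->
  forall w, `|g w| <= (C * N g) ^+ size w.
Proof.
have [c c0 Hc] := hnorm_annulus.
have small g : glike g -> N g < c -> forall w, `|g w| <= 1.
  move=> gg gc; pose h k := dilation (2^-1 ^+ k) g.
  pose P k := [forall w, `|h k w| <= 1].
  have hE k w : h k w = (2^-1 ^+ k) ^+ size w * g w by rewrite tdilE.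
  have h0 : h 0%N = g by rewrite /h expr0 tdil_id.
  have hg k : glike (h k) by apply: glike_dil.
  have hN k : N (h k) < c.
    rewrite hnorm_dil // ger0_norm ?exprn_ge0 //.
    apply: le_lt_trans gc; rewrite ler_piMl ?hnorm_ge0 //.
    by rewrite exprn_ile1 // invf_le1 // ler1n.
  have h1 k w : bseqval w = [::] -> `|h k w| = 1.
    move=> w0; have -> : w = [bseq] by apply: val_inj.
    by have [-> _ _] := hg k; rewrite normr1.
  have exP : exists k, P k.
    have [k Hk] : exists k, tnorm g <= 2 ^+ k :> R.
      by exists (Num.bound (tnorm g)); apply: ltW; exact: upper_nthrootP.
    exists k; apply/forallP => w; have [w0|w0] := eqVneq (bseqval w) [::].
      by rewrite h1.
    rewrite hE normrM ger0_norm ?exprn_ge0 //.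
    apply: (@le_trans _ _ (2^-1 ^+ k * tnorm g)).
      apply: ler_pM; rewrite ?exprn_ge0 ?tnorm_coord //.
      have s0 : (1 <= size w)%N by rewrite lt0n size_eq0.
      have i1 : 2^-1 ^+ k <= 1 :> R by rewrite exprn_ile1 // invf_le1 // ler1n.
      by have := @ler_wiXn2l R (2^-1 ^+ k) _ i1 _ _ s0; rewrite expr1; apply; rewrite exprn_ge0.
    by rewrite exprVn mulrC ler_pdivrMr ?exprn_gt0 // mul1r.
  case: (ex_minnP exP) => -[|k] Pk kmin.
    by move=> w; have := forallP Pk w; rewrite h0.
  have /existsP[w] : [exists w, ~~ (`|h k w| <= 1)].
    by rewrite -negb_forall; apply/negP => /kmin; rewrite ltnn.
  rewrite -ltNge => hw.
  have w0 : bseqval w != [::] by apply: contraTneq hw => w0; rewrite h1 ?ltxx.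
  have := hN k.+1; rewrite ltNge => /negP[]; apply: Hc => //.
    exact/forallP.
  apply: le_trans (tnorm_coord _ w).
  rewrite tsubE toneE (negbTE w0) subr0.
  have -> : h k.+1 w = 2^-1 ^+ size w * h k w.
    by rewrite !hE exprS exprMn mulrA.
  rewrite normrM ger0_norm ?exprn_ge0 //.
  apply: (@le_trans _ _ (2^-1 ^+ size w)).
    by apply: ler_wiXn2l; rewrite ?invf_le1 ?ler1n ?size_bseq.
  by rewrite ler_peMr ?exprn_ge0 // ltW.
exists (2 / c) => [|g gg w]; first exact: divr_gt0.
have [g0|g0] := eqVneq (N g) 0.
  rewrite (hnorm_eq0 gg g0) hnorm1 mulr0 toneE expr0n size_eq0.
  by case: eqP => _; rewrite ?normr1 ?normr0.
have Ng : 0 < N g by rewrite lt_neqAle eq_sym g0 hnorm_ge0.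
(* The dilate by t has N equal to c / 2, strictly below c. *)
pose t := c / (2 * N g).
have t0 : 0 < t by rewrite divr_gt0 ?mulr_gt0.
have := small (dilation t g) (glike_dil _ gg).
rewrite hnorm_dil // gtr0_norm //.
have -> : t * N g = c / 2 by rewrite /t; field; rewrite gt_eqF.
have c2 : c / 2 < c by lra.
move=> /(_ c2 w); rewrite tdilE normrM ger0_norm ?exprn_ge0 ?(ltW t0) //.
rewrite mulrC -ler_pdivlMr ?exprn_gt0 // mul1r -exprVn.
have -> // : t^-1 = 2 / c * N g by rewrite /t; field; rewrite !gt_eqF.
Qed.

End HomogeneousNorm.

(** * Antiderivatives *)

Section Primitive.
Variable R : realType.
Local Notation mu := (@lebesgue_measure R).

(** The antiderivative that vanishes at 0. Integrating from a base b < 0 gives it a two-sided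
    derivative at 0 as well. *)
Definition primitive (b : R) (f : R -> R) (t : R) : R :=
  \int[mu]_(u in `[b, t]) f u - \int[mu]_(u in `[b, 0]) f u.

Lemma is_derive_primitive (f : R -> R) (a b t : R) : a < b -> b < t ->
  (forall t, a < t -> {for t, continuous f}) -> is_derive t 1 (primitive b f) (f t).
Proof.
move=> ab bt fc.
have fi : mu.-integrable `[b, t + 1] (EFin \o f).
  apply: continuous_compact_integrable; first exact: segment_compact.
  apply: continuous_in_subspaceT => x; rewrite inE /= in_itv /= => /andP[bx _].
  exact/fc/(lt_le_trans ab).
have tt : t < t + 1 by rewrite ltrDl.
have [df fE] := continuous_FTC1_closed tt fi bt (fc t (lt_trans ab bt)).
have H : is_derive t 1 (fun t => \int[mu]_(u in `[b, t]) f u) (f t).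
  by apply: DeriveDef; [exact: df|rewrite -fE derive1E].
apply: (is_derive_eq (is_deriveB H (is_derive_cst (\int[mu]_(u in `[b, 0]) f u : R^o) t 1))).
by rewrite subr0.
Qed.

Lemma primitive_int (f : R -> R) (a b t : R) : a < b -> b < 0 -> 0 <= t ->
  (forall t, a < t -> {for t, continuous f}) ->
  \int[mu]_(u in `[0, t]) f u = primitive b f t.
Proof.
move=> ab b0; rewrite le_eqVlt => /predU1P[<- _|t0 fc].
  by rewrite /primitive subrr set_itv1 Rintegral_set1.
have d (s : R) : 0 <= s -> is_derive s 1 (primitive b f) (f s).
  by move=> s0; apply: (@is_derive_primitive f a b s) => //; exact: lt_le_trans s0.
have cF (s : R) : 0 <= s -> {for s, continuous (primitive b f)}.
  move=> s0; have [df _] := d s s0.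
  by apply: differentiable_continuous; apply/derivable1_diffP.
rewrite /Rintegral (@continuous_FTC2 _ f (primitive b f) 0 t) //=.
- by rewrite [in X in _ - X]/primitive subrr subr0.
- apply: continuous_in_subspaceT => x; rewrite inE /= in_itv /= => /andP[x0 _].
  exact/fc/(lt_le_trans (lt_trans ab b0)).
- split.
  + by move=> x; rewrite in_itv /= => /andP[/ltW x0 _]; have [] := d x x0.
  + by apply: cvg_at_right_filter; exact: cF.
  + by apply: cvg_at_left_filter; apply: cF; exact: ltW.
- move=> x; rewrite in_itv /= => /andP[/ltW x0 _].
  by rewrite derive1E; have [_] := d x x0.
Qed.

Lemma Rintegral_zero (D : set R) : \int[mu]_(u in D) (0 : R) = 0.
Proof. by rewrite /Rintegral integral0. Qed.

Lemma primitive0 (f : R -> R) b : primitive b f 0 = 0.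
Proof. exact: subrr. Qed.

End Primitive.

(** * Coordinates of the signature *)

Section Development.
Variables (R : realType) (V : normedVectType R) (m : nat).
Local Notation d := (\dim {:V}).
Local Notation T := (ttensor R d m).
Local Notation word := (m.-bseq 'I_d).
Local Notation mu := (@lebesgue_measure R).
Local Notation e i := (tbasis R m [:: i]).
Local Notation cd i v := (coord (vbasis {:V}) i v).

Lemma tmul_tinj_nil (a : T) (v : V) : (a * tinj m v) [bseq] = 0.
Proof. by rewrite tmul_nil ffunE mulr0. Qed.

Lemma tmul_tinj_rcons (a : T) (v : V) (w w' : word) i : bseqval w = rcons w' i ->
  (a * tinj m v) w = a w' * cd i v.
Proof.
move=> ww; rewrite tmulE.
have m0 : (size [:: i] <= m)%N.
  by apply: leq_trans (size_bseq w); rewrite ww size_rcons.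
rewrite (bigD1 (w', Bseq m0)) /= ?cats1 ?ww // ffunE big1 ?addr0 // => -[x y] /=.
move=> /andP[/eqP xyw /eqP nw]; rewrite ffunE.
case E: (bseqval y) => [|j [|k s]]; rewrite ?mulr0 //.
case: nw; congr pair; apply: val_inj => /=.
  by move/eqP: xyw; rewrite E cats1 eqseq_rcons => /andP[/eqP].
by move/eqP: xyw; rewrite E cats1 eqseq_rcons => /andP[_ /eqP ->].
Qed.

Section Signature.
Variable y : R -> V.
Local Notation u i := (fun t : R => cd i (derive1 y t)).
Hypothesis uc : forall i t, {for t, continuous (u i)}.

(* The primitives must be differentiable beyond both ends of [0, 1]; each
   integration loses a bit of the domain on the left of -1. *)
Definition base (k : nat) : R := - 1 - k.+1%:R^-1.

Lemma base_ltS k : base k < base k.+1.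
Proof. by rewrite /base ltrD2l ltrN2 ltf_pV2 ?posrE ?ltr0n // ltr_nat. Qed.

Lemma base_ltN1 k : base k < -1.
Proof. by rewrite /base ltrBlDr ltrDl invr_gt0 ltr0n. Qed.

(* The word is read from its last letter. *)
Fixpoint itint (r : seq 'I_d) : R -> R :=
  if r is i :: r' then primitive (base (size r)) (fun t => itint r' t * u i t)
  else cst 1.

Lemma itint_continuous_step r i (t : R) :
  (forall t, base (size r) < t -> {for t, continuous (itint r)}) ->
  base (size r) < t -> {for t, continuous (fun t => itint r t * u i t)}.
Proof. by move=> H rt; apply: continuousM; [exact: H|exact: uc]. Qed.

Lemma itint_continuous r (t : R) : base (size r) < t -> {for t, continuous (itint r)}.
Proof.
elim: r t => [|i r IH] t rt; first exact: cst_continuous.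
have [df _] : is_derive t 1 (itint (i :: r)) (itint r t * u i t).
  apply: (is_derive_primitive (f := fun t => itint r t * u i t) (base_ltS (size r))) => //.
  by move=> s; apply: itint_continuous_step.
by apply: differentiable_continuous; apply/derivable1_diffP.
Qed.

Lemma is_derive_itint i r (t : R) : -1 < t ->
  is_derive t 1 (itint (i :: r)) (itint r t * u i t).
Proof.
move=> t1; apply: (is_derive_primitive (f := fun t => itint r t * u i t) (base_ltS (size r))).
  by apply: lt_trans t1; exact: base_ltN1.
by move=> s; apply: itint_continuous_step; exact: itint_continuous.
Qed.

(** Continues the signature to t > -1, with two-sided derivatives; [signatureE] identifies the two
    for t >= 0. *)
Definition dev (t : R) : T := [ffun w : word => itint (rev w) t].

Lemma devE t (w : word) : dev t w = itint (rev w) t. Proof. by rewrite ffunE. Qed.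

Lemma dev_nil t : dev t [bseq] = 1. Proof. by rewrite devE. Qed.

Lemma dev0 : dev 0 = 1.
Proof.
apply/ffunP => w; rewrite devE toneE.
case: (lastP (bseqval w)) => [//|s i]; rewrite rev_rcons /= primitive0.
by case: s.
Qed.

Lemma word_last (w : word) : w = [bseq] \/
  exists (w' : word) i, bseqval w = rcons w' i.
Proof.
case E: {-}(bseqval w) / lastP => [|s i]; first by left; apply: val_inj.
have sm : (size s <= m)%N.
  by apply: leq_trans (size_bseq w); rewrite E size_rcons.
by right; exists (Bseq sm), i.
Qed.

Lemma tder_dev (t : R) : -1 < t -> tder dev t (dev t * tinj m (derive1 y t)).
Proof.
move=> t1 w; have [->|[w' [i ws]]] := word_last w.
  rewrite tmul_tinj_nil; under eq_fun do rewrite dev_nil.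
  exact: (is_derive_cst (1 : R^o)).
rewrite (tmul_tinj_rcons _ _ ws) devE.
have -> : (fun t => dev t w) = itint (i :: rev w').
  by apply/funext => x; rewrite devE ws rev_rcons.
exact: is_derive_itint.
Qed.

Lemma iterated_integralE k (t : R) (w : word) : 0 <= t ->
  iterated_integral m y k 0 t w = if size w == k then dev t w else 0.
Proof.
elim: k t w => [|k IH] t w t0.
  rewrite /= toneE size_eq0; case: eqP => // w0.
  by rewrite devE w0.
rewrite /= ffunE; have [->|[w' [i ws]]] := word_last w.
  rewrite /= (_ : (fun=> _) = fun=> 0); last first.
    by apply/funext => x; rewrite tmul_tinj_nil.
  by rewrite Rintegral_zero.
rewrite ws size_rcons eqSS.
transitivity (\int[mu]_(x in `[0, t])
    ((if size w' == k then 1 else 0) * (itint (rev w') x * u i x))).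
  apply: eq_Rintegral => x; rewrite inE /= in_itv /= => /andP[x0 _].
  rewrite (tmul_tinj_rcons _ _ ws) IH // devE.
  by case: eqP; rewrite ?mul1r ?mul0r.
case: eqP => sk; last first.
  by under eq_Rintegral do rewrite mul0r; rewrite Rintegral_zero.
under eq_Rintegral do rewrite mul1r.
rewrite devE ws rev_rcons /=.
apply: (@primitive_int _ _ (base (size (rev w')))) => //.
- exact: base_ltS.
- by apply: lt_trans (base_ltN1 _) _; rewrite ltrN10.
- by move=> x; apply: itint_continuous_step; exact: itint_continuous.
Qed.

Lemma signatureE (t : R) : 0 <= t -> signature m y 0 t = dev t.
Proof.
move=> t0; apply/ffunP => w; rewrite tsumE.
have ms : (size w < m.+1)%N by rewrite ltnS size_bseq.
rewrite (bigD1 (Ordinal ms)) //= iterated_integralE // eqxx big1 ?addr0 // => k kw.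
rewrite iterated_integralE //; case: eqP => // wk.
by case/eqP: kw; apply: val_inj; rewrite /= wk.
Qed.

End Signature.

End Development.

(** * Equations g' = g a *)

Section RightEquation.
Variables (R : realType) (d m : nat).
Local Notation T := (ttensor R d m).
Local Notation word := (m.-bseq 'I_d).
Implicit Types (g a : R -> T) (s t b : R) (x z : T).

Lemma tder_uniq g t x z : tder g t x -> tder g t z -> x = z.
Proof.
move=> gx gz; apply/ffunP => w.
by have [_ <-] := gx w; have [_ <-] := gz w.
Qed.

Lemma tder_expr_ex g t x (k : nat) : tder g t x ->
  exists z, tder (fun u => g u ^+ k) t z.
Proof.
move=> gx; elim: k => [|k [z IH]].
  by exists 0; apply: (tder_ext (f := fun=> 1)) (tder_cst 1 t).
exists (x * g t ^+ k + g t * z).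
apply: (tder_ext (f := fun u => g u * g u ^+ k)) (tderM gx IH) => u.
by rewrite exprS.
Qed.

(** The inverse is a finite geometric series in 1 - g, hence differentiable; the value of its
    derivative then follows by differentiating g^-1 g = 1. *)
Lemma tder_inv g t x : (forall u, g u [bseq] = 1) -> tder g t x ->
  tder (fun u => (g u)^-1) t (- ((g t)^-1 * x * (g t)^-1)).
Proof.
move=> g1 gx.
have gu u : g u \is a GRing.unit := tunit1 (g1 u).
have gV u : (g u)^-1 = \sum_(k < m.+1) (1 - g u) ^+ k.
  have := tgeom (gu u); rewrite g1 invr1 scale1r => E.
  by rewrite -[RHS](mulKr (gu u)) E mulr1.
have [z gz] : exists z, tder (fun u => (g u)^-1) t z.
  have g1x : tder (fun u => 1 - g u) t (0 - x) := tderB (tder_cst 1 t) gx.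
  have [f fE] := choice (fun k : nat => tder_expr_ex k g1x).
  exists (\sum_(k < m.+1) f k).
  apply: (tder_ext (f := fun u => \sum_(k < m.+1) (1 - g u) ^+ k)) => [u //|].
  by apply: tder_sum => k _; exact: fE.
suff <- : z = - ((g t)^-1 * x * (g t)^-1) by [].
have H0 : tder (fun u => (g u)^-1 * g u) t 0.
  apply: (tder_ext (f := fun=> 1)) (tder_cst 1 t) => u.
  by rewrite mulVr.
have /eqP := tder_uniq (tderM gz gx) H0; rewrite addr_eq0 => /eqP E.
by rewrite -[z](mulrK (gu t)) E mulNr.
Qed.

(** Signatures solve g' = g a, whereas [glike_ode] treats h' = a h; the inverse of g solves the
    latter with -a. *)
Lemma glike_right_ode a g s b : s <= b -> (forall t, lielike (a t)) ->
  (forall t, g t [bseq] = 1) ->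
  (forall t, s <= t <= b -> tder g t (g t * a t)) -> g s = 1 -> glike (g b).
Proof.
move=> sb aL g1 gd gs.
rewrite -[g b]invrK; apply: glikeV.
apply: (glike_ode (a := fun t => - a t) (h := fun t => (g t)^-1) sb).
- move=> t; rewrite -scaleN1r.
  by have [_ _ Z _] := lielike_subalgebra R d m; apply: Z.
- move=> t tI; apply: (tder_eq (tder_inv g1 (gd t tI))).
  by rewrite mulKr ?mulNr // tunit1.
- by rewrite gs invr1.
Qed.

Lemma tder_incr g t x z : tder g t x -> tder (fun u => z * g u) t (z * x).
Proof.
move=> gx; apply: (tder_eq (tderM (tder_cst z t) gx)).
by rewrite mul0r add0r.
Qed.

(** As x commutes with its own exponential, exp((Phi t - Phi s) x) solves the same equation, and
    [tode_right_eq0] gives uniqueness. *)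
Lemma tode_right_line (phi Phi : R -> R) g x s b : s <= b -> x [bseq] = 0 ->
  (forall t, s <= t <= b -> is_derive t 1 Phi (phi t)) ->
  (forall t, s <= t <= b -> tder g t (g t * (phi t *: x))) ->
  g s = 1 -> g b = texp ((Phi b - Phi s) *: x).
Proof.
move=> sb x0 Pd gd gs; apply/eqP; rewrite -subr_eq0; apply/eqP.
apply: (tode_right_eq0 (a := fun t => phi t *: x)
  (f := fun t => g t - texp ((Phi t - Phi s) *: x)) sb).
- by move=> t; rewrite tscaleE x0 mulr0.
- move=> t tI.
  have Pd' : is_derive t 1 (fun u => Phi u - Phi s) (phi t).
    apply: (is_derive_eq (is_deriveB (Pd t tI) (is_derive_cst (Phi s : R^o) t 1))).
    by rewrite subr0.
  apply: (tder_eq (tderB (gd t tI) (texp_der x0 Pd'))).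
  rewrite mulrBl; congr (_ - _); rewrite -scalerAr; congr (_ *: _).
  rewrite mulr_sumr mulr_suml; apply: eq_bigr => i _.
  by rewrite -scalerAr -scalerAl exprZn -scalerAr -scalerAl -exprS exprSr.
- by rewrite gs subrr scale0r texp0 subrr.
Qed.

End RightEquation.

(** * Increments of signatures *)

Section SignatureIncrements.
Variables (R : realType) (V : normedVectType R) (m : nat).
Local Notation d := (\dim {:V}).
Local Notation T := (ttensor R d m).
Local Notation word := (m.-bseq 'I_d).
Local Notation cd i v := (coord (vbasis {:V}) i v).

Lemma lielike_tinj (v : V) : lielike (tinj m v).
Proof. by apply: free_lielike; move=> A [_]; apply; exists v. Qed.

(** Induction on length: at [rcons w' i] the derivative is the coordinate at w' times one coordinate
    of v. The mean value inequality gives up a factor 1/|w|!, but keeps homogeneity. *)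
Lemma tder_size_bound (v : R -> V) (g : R -> T) (s b A : R) : 0 <= A ->
  (forall t, g t [bseq] = 1) ->
  (forall t, s <= t <= b -> tder g t (g t * tinj m (v t))) ->
  (forall t i, s <= t <= b -> `|cd i (v t)| <= A) -> g s = 1 ->
  forall (w : word) t, s <= t <= b -> `|g t w| <= (A * (t - s)) ^+ size w.
Proof.
move=> A0 g1 gd vA gs w; elim: {w}(size w) {-2}w (erefl (size w)) => [|n IH] w wn t.
  move=> _; have -> : w = [bseq] by apply: val_inj; apply/nilP; rewrite /nilp wn.
  by rewrite g1 normr1.
have [w0|[w' [i ws]]] := word_last w; first by rewrite w0 in wn.
have w'n : size w' = n by move: wn; rewrite ws size_rcons => -[].
move=> /andP[st tb].
have -> : g t w = g t w - g s w by rewrite gs toneE -size_eq0 wn subr0.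
have -> : (A * (t - s)) ^+ size w = (A * (t - s)) ^+ n * A * (t - s).
  by rewrite wn exprS; ring.
apply: (derive_bounded_incr (f := fun u => g u w)
  (f' := fun u => (g u * tinj m (v u)) w) st) => u /andP[su ut].
  by apply: gd; rewrite su (le_trans ut).
have uI : s <= u <= b by rewrite su (le_trans ut).
rewrite (tmul_tinj_rcons _ _ ws) normrM; apply: ler_pM => //; last exact: vA.
apply: (le_trans (IH w' w'n u uI)); rewrite w'n.
rewrite lerXn2r ?nnegrE ?mulr_ge0 ?subr_ge0 ?(le_trans su) //.
by rewrite ler_wpM2l // lerD2r.
Qed.

Variable y : R -> V.
Hypothesis y_smooth : smooth y.

Lemma smooth_coord_continuous i (t : R) :
  {for t, continuous (fun t => cd i (derive1 y t))}.
Proof.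
have [C HC] := coord_bounded V.
have dy : derivable (derive1 y) t 1 := @y_smooth 1%N t.
have cy : {for t, continuous (derive1 y)}.
  by apply: differentiable_continuous; apply/derivable1_diffP.
apply/cvgrPdist_lt => eps e0.
have C1 : 0 < `|C| + 1 by rewrite ltr_wpDl.
have /cvgrPdist_lt /(_ (eps / (`|C| + 1)) (divr_gt0 e0 C1)) := cy.
apply: filterS => x xe; rewrite -linearB /=.
apply: (le_lt_trans (HC _ i)).
apply: (@le_lt_trans _ _ ((`|C| + 1) * `|derive1 y t - derive1 y x|)).
  by rewrite ler_wpM2r // (le_trans (ler_norm C)) // lerDl.
by rewrite mulrC -ltr_pdivlMr.
Qed.

(** For t < 0 the integrals run over empty sets and the signature is 1, so it need not have a
    two-sided derivative at 0; g is a continuation that has one. *)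
Lemma tder_signature : exists g : R -> T, [/\ g 0 = 1,
  forall t, g t [bseq] = 1,
  forall t, 0 <= t -> tder g t (g t * tinj m (derive1 y t)) &
  forall t, 0 <= t -> signature m y 0 t = g t].
Proof.
exists (dev m y); split.
- exact: dev0.
- exact: dev_nil.
- move=> t t0; apply: tder_dev; first exact: smooth_coord_continuous.
  by apply: lt_le_trans t0; rewrite ltrN10.
- by move=> t t0; apply: signatureE => //; exact: smooth_coord_continuous.
Qed.

Lemma signature_glike t : 0 <= t -> glike (signature m y 0 t).
Proof.
have [g [g0 g1 gd gE]] := tder_signature => t0; rewrite gE //.
apply: (glike_right_ode (a := fun t => tinj m (derive1 y t)) t0) => //.
  by move=> u; exact: lielike_tinj.
by move=> u /andP[u0 _]; exact: gd.
Qed.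

Lemma signature0 : signature m y 0 0 = 1.
Proof. by have [g [g0 _ _ gE]] := tder_signature; rewrite gE. Qed.

Lemma signature_incr_bound (s b A : R) : 0 <= s -> s <= b -> 0 <= A ->
  (forall t i, s <= t <= b -> `|cd i (derive1 y t)| <= A) ->
  forall w : word, `|path_incr (signature m y 0) s b w| <= (A * (b - s)) ^+ size w.
Proof.
move=> s0 sb A0 yA w; have [g [g0 g1 gd gE]] := tder_signature.
have b0 := le_trans s0 sb.
rewrite /path_incr !gE //.
have gsu : g s \is a GRing.unit := tunit1 (g1 s).
apply: (tder_size_bound (v := derive1 y) (g := fun t => (g s)^-1 * g t) A0 _ _ yA) => //.
- move=> t; rewrite tmul_nil g1 mulr1.
  by have := congr1 (fun x : T => x [bseq]) (mulVr gsu); rewrite tmul_nil toneE eqxx g1 mulr1.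
- move=> t /andP[st _]; rewrite -mulrA; apply: tder_incr.
  by apply: gd; exact: le_trans st.
- by rewrite mulVr.
- by rewrite sb lexx.
Qed.

Lemma signature_incr_line (phi Phi : R -> R) (v : V) (s b : R) : 0 <= s -> s <= b ->
  (forall t, s <= t <= b -> is_derive t 1 Phi (phi t)) ->
  (forall t, s <= t <= b -> tinj m (derive1 y t) = phi t *: tinj m v) ->
  path_incr (signature m y 0) s b = texp ((Phi b - Phi s) *: tinj m v).
Proof.
move=> s0 sb Pd yp; have [g [g0 g1 gd gE]] := tder_signature.
have b0 := le_trans s0 sb.
rewrite /path_incr !gE //.
have gsu : g s \is a GRing.unit := tunit1 (g1 s).
apply: (tode_right_line (g := fun t => (g s)^-1 * g t) sb _ Pd); first by rewrite ffunE.
- move=> t tI; rewrite -mulrA; apply: tder_incr; rewrite -yp //.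
  by apply: gd; move/andP: tI => [st _]; exact: le_trans st.
- by rewrite mulVr.
Qed.

End SignatureIncrements.

(** * A smooth step function *)

Section SmoothStep.
Variable R : realType.
Implicit Types (x t : R) (f g : R -> R).

(** The functions x^-k exp(-1/x), extended by 0. With all k at once, derivatives are combinations of
    members of the family. *)
Definition flat (k : nat) x : R := if 0 < x then x^-1 ^+ k * expR (- x^-1) else 0.

Lemma flat_le0 k x : x <= 0 -> flat k x = 0.
Proof. by rewrite /flat leNgt => /negbTE ->. Qed.

Lemma flat_ge0 k x : 0 <= flat k x.
Proof.
rewrite /flat; case: ifP => // x0.
by rewrite mulr_ge0 ?expR_ge0 // exprn_ge0 // invr_ge0 ltW.
Qed.

Lemma flat_gt0 k x : 0 < x -> 0 < flat k x.
Proof. by move=> x0; rewrite /flat x0 mulr_gt0 ?expR_gt0 // exprn_gt0 // invr_gt0. Qed.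

(** From exp(y) >= y^(k+2) / (k+2)! at y = 1/x; a quadratic bound makes the derivative at 0
    vanish. *)
Lemma flat_sqr_bound k x : `|flat k x| <= k.+2`!%:R * x ^+ 2.
Proof.
rewrite ger0_norm ?flat_ge0 // /flat; case: ifPn => [x0|_]; last by rewrite mulr_ge0 ?sqr_ge0.
have y0 : 0 < x^-1 by rewrite invr_gt0.
have F0 : 0 < k.+2`!%:R :> R by rewrite ltr0n fact_gt0.
have E := expR_ge1Dxn k.+1 (ltW y0).
have E' : x^-1 ^+ k.+2 / k.+2`!%:R <= expR x^-1 by apply: le_trans E; rewrite lerDr.
rewrite expRN ler_pdivrMr ?expR_gt0 //.
apply: (@le_trans _ _ (k.+2`!%:R * x ^+ 2 * (x^-1 ^+ k.+2 / k.+2`!%:R))); last first.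
  by rewrite ler_wpM2l // mulr_ge0 ?sqr_ge0.
have -> : k.+2`!%:R * x ^+ 2 * (x^-1 ^+ k.+2 / k.+2`!%:R) = x^-1 ^+ k.
  rewrite !exprS; set Q := x^-1 ^+ k; set F := _%:R; field.
  by rewrite (gt_eqF x0) (gt_eqF F0).
exact: lexx.
Qed.

Lemma is_derive_flat k x : is_derive x 1 (flat k) (flat k.+2 x - k%:R * flat k.+1 x).
Proof.
have [x0|x0|->] := ltgtP x 0.
- rewrite !flat_le0 ?(ltW x0) // mulr0 subr0.
  apply: (near_eq_is_derive _ (is_derive_cst (0 : R^o) x 1)).
  have := lt_nbhsl x0.
  by apply: filterS => z z0; rewrite flat_le0 // ltW.
- have H : is_derive x 1 (fun u => u^-1 ^+ k * expR (- u^-1))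
      (flat k.+2 x - k%:R * flat k.+1 x).
    have xn : x != 0 by rewrite gt_eqF.
    have dV : is_derive x 1 (fun u : R => u^-1) (- x ^- 2).
      apply: (is_derive_eq (is_deriveV (f := id) xn (is_derive_id x 1))).
      by rewrite /GRing.scale /= mulr1.
    have dE := @is_derive1_comp _ expR (fun u => - u^-1) x _ _ (is_derive_expR (- x^-1)) (is_deriveN dV).
    have dP := is_deriveX k dV.
    have dP' : is_derive x 1 (fun u : R => u^-1 ^+ k) (k%:R * x^-1 ^+ k.-1 * (- x ^- 2)).
      rewrite (_ : (fun u : R => u^-1 ^+ k) = (fun u : R => u^-1) ^+ k) //.
      by apply/funext => u; rewrite exprfctE.
    apply: (is_derive_eq (is_derive_prod dP' dE)).
    rewrite /flat x0 /= opprK; set Z := expR _.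
    have -> : x ^- 2 = x^-1 ^+ 2 by rewrite exprVn.
    case: k {dP dP'} => [|k]; rewrite !exprS ?expr0 /=; ring.
  apply: near_eq_is_derive H.
  have := lt_nbhsr x0.
  by apply: filterS => z z0; rewrite /flat z0.
- rewrite !flat_le0 // mulr0 subr0; apply/is_derive1_caratheodory.
  (* The slope at 0 is 0 because division by 0 returns 0, and this is also its limit by
     [flat_sqr_bound]. *)
  exists (fun z => flat k z / z); split.
  + move=> z; rewrite (flat_le0 k (lexx 0)) !subr0.
    have [->|z0] := eqVneq z 0; first by rewrite flat_le0 // mulr0.
    by rewrite divfK.
  + apply/cvgrPdist_lt => eps e0.
    have F0 : 0 < k.+2`!%:R :> R by rewrite ltr0n fact_gt0.
    have : \forall z \near (0 : R), `|0 - z| < eps / k.+2`!%:R.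
      by apply: nbhsx_ballx; rewrite divr_gt0.
    apply: filterS => z; rewrite invr0 mulr0 !sub0r !normrN => ze.
    have [->|z0] := eqVneq z 0; first by rewrite invr0 mulr0 normr0.
    have zp : 0 < `|z| by rewrite normr_gt0.
    rewrite normrM normfV ltr_pdivrMr //.
    apply: (le_lt_trans (flat_sqr_bound k z)).
    rewrite -(real_normK (num_real z)) expr2 mulrA ltr_pM2r //.
    by rewrite mulrC -ltr_pdivlMr.
  + by rewrite invr0 mulr0.
Qed.

Definition weight x : R := flat 0 x + flat 0 (1 - x).

Lemma weight_gt0 x : 0 < weight x.
Proof.
rewrite /weight; have [x0|x0] := ltP 0 x.
  by rewrite ltr_pwDl ?flat_gt0 ?flat_ge0.
by rewrite ltr_wpDl ?flat_ge0 // flat_gt0 // subr_gt0 (le_lt_trans x0).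
Qed.

(* This class is closed under differentiation, hence consists of smooth functions. *)
Inductive elementary : (R -> R) -> Prop :=
| elementary_flat k : elementary (flat k)
| elementary_flatr k : elementary (fun x => flat k (1 - x))
| elementary_weight : elementary (fun x => (weight x)^-1)
| elementary_cst c : elementary (fun=> c)
| elementaryD f g : elementary f -> elementary g -> elementary (fun x => f x + g x)
| elementaryM f g : elementary f -> elementary g -> elementary (fun x => f x * g x).

Lemma is_derive_flatr k x : is_derive x 1 (fun x => flat k (1 - x))
  (-1 * (flat k.+2 (1 - x) + (- k%:R) * flat k.+1 (1 - x))).
Proof.
have d1 : is_derive x 1 (fun x => 1 - x) (-1).
  apply: (is_derive_eq (is_deriveB (is_derive_cst (1 : R^o) x 1) (is_derive_id x 1))).
  by rewrite sub0r.
apply: (is_derive_eq (@is_derive1_comp _ (flat k) (fun x => 1 - x) x _ _ (is_derive_flat k (1 - x)) d1)).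
by ring.
Qed.

Lemma elementary_derive f : elementary f ->
  exists2 g, elementary g & forall x, is_derive x 1 f (g x).
Proof.
have fl k : exists2 g, elementary g & forall x, is_derive x 1 (flat k) (g x).
  exists (fun x => flat k.+2 x + (- k%:R) * flat k.+1 x).
    by apply: elementaryD; [|apply: elementaryM; [exact: elementary_cst|]]; exact: elementary_flat.
  by move=> x; rewrite mulNr; exact: is_derive_flat.
have flr k : exists2 g, elementary g & forall x, is_derive x 1 (fun x => flat k (1 - x)) (g x).
  exists (fun x => -1 * (flat k.+2 (1 - x) + (- k%:R) * flat k.+1 (1 - x))).
    apply: elementaryM; first exact: elementary_cst.
    by apply: elementaryD; [|apply: elementaryM; [exact: elementary_cst|]]; exact: elementary_flatr.
  exact: is_derive_flatr.
elim=> {f} [k|k||c|f g _ [f' ef' df] _ [g' eg' dg]|f g ef [f' ef' df] eg [g' eg' dg]] //.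
- have [a ea da] := fl 0%N; have [b eb db] := flr 0%N.
  exists (fun x => -1 * ((weight x)^-1 * (weight x)^-1) * (a x + b x)).
    apply: elementaryM; last exact: elementaryD.
    apply: elementaryM; first exact: elementary_cst.
    by apply: elementaryM; exact: elementary_weight.
  move=> x; have wn : weight x != 0 by rewrite gt_eqF ?weight_gt0.
  apply: (is_derive_eq (is_deriveV wn (is_deriveD (da x) (db x)))).
  by rewrite /GRing.scale /= mulN1r expr2 invfM.
- exists (fun=> 0); first exact: elementary_cst.
  by move=> x; exact: (is_derive_cst (c : R^o)).
- exists (fun x => f' x + g' x); first exact: elementaryD.
  by move=> x; exact: is_deriveD (df x) (dg x).
- exists (fun x => f' x * g x + f x * g' x).
    by apply: elementaryD; exact: elementaryM.
  by move=> x; exact: is_derive_prod.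
Qed.

Definition smoothstep x : R := flat 0 x * (weight x)^-1.

Lemma elementary_smoothstep : elementary smoothstep.
Proof. by apply: elementaryM; [exact: elementary_flat|exact: elementary_weight]. Qed.

Lemma smoothstep_le0 x : x <= 0 -> smoothstep x = 0.
Proof. by move=> x0; rewrite /smoothstep flat_le0 ?mul0r. Qed.

Lemma smoothstep_ge1 x : 1 <= x -> smoothstep x = 1.
Proof.
move=> x1; have := weight_gt0 x; rewrite /smoothstep /weight.
by rewrite [flat 0 (1 - x)]flat_le0 ?subr_le0 // addr0 => w0; rewrite mulfV // gt_eqF.
Qed.

Lemma smoothstep_derive : exists (g : R -> R) (B : R), [/\ elementary g,
  forall x, is_derive x 1 smoothstep (g x),
  forall x, x <= 0 -> g x = 0,
  forall x, 1 <= x -> g x = 0 &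
  forall x, `|g x| <= B].
Proof.
(* The quotient rule for a / (a + b) with a = [flat 0 x] and b = [flat 0 (1 - x)]: the numerator is
   a' b - a b', where a' = [flat 2 x] and b' = - [flat 2 (1 - x)]. *)
pose g x := (weight x)^-1 * (weight x)^-1 *
  (flat 2 x * flat 0 (1 - x) + flat 0 x * flat 2 (1 - x)).
have eg : elementary g.
  apply: elementaryM; first by apply: elementaryM; exact: elementary_weight.
  by apply: elementaryD; apply: elementaryM;
    (exact: elementary_flat || exact: elementary_flatr).
have g0 x : x <= 0 -> g x = 0.
  by move=> x0; rewrite /g !(flat_le0 _ x0) !mul0r addr0 mulr0.
have g1 x : 1 <= x -> g x = 0.
  by move=> x1; rewrite /g ![flat _ (1 - x)]flat_le0 ?subr_le0 // !mulr0 addr0 mulr0.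
have gc : {within `[0, 1], continuous (fun x => `|g x|)}.
  apply: continuous_subspaceT => x; apply: continuous_comp; last exact: norm_continuous.
  have [g' _ /(_ x) [dg _]] := elementary_derive eg.
  by apply: differentiable_continuous; apply/derivable1_diffP.
have [c _ Hc] := EVT_max ler01 gc.
exists g, `|g c|; split=> // x; last first.
  have [x0|x0] := ltP x 0; first by rewrite (g0 _ (ltW x0)) normr0 normr_ge0.
  have [x1|x1] := ltP 1 x; first by rewrite (g1 _ (ltW x1)) normr0 normr_ge0.
  by apply: Hc; rewrite in_itv /= x0 x1.
have wn : weight x != 0 by rewrite gt_eqF ?weight_gt0.
have dw := is_deriveV wn (is_deriveD (is_derive_flat 0 x) (is_derive_flatr 0 x)).
apply: (is_derive_eq (is_derive_prod (is_derive_flat 0 x) dw)).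
move: wn; rewrite /g /weight /GRing.scale /=.
set a := flat 0 x; set b := flat 0 (1 - x) => wn; field.
exact: wn.
Qed.

End SmoothStep.

Section VectorDerivative.
Variables (R : realType) (W : normedModType R).

Lemma is_derive_scalel (f : R -> R) (t a : R) (v : W) : is_derive t 1 f a ->
  is_derive t 1 (fun u => f u *: v) (a *: v).
Proof.
case=> df <-.
have H : h^-1 *: (((fun u => f u *: v) \o shift t) (h *: 1) - f t *: v) @[h --> 0^']
    --> 'D_1 f t *: v.
  rewrite (_ : (fun h => _) =
      (fun h => (h^-1 *: ((f \o shift t) (h *: 1) - f t)) *: v)); last first.
    by apply/funext => h /=; rewrite -scalerBl scalerA.
  exact: cvgZr_tmp.
apply: DeriveDef; first by apply/cvg_ex; eexists; exact: H.
by apply: cvg_lim => //; exact: norm_hausdorff.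
Qed.

End VectorDerivative.

(** * Paths made of smoothly parametrized segments *)

Section StepPath.
Variables (R : realType) (V : normedVectType R).
Implicit Types (f g : R -> R) (tau t : R) (n : nat) (v : nat -> V).

(** For f = [smoothstep] the path covers the displacement v_j during the j-th interval of length
    tau. A general f is allowed because derivatives of stairs are stairs. *)
Definition stair f tau n v t : V := \sum_(j < n) f (tau^-1 * t - j%:R) *: v j.

Lemma is_derive_stair f g tau n v t : (forall x : R, is_derive x 1 f (g x)) ->
  is_derive t 1 (stair f tau n v) (stair g tau n (fun j => tau^-1 *: v j) t).
Proof.
move=> fg; apply: is_derive_bigsum => j _.
have dl : is_derive t 1 (fun u => tau^-1 * u - j%:R) tau^-1.
  apply: (is_derive_eq (is_deriveB (is_deriveZ tau^-1 (is_derive_id t 1))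
    (is_derive_cst (j%:R : R^o) t 1))).
  by rewrite subr0 /GRing.scale /= mulr1.
have := is_derive_scalel (v j) (@is_derive1_comp _ f (fun u => tau^-1 * u - j%:R) t _ _ (fg _) dl).
by rewrite scalerA.
Qed.

Lemma derive1_stair f g tau n v : (forall x : R, is_derive x 1 f (g x)) ->
  derive1 (stair f tau n v) = stair g tau n (fun j => tau^-1 *: v j).
Proof.
move=> fg; apply/funext => t; rewrite derive1E.
by have [_ ->] := is_derive_stair tau n v t fg.
Qed.

Lemma smooth_stair f tau n v : elementary f -> smooth (stair f tau n v).
Proof.
move=> ef k t.
suff [g [w [eg ->]]] : exists g (w : nat -> V), elementary g /\
    derive1n k (stair f tau n v) = stair g tau n w.
  have [g' _ dg] := elementary_derive eg.
  by have [] := is_derive_stair tau n w t dg.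
elim: k => [|k [g [w [eg E]]]]; first by exists f, v.
have [g' eg' dg] := elementary_derive eg.
exists g', (fun j => tau^-1 *: w j); split => //.
by rewrite derive1nS E; exact: derive1_stair.
Qed.

(** Meant for the derivative of [smoothstep]: as f vanishes outside ]0, 1[, only one summand is
    active. *)
Lemma stair_cell f tau n v j t : 0 < tau -> (j < n)%N ->
  (forall x, x <= 0 -> f x = 0) -> (forall x, 1 <= x -> f x = 0) ->
  j%:R * tau <= t <= j.+1%:R * tau ->
  stair f tau n v t = f (tau^-1 * t - j%:R) *: v j.
Proof.
move=> tau0 jn f0 f1 /andP[jt tj].
have jx : j%:R <= tau^-1 * t by rewrite mulrC ler_pdivlMr.
have xj : tau^-1 * t <= j.+1%:R by rewrite mulrC ler_pdivrMr.
rewrite /stair (bigD1 (Ordinal jn)) //= big1 ?addr0 // => i ij.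
have [ij'|ji|E] := ltngtP i j.
- rewrite f1 ?scale0r // lerBrDr; apply: le_trans jx.
  by rewrite nat1r ler_nat.
- rewrite f0 ?scale0r // subr_le0; apply: (le_trans xj).
  by rewrite ler_nat.
- by case/eqP: ij; apply: val_inj.
Qed.

End StepPath.

(** * Smooth interpolation of a group-valued path *)

Section Interpolation.
Variables (R : realType) (V : normedVectType R) (m : nat).
Local Notation d := (\dim {:V}).
Local Notation T := (ttensor R d m).
Local Notation word := (m.-bseq 'I_d).
Local Notation cd i v := (coord (vbasis {:V}) i v).

Lemma step_path : exists B : R, 0 <= B /\ forall (tau : R) n (v : nat -> V), 0 < tau ->
  exists y : R -> V, [/\ smooth y,
    forall j t i, (j < n)%N -> j%:R * tau <= t <= j.+1%:R * tau ->
      `|cd i (derive1 y t)| <= B * tau^-1 * `|cd i (v j)| &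
    forall j, (j < n)%N -> path_incr (signature m y 0) (j%:R * tau) (j.+1%:R * tau) =
      texp (tinj m (v j))].
Proof.
have [g [B [eg dg g0 g1 gB]]] := smoothstep_derive R.
exists B; split=> [|tau n v tau0]; first exact: le_trans (gB 0).
exists (stair (@smoothstep R) tau n v); split.
- by apply: smooth_stair; exact: elementary_smoothstep.
- move=> j t i jn tj; rewrite (derive1_stair _ _ _ dg) (stair_cell _ tau0 jn) //.
  rewrite !linearZ /= !normrM [`|tau^-1|]gtr0_norm ?invr_gt0 // mulrA.
  rewrite ler_wpM2r // ler_wpM2r ?gB // invr_ge0; exact: ltW.
- move=> j jn.
  have jj : j%:R * tau <= j.+1%:R * tau by rewrite ler_pM2r // ler_nat.
  have dl (t : R) : is_derive t 1 (fun u => smoothstep (tau^-1 * u - j%:R))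
      (g (tau^-1 * t - j%:R) * tau^-1).
    have dl : is_derive t 1 (fun u => tau^-1 * u - j%:R) tau^-1.
      apply: (is_derive_eq (is_deriveB (is_deriveZ tau^-1 (is_derive_id t 1))
        (is_derive_cst (j%:R : R^o) t 1))).
      by rewrite subr0 /GRing.scale /= mulr1.
    exact: (@is_derive1_comp _ (@smoothstep R) (fun u => tau^-1 * u - j%:R) t _ _ (dg _) dl).
  rewrite (@signature_incr_line _ _ _ _ _ (fun t => g (tau^-1 * t - j%:R) * tau^-1)
    (fun u => smoothstep (tau^-1 * u - j%:R)) (v j)) //.
  + rewrite smoothstep_ge1; last by rewrite mulrCA mulVf ?gt_eqF // mulr1 -nat1r addrK.
    rewrite smoothstep_le0; last by rewrite mulrCA mulVf ?gt_eqF // mulr1 subrr.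
    by rewrite subr0 scale1r.
  + by apply: smooth_stair; exact: elementary_smoothstep.
  + by rewrite mulr_ge0 // ltW.
  + move=> t tj; rewrite (derive1_stair _ _ _ dg) (stair_cell _ tau0 jn) //.
    by rewrite scalerA tinjZ.
Qed.

Lemma path_incrM (X : R -> T) s t u : X t \is a GRing.unit ->
  path_incr X s t * path_incr X t u = path_incr X s u.
Proof. by move=> Xt; rewrite /path_incr mulrA mulrK. Qed.

Lemma find_cell (x a : R) (K : nat) : (0 < K)%N -> a <= x <= a + K%:R ->
  exists2 r, (r < K)%N & a + r%:R <= x <= a + r.+1%:R.
Proof.
elim: K => // -[|K] IH _ /andP[ax xa]; first by exists 0%N => //; rewrite addr0 ax.
have [xK|Kx] := leP x (a + K.+1%:R); last first.
  by exists K.+1 => //; rewrite xa ltW.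
have [|r rK H] := IH isT; first by rewrite ax.
by exists r => //; apply: ltn_trans rK _.
Qed.

Variable N : T -> R.
Hypothesis HN : @homogeneous_norm R V m N.

(** C depends on neither n nor Y. With g the increment of Y over a cell, [hnorm_lower] and [chow]
    give segments of length at most Cc Cl N(g); the K slots of the cell are crossed at speed at most
    B n K times this, and [hnorm_upper] turns the speed into a bound on N. *)
Lemma interpolation : exists C : R, 0 < C /\ forall (n : nat) (Y : R -> T), (0 < n)%N ->
  Y 0 = 1 -> (forall k, (k <= n)%N -> glike (Y (k%:R / n%:R))) ->
  exists y : R -> V, [/\ smooth y,
    forall k, (k <= n)%N -> signature m y 0 (k%:R / n%:R) = Y (k%:R / n%:R) &
    forall q s t, (q < n)%N -> q%:R / n%:R <= s -> s <= t -> t <= q.+1%:R / n%:R ->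
      N (path_incr (signature m y 0) s t) <=
        C * (n%:R * (t - s)) * N (path_incr Y (q%:R / n%:R) (q.+1%:R / n%:R))].
Proof.
have [B [B0 step]] := step_path.
have [K0 [Cc [Cc0 Hchow]]] := chow V m.
have [Cl Cl0 Hlow] := hnorm_lower HN.
have [Cu Cu0 Hup] := hnorm_upper HN.
(* Every cell is cut into K slots, one per segment; the successor makes K positive. *)
pose K := K0.+1.
exists (Cu * (B * K%:R * (Cc * Cl)) + 1); split.
  by rewrite ltr_wpDl // !mulr_ge0 // ltW.
move=> n Y n0 Y0 YG.
have n0' : 0 < n%:R :> R by rewrite ltr0n.
pose g q := path_incr Y (q%:R / n%:R) (q.+1%:R / n%:R).
have gg q : (q < n)%N -> glike (g q).
  by move=> qn; apply: glikeM; [apply: glikeV|]; apply: YG => //; exact: ltnW.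
have exl q : exists l : seq (R * 'I_d), (q < n)%N ->
    [/\ (size l <= K0)%N, lbound (Cc * (Cl * N (g q))) l & g q = lprod m l].
  have [qn|_] := boolP (q < n)%N; last by exists [::].
  have [|l Hl] := Hchow (Cl * N (g q)) (g q) _ (gg q qn) (Hlow _ (gg q qn)).
    by rewrite mulr_ge0 ?(ltW Cl0) // hnorm_ge0 //; exact: gg.
  by exists l.
have [l Hl] := choice exl.
pose vs q : seq V := [seq x.1 *: (vbasis {:V})`_x.2 | x : R * 'I_d <- l q].
(* Slot j belongs to cell j / K. The default 0 lets the path rest in the slots left over by a short
   factorization. *)
pose v j := nth 0 (vs (j %/ K)%N) (j %% K)%N.
have [tau tauV] : exists tau : R, tau = (n * K)%:R^-1 by eexists.
have tau0 : 0 < tau by rewrite tauV invr_gt0 ltr0n muln_gt0 n0.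
have [y [ys yb yl]] := step tau (n * K)%N v tau0.
pose X := signature m y 0.
have Xg t : 0 <= t -> glike (X t) by exact: signature_glike.
have XU t : 0 <= t -> X t \is a GRing.unit by move=> t0; exact/glike_unit/Xg.
have vE q r : (r < K)%N -> v (q * K + r)%N = nth 0 (vs q) r.
  by move=> rK; rewrite /v divnMDl // divn_small // addn0 modnMDl modn_small.
have jn q r : (q < n)%N -> (r < K)%N -> (q * K + r < n * K)%N.
  move=> qn rK; apply: (@leq_trans (q * K + K)); first by rewrite ltn_add2l.
  by rewrite -mulSnr leq_mul2r qn orbT.
have tauE q r : (q * K + r)%:R * tau = q%:R / n%:R + r%:R * tau.
  have Kn : K%:R != 0 :> R by rewrite pnatr_eq0.
  have nn : n%:R != 0 :> R by rewrite gt_eqF.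
  by rewrite natrD mulrDl; congr (_ + _); rewrite tauV !natrM; field; rewrite Kn nn.
have cell0 q : (q%:R / n%:R : R) >= 0 by rewrite divr_ge0.
have tauK q : q%:R / n%:R + K%:R * tau = q.+1%:R / n%:R.
  by rewrite -tauE addnC -mulSn -[(q.+1 * K)%N]addn0 tauE mul0r addr0.
have pieces q r : (q < n)%N -> (r <= K)%N ->
    path_incr X (q%:R / n%:R) (q%:R / n%:R + r%:R * tau) = lprod m (take r (l q)).
  move=> qn; elim: r => [_|r IH rK].
    by rewrite mul0r addr0 take0 /path_incr mulVr ?XU ?cell0 // /lprod big_nil.
  have tr k : 0 <= q%:R / n%:R + k%:R * tau by rewrite addr_ge0 ?cell0 // mulr_ge0 // ltW.
  have Xr k : X (q%:R / n%:R + k%:R * tau) \is a GRing.unit by apply/glike_unit/Xg/tr.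
  have -> : path_incr X (q%:R / n%:R) (q%:R / n%:R + r.+1%:R * tau) =
      path_incr X (q%:R / n%:R) (q%:R / n%:R + r%:R * tau) *
      path_incr X (q%:R / n%:R + r%:R * tau) (q%:R / n%:R + r.+1%:R * tau).
    by rewrite path_incrM.
  rewrite IH ?(ltnW rK) // -!tauE addnS yl ?jn // vE //.
  have [rs|sr] := ltnP r (size (l q)).
    have x0 : R * 'I_d by case: (l q) rs => // x _ _; exact: x.
    rewrite (take_nth x0) // -cats1 lprod_cat; congr (_ * _).
    rewrite /vs (nth_map x0) // lprod_cons /lprod big_nil mulr1.
    by rewrite tinjZ tinj_vbasis.
  rewrite !take_oversize ?(leq_trans sr) // nth_default ?size_map //.
  by rewrite -(scale0r (0 : V)) tinjZ scale0r texp0 mulr1.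
have Xcell q : (q < n)%N -> path_incr X (q%:R / n%:R) (q.+1%:R / n%:R) = g q.
  move=> qn; have [lK _ ->] := Hl q qn.
  by rewrite -tauK pieces // take_oversize // leqW.
exists y; split=> //.
- elim=> [_|k IH kn]; first by rewrite mul0r signature0.
  have Xu : X (k%:R / n%:R) \is a GRing.unit by apply/glike_unit/Xg.
  rewrite -/X -[LHS](mulVKr Xu) -/(path_incr X _ _) Xcell // /g /path_incr.
  by rewrite -/X in IH; rewrite IH ?(ltnW kn) // mulVKr // -IH ?(ltnW kn).
move=> q s t qn qs st tq.
have [lK lC _] := Hl q qn.
set D := Cc * (Cl * N (g q)) in lC.
have Ng0 : 0 <= N (g q) by apply: hnorm_ge0 => //; exact: gg.
have D0 : 0 <= D by rewrite !mulr_ge0 // ltW.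
have s0 := le_trans (cell0 q) qs.
pose A := B * tau^-1 * D.
have ti0 : 0 <= tau^-1 by rewrite invr_ge0 ltW.
have A0 : 0 <= A := mulr_ge0 (mulr_ge0 B0 ti0) D0.
have vD r i : (r < K)%N -> `|cd i (v (q * K + r)%N)| <= D.
  move=> rK; rewrite vE //; have [rs|sr] := ltnP r (size (l q)); last first.
    by rewrite nth_default ?size_map // linear0 normr0.
  have x0 : R * 'I_d by case: (l q) rs => // x _ _; exact: x.
  rewrite /vs (nth_map x0) // linearZ /= normrM.
  have xC := allP lC _ (mem_nth x0 rs).
  rewrite coord_free ?(basis_free (vbasisP _)) //.
  by case: eqP => _; rewrite ?normr1 ?normr0 ?mulr1 ?mulr0.
have yA u i : s <= u <= t -> `|cd i (derive1 y u)| <= A.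
  move=> /andP[su ut].
  have [||r rK] := @find_cell (tau^-1 * u) (q * K)%:R K.
  - by [].
  - have qKE : (q * K)%:R * tau = q%:R / n%:R by rewrite -[(q * K)%N]addn0 tauE mul0r addr0.
    rewrite -natrD [tau^-1 * u]mulrC ler_pdivlMr // ler_pdivrMr // qKE (le_trans qs su) /=.
    by rewrite tauE tauK (le_trans ut tq).
  rewrite -!natrD [tau^-1 * u]mulrC ler_pdivlMr // ler_pdivrMr // addnS => ur.
  apply: (le_trans (yb _ _ i (jn q r qn rK) ur)).
  by rewrite ler_wpM2l ?vD // mulr_ge0.
have Hb := @signature_incr_bound _ _ m y ys s t A s0 st A0 yA.
have Xst : glike (path_incr X s t).
  by apply: glikeM; [apply: glikeV|]; apply: Xg => //; exact: le_trans st.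
have ts0 : 0 <= t - s by rewrite subr_ge0.
apply: (le_trans (Hup (A * (t - s)) _ _ Xst Hb)); first exact: mulr_ge0.
have -> : Cu * (A * (t - s)) =
    Cu * (B * K%:R * (Cc * Cl)) * (n%:R * (t - s)) * N (g q).
  by rewrite /A /D tauV invrK natrM; ring.
rewrite ler_wpM2r // ler_wpM2r ?mulr_ge0 // ?ler0n //.
by rewrite lerDl.
Qed.

End Interpolation.

(** * The limit near the diagonal in terms of eps and delta *)

Section Vanishing.
Variable R : realType.

Lemma vanishes_near_diagP (F : R -> R -> R) :
  (forall s t, 0 <= s -> s < t -> t <= 1 -> 0 <= F s t) ->
  vanishes_near_diag F <-> forall eps : R, 0 < eps -> exists2 delta : R, 0 < delta &
    forall s t, 0 <= s -> s < t -> t <= 1 -> t - s <= delta -> F s t <= eps.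
Proof.
move=> F0; rewrite /vanishes_near_diag; split=> [H eps e0|H A].
  have ne : nbhs (0%E : \bar R) [set x : \bar R | (x < eps%:E)%E].
    rewrite /nbhs /= /ereal_nbhs /=; have := lt_nbhsl e0.
    by apply: filterS => z z0 /=; rewrite lte_fin.
  have [delta [/= d0 Hd]] := filter_ex (filterI (nbhs_right_gt (0 : R)) (H _ ne)).
  exists delta => // s t s0 st t1 tsd; rewrite -lee_fin; apply/ltW.
  apply: le_lt_trans Hd; apply: ereal_sup_ubound.
  by exists (s, t).
rewrite /nbhs /= /ereal_nbhs /= => /nbhs_ballP[e /= e0 eA].
have [delta d0 Hd] := H (e / 2) (divr_gt0 e0 (ltr0Sn _ 1)).
have := nbhs_right_lt d0; have := nbhs_right_gt (0 : R).
apply: filterS2 => x x0 xd /=.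
set S := (X in ereal_sup X).
have Sub : (ereal_sup S <= (e / 2)%:E)%E.
  apply: ge_ereal_sup => _ [[s t] /= [s0 st t1 tsx] <-].
  by rewrite lee_fin; apply: Hd => //; apply: le_trans tsx (ltW xd).
(* The supremum of an empty set would be -oo; here the pair (0, min x 1) is admissible. *)
have Slb : (0%:E <= ereal_sup S)%E.
  pose t := Num.min x 1.
  have t0 : 0 < t by rewrite lt_min x0 ltr01.
  have t1 : t <= 1 by rewrite ge_min lexx orbT.
  apply: (@le_trans _ _ (F 0 t)%:E); first by rewrite lee_fin F0.
  apply: ereal_sup_ubound; exists (0, t) => //=; split=> //.
  by rewrite subr0 ge_min lexx.
move: Sub Slb; case: (ereal_sup S) => [r| |] //=; rewrite !lee_fin => re r0.
apply: eA; rewrite /ball /= sub0r normrN ger0_norm //.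
by apply: (le_lt_trans re); rewrite ltr_pdivrMr // ltr_pMr // ltr1n.
Qed.

End Vanishing.

(** * The function omega^(1/p) under condition (H_p) *)

Section ControlRoot.
Variables (R : realType) (omega : R -> R -> R) (p : R).
Hypotheses (p1 : 1 <= p) (Hc : control omega) (HH : condition_H p omega).
Local Notation W s t := (omega s t `^ p^-1).

Let p0 : 0 < p. Proof. exact: lt_le_trans p1. Qed.

Lemma croot_gt0 s t : 0 <= s -> s < t -> t <= 1 -> 0 < W s t.
Proof. by move=> s0 st t1; apply/powR_gt0/(condition_H_gt0 Hc HH). Qed.

Lemma control_mono r s t u : 0 <= r -> r <= s -> s < t -> t <= u -> u <= 1 ->
  omega s t <= omega r u.
Proof.
move=> r0 rs st tu u1; have [_ ge0 _ super] := Hc.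
have s0 := le_trans r0 rs.
apply: (@le_trans _ _ (omega s u)).
  move: tu; rewrite le_eqVlt => /predU1P[-> //|tu].
  apply: le_trans (super _ _ _ s0 st tu u1); rewrite lerDl.
  by apply: ge0 => //; [exact: le_trans s0 (ltW st)|exact: ltW].
move: rs; rewrite le_eqVlt => /predU1P[-> //|rs].
have su := lt_le_trans st tu.
apply: le_trans (super _ _ _ r0 rs su u1); rewrite lerDr.
by apply: ge0 => //; [exact: ltW|exact: le_trans (ltW su) u1].
Qed.

Lemma croot_mono r s t u : 0 <= r -> r <= s -> s < t -> t <= u -> u <= 1 ->
  W s t <= W r u.
Proof.
move=> r0 rs st tu u1; have s0 := le_trans r0 rs; have t1 := le_trans tu u1.
have ru : r < u by apply: le_lt_trans rs _; exact: lt_le_trans tu.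
apply: ge0_ler_powR; rewrite ?invr_ge0 ?nnegrE ?(ltW p0) //.
- by apply/ltW/(condition_H_gt0 Hc HH).
- by apply/ltW/(condition_H_gt0 Hc HH).
- exact: control_mono.
Qed.

(* (H_p) only concerns strictly nested intervals; shrinking the inner interval
   by half extends it to all nested ones. *)
Lemma croot_doubling : exists2 C : R, 0 < C & forall r s t u, 0 <= r -> r <= s ->
  s < t -> t <= u -> u <= 1 -> W r u * (t - s) <= C * (W s t * (u - r)).
Proof.
have [_ [C HC]] := HH.
(* The factor 2 is (t - s) / (t' - s'); the absolute value and the summand 1 make the constant
   positive. *)
exists (2 * (`|C| `^ p^-1 + 1)).
  by rewrite mulr_gt0 // ltr_wpDl // powR_ge0.
move=> r s t u r0 rs st tu u1.
pose s' := s + (t - s) / 4; pose t' := t - (t - s) / 4.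
have ss' : s < s' by rewrite /s'; lra.
have st' : s' < t' by rewrite /s' /t'; lra.
have tt' : t' < t by rewrite /t'; lra.
have H := HC r s' t' u r0 (le_lt_trans rs ss') st' (lt_le_trans tt' tu) u1.
have s0 := le_trans r0 rs; have t1 := le_trans tu u1.
have wst : 0 < omega s t by apply: (condition_H_gt0 Hc HH).
have ur : 0 < u - r by lra.
have ts : 0 < t - s by lra.
pose rho := (u - r) / (t' - s').
have ts' : 0 < t' - s' by lra.
have rho0 : 0 < rho by rewrite divr_gt0.
have rhoE : rho = 2 * ((u - r) / (t - s)).
  by rewrite /rho /s' /t'; field; rewrite gt_eqF //= gt_eqF //; lra.
have up : 0 < (u - r) `^ p by rewrite powR_gt0.
have tp : 0 < (t' - s') `^ p by rewrite powR_gt0.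
have urE : (u - r) `^ p = rho `^ p * (t' - s') `^ p.
  by rewrite -powRM ?(ltW rho0) ?(ltW ts') // /rho divfK // gt_eqF.
have K : omega r u <= `|C| * omega s t * rho `^ p.
  move: H; rewrite ler_pdivrMr // urE => /le_trans; apply.
  have -> : C * (omega s' t' / (t' - s') `^ p) * (rho `^ p * (t' - s') `^ p) =
      C * omega s' t' * rho `^ p by field; rewrite gt_eqF.
  rewrite ler_wpM2r ?powR_ge0 //.
  have w' : 0 <= omega s' t'.
    have [_ ge0 _ _] := Hc; apply: ge0; last by lra.
      by apply: le_trans s0 (ltW ss').
    exact: ltW.
  apply: (@le_trans _ _ (`|C| * omega s' t')); first by rewrite ler_wpM2r ?ler_norm.
  by rewrite ler_wpM2l // control_mono // ltW.
have ipn : 0 <= p^-1 by rewrite invr_ge0 ltW.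
have nn1 : 0 <= `|C| * omega s t * rho `^ p by rewrite !mulr_ge0 ?powR_ge0 // ltW.
have K' : W r u <= `|C| `^ p^-1 * W s t * rho.
  have ru : r < u by lra.
  have := ge0_ler_powR ipn _ _ K; rewrite !nnegrE => /(_ _ nn1).
  rewrite (ltW (condition_H_gt0 Hc HH r0 ru u1)) => /(_ isT) /le_trans; apply.
  rewrite (powRM _ (mulr_ge0 (normr_ge0 C) (ltW wst)) (powR_ge0 rho p)).
  rewrite (powRM _ (normr_ge0 C) (ltW wst)).
  by rewrite -powRrM mulfV ?gt_eqF // powRr1 // ltW.
apply: (@le_trans _ _ (`|C| `^ p^-1 * W s t * rho * (t - s))).
  by rewrite ler_wpM2r // ltW.
have -> : `|C| `^ p^-1 * W s t * rho * (t - s) =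
    2 * `|C| `^ p^-1 * (W s t * (u - r)).
  by rewrite rhoE; field; rewrite gt_eqF.
rewrite ler_wpM2r ?mulr_ge0 ?powR_ge0 ?(ltW ur) //.
by rewrite ler_wpM2l // lerDl.
Qed.

(** [croot_doubling] with outer interval [0, 1]; it keeps W away from 0 far from the diagonal. *)
Lemma croot_lower : exists2 c : R, 0 < c & forall s t, 0 <= s -> s < t -> t <= 1 ->
  c * (t - s) <= W s t.
Proof.
have [C C0 HC] := croot_doubling.
have W01 : 0 < W 0 1 by exact: croot_gt0.
exists (W 0 1 / C) => [|s t s0 st t1]; first exact: divr_gt0.
have := HC 0 s t 1 (lexx _) s0 st t1 (lexx _).
by rewrite subr0 mulr1 mulrAC ler_pdivrMr // [W s t * C]mulrC.
Qed.

End ControlRoot.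

(** * Approximation in the omega distance by signatures *)

Section Approximation.
Variables (R : realType) (V : normedVectType R) (m : nat).
Local Notation d := (\dim {:V}).
Local Notation T := (ttensor R d m).
Local Notation word := (m.-bseq 'I_d).
Variable N : T -> R.
Hypothesis HN : @homogeneous_norm R V m N.
Variables (omega : R -> R -> R) (p : R).
Hypotheses (p1 : 1 <= p) (Hc : control omega) (HH : condition_H p omega).
Local Notation W s t := (omega s t `^ p^-1).

Lemma hnorm_small (eta : R) : 0 < eta -> exists2 eps : R, 0 < eps &
  forall g, glike g -> N g <= eps -> tnorm (g - 1) <= eta.
Proof.
move=> eta0; have [C C0 H] := hnorm_lower HN.
pose n : R := #|{: word}|%:R.
have n1 : 0 < n + 1 by rewrite ltr_wpDl.
pose lam := Num.min 1 (eta / (n + 1)).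
have lam0 : 0 < lam by rewrite lt_min ltr01 divr_gt0.
have lam1 : lam <= 1 by rewrite ge_min lexx.
exists (lam / C) => [|g gg gN]; first exact: divr_gt0.
have CN : C * N g <= lam by rewrite mulrC -ler_pdivlMr.
have CN0 : 0 <= C * N g by rewrite mulr_ge0 ?(ltW C0) // (hnorm_ge0 HN).
apply: (@le_trans _ _ (n * lam)); last first.
  apply: (@le_trans _ _ ((n + 1) * lam)); first by rewrite ler_wpM2r ?lerDl // ltW.
  by rewrite mulrC -ler_pdivlMr // ge_min lexx orbT.
rewrite mulr_natl; apply: tnorm_le => w.
have [w0|w0] := eqVneq (bseqval w) [::].
  have -> : w = [bseq] by apply: val_inj.
  by rewrite tsubE toneE eqxx; have [-> _ _] := gg; rewrite subrr normr0 ltW.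
rewrite tsubE toneE (negbTE w0) subr0; apply: (le_trans (H g gg w)).
apply: (@le_trans _ _ (lam ^+ size w)); first by rewrite lerXn2r // nnegrE // ltW.
have s1 : (1 <= size w)%N by rewrite lt0n size_eq0.
by rewrite -[leRHS]expr1 ler_wiXn2l // ltW.
Qed.

Lemma hnorm_bounded (M : R) : exists B : R, forall g, glike g -> N g <= M -> tnorm g <= B.
Proof.
have [C C0 H] := hnorm_lower HN.
pose D := Num.max 1 (C * M).
exists (D ^+ m *+ #|{: word}|) => g gg gM; apply: tnorm_le => w.
apply: (le_trans (H g gg w)).
have g0 : 0 <= C * N g by rewrite mulr_ge0 ?(ltW C0) // (hnorm_ge0 HN).
have D1 : 1 <= D by rewrite le_max lexx.
apply: (@le_trans _ _ (D ^+ size w)); last by rewrite ler_weXn2l // size_bseq.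
apply: lerXn2r; rewrite ?nnegrE //; first exact: le_trans ler01 D1.
by rewrite le_max ler_wpM2l ?orbT // ltW.
Qed.

(** The detour through coordinates turns [hnorm_conj] into a statement about N alone; eta depends on
    the bound M of the conjugating element. *)
Lemma hnorm_conj_small (M eps : R) : 0 < eps -> exists2 eta : R, 0 < eta &
  forall g a, glike g -> glike a -> N g <= M -> N a <= eta -> N (g^-1 * a * g) <= eps.
Proof.
move=> e0; have [B HB] := hnorm_bounded M.
have [eta1 e1 H1] := hnorm_conj HN B e0.
have [eta e2 H2] := hnorm_small e1.
exists eta => // g a gg aa gM aeta; apply: H1 => //.
- exact: HB.
- by apply: HB; [exact: glikeV|rewrite (hnormV HN)].
- exact: H2.
Qed.

Lemma smooth_speed_bounded (y : R -> V) : smooth y -> exists2 A : R, 0 <= A &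
  forall t i, 0 <= t <= 1 -> `|coord (vbasis {:V}) i (derive1 y t)| <= A.
Proof.
move=> ys; have [C HC] := coord_bounded V.
have gc : {within `[0, 1], continuous (fun t : R => `|derive1 y t|)}.
  apply: continuous_subspaceT => t; apply: continuous_comp; last exact: norm_continuous.
  have dy : derivable (derive1 y) t 1 := @ys 1%N t.
  by apply: differentiable_continuous; apply/derivable1_diffP.
have [c _ Hm] := EVT_max ler01 gc.
exists (`|C| * `|derive1 y c|) => [|t i tI]; first exact: mulr_ge0.
apply: (le_trans (HC _ i)); apply: (@le_trans _ _ (`|C| * `|derive1 y t|)).
  by rewrite ler_wpM2r // ler_norm.
by rewrite ler_wpM2l // Hm // in_itv.
Qed.

Lemma signature_hnorm_bound (y : R -> V) : smooth y -> exists2 A : R, 0 <= A &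
  forall s t, 0 <= s -> s <= t -> t <= 1 ->
    N (path_incr (signature m y 0) s t) <= A * (t - s).
Proof.
move=> ys; have [A A0 HA] := smooth_speed_bounded ys.
have [C C0 HC] := hnorm_upper HN.
exists (C * A) => [|s t s0 st t1]; first by rewrite mulr_ge0 // ltW.
have ts : 0 <= t - s by rewrite subr_ge0.
rewrite -mulrA; apply: HC; first exact: mulr_ge0.
  by apply: glikeM; [apply: glikeV|]; apply: signature_glike => //; exact: le_trans st.
apply: signature_incr_bound => // u i /andP[su ut].
by apply: HA; rewrite (le_trans s0 su) (le_trans ut t1).
Qed.

Variable Y : R -> T.
Hypotheses (Y0 : Y 0 = 1) (YG : forall t, 0 <= t <= 1 -> glike (Y t)).

Let YI s t : 0 <= s -> s <= t -> t <= 1 -> glike (path_incr Y s t).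
Proof.
move=> s0 st t1; apply: glikeM; [apply: glikeV|]; apply: YG.
  by rewrite s0 (le_trans st).
by rewrite t1 (le_trans s0).
Qed.

Lemma approximation (M : R) :
  (forall s t, 0 <= s -> s < t -> t <= 1 -> N (path_incr Y s t) <= M * W s t) ->
  (forall eps : R, 0 < eps -> exists2 delta : R, 0 < delta &
    forall s t, 0 <= s -> s < t -> t <= 1 -> t - s <= delta ->
      N (path_incr Y s t) <= eps * W s t) ->
  forall eps : R, 0 < eps -> exists2 y : R -> V, smooth y &
    forall s t, 0 <= s -> s < t -> t <= 1 ->
      N ((path_incr Y s t)^-1 * path_incr (signature m y 0) s t) <= eps * W s t.
Proof.
move=> YM Yvan eps e0.
have [Ci [Ci0 interp]] := interpolation HN.
have [Cd Cd0 dbl] := croot_doubling p1 Hc HH.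
have [c c0 low] := croot_lower p1 Hc HH.
pose Q := Ci * Cd.
have Q0 : 0 < Q by exact: mulr_gt0.
(* Nearby points: both increments are small. *)
pose eta1 := eps / (2 * Q + 2).
have e1 : 0 < eta1 by rewrite divr_gt0 // addr_gt0 // mulr_gt0.
have [d1 d10 near1] := Yvan eta1 e1.
(* Distant points: conjugate a small element by a bounded one. *)
pose M1 := `|M| * W 0 1.
(* When t - s > d1, [croot_lower] shows that this absolute error is at most [eps / 2 * W s t]. *)
have ec : 0 < eps / 2 * (c * d1) by rewrite mulr_gt0 ?divr_gt0 ?mulr_gt0.
have [eta2 e2 conj] := hnorm_conj_small M1 ec.
have W01 : 0 < W 0 1 by exact: (croot_gt0 Hc HH).
(* The first entry makes N A at most eta2, the second makes the two end pieces together at most half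
   of the allowed error. *)
pose eta3 := Num.min (eta2 / ((1 + Q) * W 0 1)) (eps / 2 / (1 + Q)).
have Q1 : 0 < 1 + Q by rewrite addr_gt0.
have e3 : 0 < eta3 by rewrite lt_min !divr_gt0 ?mulr_gt0.
have [d3 d30 near3] := Yvan eta3 e3.
have [n nP] : exists n : nat, n.+1%:R^-1 < Num.min (Num.min d1 d3) (d1 / 2).
  have dm : 0 < Num.min (Num.min d1 d3) (d1 / 2) by rewrite !lt_min d10 d30 divr_gt0.
  have [k _ kP] := near_infty_natSinv_lt (PosNum dm).
  by exists k; apply: kP => /=.
move: nP; rewrite !lt_min => /andP[/andP[nd1 nd3] nd2].
pose h : R := n.+1%:R^-1.
have h0 : 0 < h by rewrite invr_gt0.
have gridI k : (k <= n.+1)%N -> 0 <= k%:R * h <= 1.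
  by move=> kn; rewrite mulr_ge0 ?(ltW h0) //= ler_pdivrMr // mul1r ler_nat.
have [|y [ys yg yc]] := interp n.+1 Y (ltn0Sn n) Y0.
  by move=> k kn; apply: YG; exact: gridI.
exists y => //; set X := signature m y 0 in yg yc *.
have XG t : 0 <= t -> glike (X t) by exact: signature_glike.
have XU t : 0 <= t -> X t \is a GRing.unit by move=> t0; exact/glike_unit/XG.
have XI s t : 0 <= s -> s <= t -> glike (path_incr X s t).
  by move=> s0 st; apply: glikeM; [apply: glikeV|]; apply: XG => //; exact: le_trans st.
have Ynear eta delta s t u v : (forall s t, 0 <= s -> s < t -> t <= 1 ->
    t - s <= delta -> N (path_incr Y s t) <= eta * W s t) -> 0 <= eta ->
    0 <= u -> u <= s -> s <= t -> t <= v -> v <= 1 -> t - s <= delta ->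
    N (path_incr Y s t) <= eta * W u v.
  move=> van eta0 u0 us; rewrite le_eqVlt => /predU1P[<- sv v1 _|st tv v1 tsd].
    have s0 := le_trans u0 us.
    rewrite /path_incr mulVr ?(hnorm1 HN) ?mulr_ge0 ?powR_ge0 //.
    by apply/glike_unit/YG; rewrite s0 (le_trans sv).
  apply: (le_trans (van s t (le_trans u0 us) st (le_trans tv v1) tsd)).
  by rewrite ler_wpM2l // (croot_mono p1 Hc HH).
(* Interpolation bounds the increment by Ci (t - s) / h times eta times W of the whole cell;
   [croot_doubling] exchanges (t - s) / h times W of the cell for Cd W s t. *)
have cell eta delta q s t u v : (forall s t, 0 <= s -> s < t -> t <= 1 ->
    t - s <= delta -> N (path_incr Y s t) <= eta * W s t) -> h < delta -> 0 <= eta ->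
    (q <= n)%N -> q%:R * h <= s -> s <= t -> t <= q.+1%:R * h ->
    0 <= u -> u <= s -> t <= v -> v <= 1 ->
    N (path_incr X s t) <= Q * eta * W u v.
  move=> van hd eta0 qn qs; rewrite le_eqVlt => /predU1P[<- _ u0 us _ _|st tq u0 us tv v1].
    rewrite /path_incr mulVr ?XU ?(le_trans u0 us) // (hnorm1 HN).
    by rewrite !mulr_ge0 ?powR_ge0 // ltW.
  have [qh0 _] := andP (gridI q (leqW qn)).
  have [_ qh1] := andP (gridI q.+1 qn).
  have qq : q%:R * h < q.+1%:R * h by rewrite ltr_pM2r // ltr_nat.
  have qqh : q.+1%:R * h - q%:R * h = h by rewrite -mulrBl -nat1r addrK mul1r.
  have YN := van _ _ qh0 qq qh1; rewrite qqh in YN.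
  have {YN} YN := YN (ltW hd).
  have D := dbl _ _ _ _ qh0 qs st tq qh1; rewrite qqh in D.
  apply: (le_trans (yc q s t qn qs (ltW st) tq)).
  have nts : 0 <= Ci * (n.+1%:R * (t - s)).
    by rewrite !mulr_ge0 ?(ltW Ci0) // subr_ge0 ltW.
  apply: (le_trans (ler_wpM2l nts YN)).
  have hn : n.+1%:R * h = 1 :> R by rewrite mulfV.
  apply: (@le_trans _ _ (Q * eta * W s t)); last first.
    by rewrite ler_wpM2l ?(croot_mono p1 Hc HH) // mulr_ge0 // ltW.
  set Wst := W s t in D *; set Wq := (X in _ * (eta * X) <= _) in D *.
  have -> : Ci * (n.+1%:R * (t - s)) * (eta * Wq) =
      Ci * eta * n.+1%:R * (Wq * (t - s)) by ring.
  have -> : Q * eta * Wst = Ci * eta * n.+1%:R * (Cd * (Wst * h)).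
    have E (x z : R) : Ci * eta * x * (Cd * (Wst * z)) = Ci * Cd * eta * Wst * (x * z).
      by ring.
    by rewrite E hn mulr1.
  by rewrite ler_wpM2l // !mulr_ge0 // ltW.
have locate s : 0 <= s -> s <= 1 -> exists2 q, (q <= n)%N & q%:R * h <= s <= q.+1%:R * h.
  move=> s0 s1; have [||q qn] := @find_cell _ (s * n.+1%:R) 0 n.+1; first by [].
    by apply/andP; split; [exact: mulr_ge0|rewrite add0r; exact: ler_piMl].
  rewrite !add0r => /andP[qs sq]; exists q => //.
  by rewrite /h ler_pdivrMr // qs ler_pdivlMr.
have split3 s t : 0 <= s -> s < t -> t <= 1 ->
    (exists q, [/\ (q <= n)%N, q%:R * h <= s & t <= q.+1%:R * h]) \/
    (exists k l, [/\ (k <= n)%N, (l <= n)%N, (k < l)%N,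
      k%:R * h <= s <= k.+1%:R * h & l%:R * h <= t <= l.+1%:R * h]).
  move=> s0 st t1; have [k kn kI] := locate s s0 (le_trans (ltW st) t1).
  have [l ln lI] := locate t (le_trans s0 (ltW st)) t1.
  have [lk|kl|kl] := ltngtP l k; last 2 first.
  - by right; exists k, l.
  - by left; exists k; case/andP: kI => ks _; case/andP: lI => _; rewrite kl.
  have : t <= s.
    case/andP: kI => ks _; case/andP: lI => _ tl; apply: (le_trans tl).
    by apply: le_trans ks; rewrite ler_pM2r // ler_nat.
  by rewrite leNgt st.
move=> s t s0 st t1.
have Wst : 0 < W s t by exact: (croot_gt0 Hc HH).
have [sle tle] := (ltW st, ltW st).
have XYst : N ((path_incr Y s t)^-1 * path_incr X s t) <=
    N (path_incr Y s t) + N (path_incr X s t).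
  rewrite -(hnormV HN (YI s0 (ltW st) t1)); apply: (hnormM HN).
    by apply: glikeV; apply: YI => //; exact: ltW.
  by apply: XI => //; exact: ltW.
case: (split3 s t s0 st t1) => [[q [qn qs tq]]|[k [l [kn ln kl]]]].
  have NX := cell eta1 d1 q s t s t near1 nd1 (ltW e1) qn qs (ltW st) tq s0 (lexx s) (lexx t) t1.
  have tsd : t - s <= d1.
    apply: (le_trans _ (ltW nd1)); rewrite -/h.
    have -> : h = q.+1%:R * h - q%:R * h by rewrite -mulrBl -nat1r addrK mul1r.
    by rewrite lerB.
  have NY := near1 s t s0 st t1 tsd.
  apply: (le_trans XYst); apply: (le_trans (lerD NY NX)).
  have -> : eta1 * W s t + Q * eta1 * W s t = (1 + Q) * eta1 * W s t by ring.
  rewrite ler_wpM2r ?(ltW Wst) // /eta1 mulrA ler_pdivrMr ?addr_gt0 ?mulr_gt0 //.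
  rewrite mulrC ler_wpM2l ?(ltW e0) //; lra.
move=> /andP[ks sk] /andP[lt tl].
set a := k.+1%:R * h in sk; set b := l%:R * h in lt.
have ab : a <= b by rewrite ler_pM2r // ler_nat.
have a0 : 0 <= a by exact: le_trans s0 sk.
have b0 : 0 <= b by exact: le_trans a0 ab.
have b1 : b <= 1 by exact: le_trans lt t1.
have a1 : a <= 1 by exact: le_trans ab b1.
have [sb at_] := (le_trans sk ab, le_trans ab lt).
have YU r : 0 <= r -> r <= 1 -> Y r \is a GRing.unit.
  by move=> r0 r1; apply/glike_unit/YG; rewrite r0.
have Xab : path_incr X a b = path_incr Y a b.
  rewrite /path_incr; congr (_^-1 * _); apply: yg => //.
  exact: leqW.
have Xsplit : path_incr X s t = path_incr X s a * path_incr Y a b * path_incr X b t.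
  by rewrite -Xab !path_incrM ?XU.
have Ysplit : path_incr Y s t = path_incr Y s a * path_incr Y a b * path_incr Y b t.
  by rewrite !path_incrM ?YU.
have gYsa := YI s0 sk a1; have gYab := YI a0 ab b1; have gYbt := YI b0 lt t1.
have gXsa := XI s a s0 sk; have gXbt := XI b t b0 lt.
have ah : a - s <= h.
  have -> : h = a - k%:R * h by rewrite /a -mulrBl -nat1r addrK mul1r.
  by rewrite lerD2l lerN2.
have bh : t - b <= h.
  have -> : h = l.+1%:R * h - b by rewrite /b -mulrBl -nat1r addrK mul1r.
  by rewrite lerD2r.
(* The denominator 2 Q + 2 of eta1 counts one share for Y on [s, t], one for the middle piece and Q
   for each end piece of X. *)
have [tsd1|tsd1] := leP (t - s) d1.
  apply: (le_trans XYst).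
  have NY := near1 s t s0 st t1 tsd1.
  have N1 := cell eta1 d1 k s a s t near1 nd1 (ltW e1) kn ks sk (lexx _) s0 (lexx s) at_ t1.
  have N3 := cell eta1 d1 l b t s t near1 nd1 (ltW e1) ln (lexx _) lt tl s0 sb (lexx t) t1.
  have bad : b - a <= d1 by apply: le_trans tsd1; rewrite lerB.
  have N2 := Ynear eta1 d1 a b s t near1 (ltW e1) s0 sk ab lt t1 bad.
  have NX : N (path_incr X s t) <= Q * eta1 * W s t + eta1 * W s t + Q * eta1 * W s t.
    rewrite Xsplit; apply: (le_trans (hnormM HN (glikeM gXsa gYab) gXbt)).
    by apply: lerD => //; apply: (le_trans (hnormM HN gXsa gYab)); exact: lerD.
  apply: (le_trans (lerD NY NX)).
  have -> : eta1 * W s t + (Q * eta1 * W s t + eta1 * W s t + Q * eta1 * W s t) =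
      (2 * Q + 2) * eta1 * W s t by ring.
  rewrite ler_wpM2r ?(ltW Wst) // /eta1 mulrCA mulfV ?mulr1 //.
  by rewrite gt_eqF // addr_gt0 // mulr_gt0.
pose A := (path_incr Y s a)^-1 * path_incr X s a.
have gA : glike A by apply: glikeM => //; exact: glikeV.
have -> : (path_incr Y s t)^-1 * path_incr X s t =
    (path_incr Y b t)^-1 * ((path_incr Y a b)^-1 * A * path_incr Y a b) * path_incr X b t.
  have [[u1 u2] u3] := (glike_unit gYsa, glike_unit gYab, glike_unit gYbt).
  rewrite Xsplit Ysplit (invrM (glike_unit (glikeM gYsa gYab)) u3) (invrM u1 u2).
  by rewrite /A !mulrA.
have e30 := ltW e3.
have h3 : h <= d3 := ltW nd3.
have NYbt := Ynear eta3 d3 b t s t near3 e30 s0 sb lt (lexx t) t1 (le_trans bh h3).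
have NXbt := cell eta3 d3 l b t s t near3 nd3 e30 ln (lexx _) lt tl s0 sb (lexx t) t1.
(* The pieces on [s, a] are compared with W 0 1, since A enters [conj] through an absolute bound;
   those on [b, t] stay outside the conjugation and are compared with W s t. *)
have NYsa := Ynear eta3 d3 s a 0 1 near3 e30 (lexx 0) s0 sk a1 (lexx 1) (le_trans ah h3).
have NXsa := cell eta3 d3 k s a 0 1 near3 nd3 e30 kn ks sk (lexx _) (lexx 0) s0 a1 (lexx 1).
have NA : N A <= eta2.
  apply: (le_trans (hnormM HN (glikeV gYsa) gXsa)); rewrite (hnormV HN) //.
  apply: (le_trans (lerD NYsa NXsa)).
  have -> : eta3 * W 0 1 + Q * eta3 * W 0 1 = eta3 * ((1 + Q) * W 0 1) by ring.
  by rewrite -ler_pdivlMr ?mulr_gt0 // ge_min lexx.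
have NYab : N (path_incr Y a b) <= M1.
  move: ab; rewrite le_eqVlt => /predU1P[<-|ab'].
    by rewrite /path_incr mulVr ?YU // (hnorm1 HN) mulr_ge0 ?powR_ge0.
  apply: (le_trans (YM a b a0 ab' b1)).
  apply: (@le_trans _ _ (`|M| * W a b)); first by rewrite ler_wpM2r ?powR_ge0 ?ler_norm.
  by rewrite ler_wpM2l // (croot_mono p1 Hc HH).
have NC := conj _ _ gYab gA NYab NA.
have NC' : N ((path_incr Y a b)^-1 * A * path_incr Y a b) <= eps / 2 * W s t.
  apply: (le_trans NC); rewrite ler_wpM2l ?divr_ge0 ?(ltW e0) //.
  by apply: le_trans (low s t s0 st t1); rewrite ler_wpM2l ?(ltW c0) // ltW.
have gC : glike ((path_incr Y a b)^-1 * A * path_incr Y a b).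
  by apply: glikeM => //; apply: glikeM => //; exact: glikeV.
apply: (le_trans (hnormM HN (glikeM (glikeV gYbt) gC) gXbt)).
apply: (le_trans (lerD (hnormM HN (glikeV gYbt) gC) (lexx _))).
rewrite (hnormV HN) //; apply: (le_trans (lerD (lerD NYbt NC') NXbt)).
have -> : eta3 * W s t + eps / 2 * W s t + Q * eta3 * W s t =
    (eta3 * (1 + Q) + eps / 2) * W s t by ring.
rewrite ler_wpM2r ?(ltW Wst) //.
have : eta3 * (1 + Q) <= eps / 2 by rewrite -ler_pdivlMr // ge_min lexx orbT.
lra.
Qed.

End Approximation.

(** * The two implications *)

Unset Implicit Arguments.

Theorem theorem20 (R : realType) (V : normedVectType R) (m : nat) (p : R)
    (N : ttensor R (\dim {:V}) m -> R) (omega : R -> R -> R)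
    (Y : R -> ttensor R (\dim {:V}) m) :
  (1 <= m)%N -> 1 <= p ->
  homogeneous_norm N ->
  control omega -> condition_H p omega ->
  vanishes_near_diag (fun s t => (t - s) / omega s t `^ p^-1) ->
  C_omega N omega p Y ->
  C0_omega N omega p Y <->
  vanishes_near_diag (fun s t => N (path_incr Y s t) / omega s t `^ p^-1).
Proof.
move=> _ p1 HN Hc HH van [YP Yfin].
have W0 s t : 0 <= s -> s < t -> t <= 1 -> 0 < omega s t `^ p^-1.
  exact: croot_gt0.
have YG t : 0 <= t <= 1 -> glike (Y t).
  by move=> tI; have [_ H _] := YP; apply/free_nilpotentE/H.
have Y0 : Y 0 = 1 by have [] := YP.
have YI s t : 0 <= s -> s < t -> t <= 1 -> glike (path_incr Y s t).
  move=> s0 st t1; apply: glikeM; [apply: glikeV|]; apply: YG.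
    by rewrite s0 (le_trans (ltW st)).
  by rewrite t1 (le_trans s0 (ltW st)).
have YN0 s t : 0 <= s -> s < t -> t <= 1 ->
    0 <= N (path_incr Y s t) / omega s t `^ p^-1.
  by move=> s0 st t1; rewrite divr_ge0 ?powR_ge0 // (hnorm_ge0 HN) //; exact: YI.
split=> [[_ Hx]|HY].
  apply/(vanishes_near_diagP YN0) => eps e0.
  have e2 : 0 < eps / 2 by rewrite divr_gt0.
  have [x xs xd] := Hx (eps / 2) e2.
  have [A A0 HA] := signature_hnorm_bound HN xs.
  have A1 : 0 < A + 1 by rewrite ltr_wpDl.
  have F0 s t : 0 <= s -> s < t -> t <= 1 -> 0 <= (t - s) / omega s t `^ p^-1.
    by move=> s0 st t1; rewrite divr_ge0 ?powR_ge0 // subr_ge0 ltW.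
  (* The hypothesis on (t - s) / omega^(1/p), taken at precision eps / 2 / (A + 1), absorbs the
     Lipschitz bound A (t - s) of the signature. *)
  have [delta d0 Hd] := (vanishes_near_diagP F0).1 van _ (divr_gt0 e2 A1).
  exists delta => // s t s0 st t1 tsd.
  have W := W0 s t s0 st t1.
  rewrite ler_pdivrMr //; have := Hd s t s0 st t1 tsd; rewrite ler_pdivrMr // => ts.
  have gY := YI s t s0 st t1.
  pose X := signature m x 0.
  have gX : glike (path_incr X s t).
    apply: glikeM; [apply: glikeV|]; apply: signature_glike => //.
    exact: le_trans s0 (ltW st).
  have Nd : N ((path_incr Y s t)^-1 * path_incr X s t) <= eps / 2 * omega s t `^ p^-1.
    rewrite -ler_pdivrMr // -lee_fin; apply: ltW; apply: le_lt_trans xd.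
    by apply: ereal_sup_ubound; exists (s, t).
  have -> : path_incr Y s t =
      path_incr X s t * ((path_incr Y s t)^-1 * path_incr X s t)^-1.
    have [uX uY] := (glike_unit gX, glike_unit gY).
    by rewrite invrM ?unitrV // invrK mulrA divrr // mul1r.
  have gD : glike ((path_incr Y s t)^-1 * path_incr X s t).
    by apply: glikeM => //; apply: glikeV.
  apply: (le_trans (hnormM HN gX (glikeV gD))); rewrite (hnormV HN gD).
  apply: (le_trans (lerD (HA s t s0 (ltW st) t1) Nd)).
  have AB : A * (t - s) <= eps / 2 * omega s t `^ p^-1.
    apply: (@le_trans _ _ ((A + 1) * (t - s))).
      by rewrite ler_wpM2r ?subr_ge0 ?(ltW st) // lerDl.
    by rewrite mulrC -ler_pdivlMr // mulrAC.
  by rewrite [leRHS](_ : _ = eps / 2 * omega s t `^ p^-1 + eps / 2 * omega s t `^ p^-1) ?lerD //; field.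
split=> // eps e0.
have [M HM] : exists M : R, forall s t, 0 <= s -> s < t -> t <= 1 ->
    N (path_incr Y s t) <= M * omega s t `^ p^-1.
  have : (norm_omega N omega p Y != +oo)%E by rewrite lt_eqF.
  have ub s t : 0 <= s -> s < t -> t <= 1 ->
      ((N (path_incr Y s t) / omega s t `^ p^-1)%:E <= norm_omega N omega p Y)%E.
    move=> s0 st t1; apply: ereal_sup_ubound; exists (s, t) => //=.
    rewrite /hdist [path_incr (cst 1) s t]/path_incr /= invr1 !mulr1.
    by rewrite (hnormV HN) //; exact: YI.
  move: ub; case: (norm_omega N omega p Y) => [r| |] // ub _.
    exists r => s t s0 st t1; have := ub s t s0 st t1.
    by rewrite lee_fin ler_pdivrMr // W0.
  (* The value -oo is excluded by the pair (0, 1). *)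
  by have := ub 0 1 (lexx _) ltr01 (lexx _).
(* Half of eps, because the supremum of the quotients must be strictly less than eps. *)
have e2 : 0 < eps / 2 by rewrite divr_gt0.
have Yv := (vanishes_near_diagP YN0).1 HY.
have [|y ys Hy] := approximation HN p1 Hc HH Y0 YG HM _ e2.
  move=> eta eta0; have [delta d0 Hd] := Yv eta eta0.
  exists delta => // s t s0 st t1 tsd.
  by have := Hd s t s0 st t1 tsd; rewrite ler_pdivrMr // W0.
exists y => //; apply: (@le_lt_trans _ _ (eps / 2)%:E); last first.
  by rewrite lte_fin ltr_pdivrMr // ltr_pMr // ltr1n.
apply: ge_ereal_sup => _ [[s t] /= [s0 st t1] <-].
by rewrite lee_fin ler_pdivrMr ?W0 //; exact: Hy.
Qed.
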